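(* Let $d\ge2$ and let $V:\mathbb R^d\to\mathbb R$ be isotropic ($V(x)$ depends only on $|x|$), belonging to $\mathscr V$ and to $\mathscr V_N$ on $\mathbb T_L^d$ for all $L$ sufficiently large. Then for all $L$ sufficiently large there is no lower critical point on $\mathbb T_L^d$: the lower transition point $\theta_T=\theta_T(L)$ satisfies $\theta_T<\theta^\sharp(L)$, and the transition at $\theta_T$ is discontinuous, i.e. there exists $\rho_{\theta_T}\in\mathscr P$, $\rho_{\theta_T}\ne\rho_0$, with $\mathcal F_{\theta_T}(\rho_{\theta_T})=\mathcal F_{\theta_T}(\rho_0)=\inf_{\mathscr P}\mathcal F_{\theta_T}$, $\mathcal E(\rho_{\theta_T},\rho_{\theta_T})<\mathcal E(\rho_0,\rho_0)$ and $\mathcal S(\rho_{\theta_T})>\mathcal S(\rho_0)$.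
   Context: $\mathbb T_L^d=\mathbb R^d/(L\mathbb Z)^d$. The class $\mathscr V$ consists of measurable $V:\mathbb R^d\to\mathbb R$ with $V\in L^1(\mathbb R^d)$, $V^-\in L^\infty$, $V(x)=V(-x)$, $V(x)=0$ for $|x|>a$, $0<a<L/2$; $V$ is periodized to $\mathbb T_L^d$ and $\hat V(k)=\int_{\mathbb T_L^d}V(x)e^{-ik\cdot x}dx$ for $k\in(2\pi/L)\mathbb Z^d$. $\mathscr V_N$ (on $\mathbb T_L^d$) = those $V$ with $\hat V(k)<0$ for some $k\neq0$; $\theta^\sharp(L)=|\min_{k\ne0}\hat V(k)|^{-1}$. $\mathscr P$ = probability densities on $\mathbb T_L^d$, $\rho_0\equiv L^{-d}$. $\mathcal S(\rho)=\int\rho\log\rho\,dx$, $\mathcal E(f,g)=\iint V(x-y)f(x)g(y)\,dx\,dy$, $\mathcal F_\theta=\mathcal S+\tfrac12\theta L^d\mathcal E(\cdot,\cdot)$. Lower transition point: $\theta_T=\sup\{\theta\ge0:\rho_0$ is the unique minimizer of $\mathcal F_{\theta'}$ for all $\theta'\le\theta\}$. A lower critical point $\theta_c$: (1) for $\theta\le\theta_c$, $\rho_0$ is the unique minimizer; (2) for $\theta>\theta_c$ a minimizer $\rho_\theta\ne\rho_0$ exists; (3) every such family satisfies $\limsup_{\theta\downarrow\theta_c}\|\rho_\theta-\rho_0\|_{L^1}=0$. *)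

(* Defs.v *)
(* R : realType, points of R^d are d.-tuple R
   (with the product Borel sigma-algebra of measurable_structure.v). *)
From HB Require Import structures.
From mathcomp Require Import all_boot all_order all_algebra.
From mathcomp Require Import all_classical all_reals all_analysis.
Set Implicit Arguments. Unset Strict Implicit. Unset Printing Implicit Defensive.
Import Order.TTheory GRing.Theory Num.Theory.
Import numFieldNormedType.Exports.
Local Open Scope classical_set_scope.
Local Open Scope ring_scope.

Section Defs.
Variable R : realType.

(* iint D n f = \int_{D^n} f  for f >= 0, computed as iterated one-dimensional
   Lebesgue integrals (each coordinate ranging over D). *)
Fixpoint iint (D : set R) (n : nat) : (n.-tuple R -> \bar R) -> \bar R :=
  match n return (n.-tuple R -> \bar R) -> \bar R with
  | 0 => fun f => f [tuple]
  | n'.+1 => fun f =>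
      (\int[@lebesgue_measure R]_(x in D) iint D (fun t => f (cons_tuple x t)))%E
  end.

Definition ppart (r : R) : \bar R := (Num.max r 0)%:E.

Definition sint (D : set R) (n : nat) (f : n.-tuple R -> R) : \bar R :=
  (iint D (fun x => ppart (f x)) - iint D (fun x => ppart (- f x)))%E.

(* the fundamental cell [0,L)^d of the torus T_L^d = R^d/(L Z)^d *)
Definition cell (L : R) : set R := [set x | 0 <= x < L].

Definition vsub d (x y : d.-tuple R) : d.-tuple R :=
  [tuple tnth x i - tnth y i | i < d].
Definition vopp d (x : d.-tuple R) : d.-tuple R := [tuple - tnth x i | i < d].
Definition vnorm d (x : d.-tuple R) : R := Num.sqrt (\sum_(i < d) tnth x i ^+ 2).

Definition isotropic d (V : d.-tuple R -> R) : Prop :=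
  forall x y, vnorm x = vnorm y -> V x = V y.

Definition inV (L : R) d (V : d.-tuple R -> R) : Prop :=
  [/\ measurable_fun setT V,
      (iint setT (fun x => (`|V x|)%:E) < +oo)%E,
      (exists M : R, iint setT
           (fun x => (\1_[set y | V y < - M] x)%:E) = 0%E),
      (forall x, V x = V (vopp x)) &
      (exists a : R, 0 < a < L / 2 /\ forall x, a < vnorm x -> V x = 0)].

(* periodization of V to T_L^d, evaluated at points z in (-L,L)^d (the only
   points where it is used: differences of two points of the cell [0,L)^d).
   For such z only the translates z + L n with n in {-1,0,1}^d can meet the
   support of V, so this finite sum is the lattice sum \sum_{n in Z^d} V(z+Ln). *)
Definition Vper (L : R) d (V : d.-tuple R -> R) (z : d.-tuple R) : R :=
  \sum_(n : d.-tuple 'I_3)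
     V [tuple tnth z i + L * ((tnth n i : nat)%:R - 1) | i < d].

(* Fourier coefficient \hat V(k) for k = (2 pi / L) m, m in Z^d.
   (V is even, so \hat V(k) = \int V(x) e^{-ik.x} dx is real and equals
   \int V(x) cos(k.x) dx.) *)
Definition kdot (L : R) d (m : d.-tuple int) (x : d.-tuple R) : R :=
  \sum_(i < d) (2 * pi / L * (tnth m i)%:~R) * tnth x i.
Definition Vhat (L : R) d (V : d.-tuple R -> R) (m : d.-tuple int) : R :=
  fine (sint (cell L) (fun x => Vper L V x * cos (kdot L m x))).

Definition nonzero_freq d (m : d.-tuple int) : Prop := exists i, tnth m i != 0.

Definition inVN (L : R) d (V : d.-tuple R -> R) : Prop :=
  exists m : d.-tuple int, nonzero_freq m /\ Vhat L V m < 0.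

Definition thetasharp (L : R) d (V : d.-tuple R -> R) : R :=
  (`| inf [set Vhat L V m | m in @nonzero_freq d] |)^-1.

Definition density (L : R) d (rho : d.-tuple R -> R) : Prop :=
  [/\ measurable_fun setT rho, forall x, 0 <= rho x &
      iint (cell L) (fun x => (rho x)%:E) = 1%E].

Definition rho0 (L : R) (d : nat) : d.-tuple R -> R := fun _ => L ^- d.
Arguments rho0 L d : clear implicits.

Definition L1dist (L : R) d (f g : d.-tuple R -> R) : \bar R :=
  iint (cell L) (fun x => (`|f x - g x|)%:E).
Definition same_density (L : R) d (f g : d.-tuple R -> R) : Prop :=
  L1dist L f g = 0%E.

Definition xlnx (r : R) : R := if r == 0 then 0 else r * ln r.

Definition entropy (L : R) d (rho : d.-tuple R -> R) : \bar R :=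
  sint (cell L) (fun x => xlnx (rho x)).

Definition energy (L : R) d (V : d.-tuple R -> R) (rho : d.-tuple R -> R)
  : \bar R :=
  (iint (cell L) (fun x => iint (cell L)
       (fun y => ppart (Vper L V (vsub x y) * rho x * rho y)))
   - iint (cell L) (fun x => iint (cell L)
       (fun y => ppart (- (Vper L V (vsub x y) * rho x * rho y)))))%E.

Definition Ftheta (L : R) d (V : d.-tuple R -> R) (theta : R)
  (rho : d.-tuple R -> R) : \bar R :=
  (entropy L rho + (theta * L ^+ d / 2)%:E * energy L V rho)%E.

Definition minimizer (L : R) d (V : d.-tuple R -> R) (theta : R)
  (rho : d.-tuple R -> R) : Prop :=
  density L rho /\ forall sigma, density L sigma ->
    (Ftheta L V theta rho <= Ftheta L V theta sigma)%E.

Definition unique_minimizer_rho0 (L : R) d (V : d.-tuple R -> R) (theta : R)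
  : Prop :=
  minimizer L V theta (rho0 L d) /\
  forall rho, minimizer L V theta rho -> same_density L rho (rho0 L d).

Definition thetaT (L : R) d (V : d.-tuple R -> R) : \bar R :=
  ereal_sup [set theta%:E | theta in
    [set theta : R | 0 <= theta /\
       forall theta', 0 <= theta' <= theta -> unique_minimizer_rho0 L V theta']].

Definition lower_critical_point (L : R) d (V : d.-tuple R -> R) (thc : R)
  : Prop :=
  [/\ forall theta, 0 <= theta <= thc -> unique_minimizer_rho0 L V theta,
      forall theta, thc < theta -> exists rho,
          minimizer L V theta rho /\ ~ same_density L rho (rho0 L d) &
      forall fam : R -> d.-tuple R -> R,
        (forall theta, thc < theta ->
           minimizer L V theta (fam theta) /\
           ~ same_density L (fam theta) (rho0 L d)) ->
        forall eps : R, 0 < eps -> exists2 delta : R, 0 < delta &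
          forall theta, thc < theta < thc + delta ->
            (L1dist L (fam theta) (rho0 L d) < eps%:E)%E].

End Defs.
Arguments rho0 {R} L d.

(* Main.v *)
(* With m = L^d and H(rho) the relative entropy of [rho] with respect to [rho0],
   F_theta(rho) - F_theta(rho0) = (H(rho) - theta G(rho)) / m, where G is the
   gain in interaction energy.  Hence the transition point is the infimum of
   H / G over the densities with G > 0.

   The infimum is attained and the transition is discontinuous as soon as it is
   smaller than theta# = 1 / lambda, with -lambda the minimum of the Fourier
   coefficients at nonzero frequencies.  Indeed the interaction is bounded below
   by -lambda on mean-zero functions, so for theta < theta# one has
   theta G <= H near [rho0]; a minimizing sequence of H / G therefore stays away
   from [rho0], and its weak limit is a nontrivial minimizer by lower
   semicontinuity of entropy and energy.

   The infimum is smaller than theta# on a large torus.  The Fourier transform of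
   an isotropic potential is radial and Lipschitz, so it is almost minimal at
   three lattice frequencies k1 + k2 + k3 = 0 close to an equilateral triangle.
   For eta = cos(k1.x) + cos(k2.x) + cos(k3.x) one has \int eta^3 >= 3/2 m, and
   the cubic term -eps^3/6 \int eta^3 of the relative entropy of
   (1 + eps eta) / m brings H / G below theta#. *)

(* A single wave gives the relative entropy no cubic term; three frequencies with zero sum do. The
   margin is quantitative: with amplitude 1/100, frequencies that are minimal up to a relative error
   of 1/10000 suffice, and these constants serve every large torus because the infimum over all real
   frequencies does not depend on [L]. The obstacle in the stability step is that [V] is only
   integrable and bounded below. A density of small relative entropy may have high peaks and a
   deviation that is not square integrable, so the spectral bound applies only to a truncated
   deviation. Truncation destroys the zero mean, hence the extra penalty on the mean in [coercive].
   Weak limits are taken along an ultrafilter, along which all bounded real sequences converge at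
   once, so no subsequence is extracted. The spectral bound passes from trigonometric polynomials to
   bounded measurable functions by closing under bounded pointwise limits, which dominated
   convergence respects. *)
Require Import Defs.
From HB Require Import structures.
From mathcomp Require Import all_boot all_order all_algebra.
From mathcomp Require Import all_classical all_reals all_analysis.
From mathcomp Require Import measurable_realfun ring lra.
Set Implicit Arguments. Unset Strict Implicit. Unset Printing Implicit Defensive.
Import Order.TTheory GRing.Theory Num.Theory.
Import numFieldNormedType.Exports.
Local Open Scope classical_set_scope.
Local Open Scope ring_scope.

(** * Lebesgue measure on tuples *)

Section PushIso.
Context {d1 d2 : measure_display} {T1 : measurableType d1}
  {T2 : measurableType d2} {R : realType}.
Variables (m : {sigma_finite_measure set T1 -> \bar R}).
Variables (f : T1 -> T2) (g : T2 -> T1).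
Hypotheses (mf : measurable_fun setT f) (mg : measurable_fun setT g).
Hypotheses (fK : cancel f g) (gK : cancel g f).

(** The proofs are arguments so that the measure structures can be attached to this head symbol:
    sigma-finiteness of the image needs the measurable inverse to transport the exhausting sets. *)
Definition push_iso of measurable_fun setT f & measurable_fun setT g
  & cancel f g & cancel g f : set T2 -> \bar R := pushforward m f.

Local Notation nu := (push_iso mf mg fK gK).

Let nu0 : nu set0 = 0%E.
Proof. by rewrite /push_iso /pushforward preimage_set0 measure0. Qed.

Let nu_ge0 A : (0 <= nu A)%E. Proof. exact: measure_ge0. Qed.

Let nu_sigma_additive : semi_sigma_additive nu.
Proof.
move=> F mF tF mUF; rewrite /push_iso /pushforward preimage_bigcup.
apply: measure_semi_sigma_additive.
- by move=> n; rewrite -[X in measurable X]setTI; exact: mf.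
- apply/trivIsetP => /= i j _ _ ij; rewrite -preimage_setI.
  by move/trivIsetP : tF => /(_ _ _ _ _ ij) ->//; rewrite preimage_set0.
- by rewrite -preimage_bigcup -[X in measurable X]setTI; exact: mf.
Qed.

HB.instance Definition _ := isMeasure.Build _ _ _ nu nu0 nu_ge0
  nu_sigma_additive.

Let nu_sigma_finite : sigma_finite setT nu.
Proof.
have [F TF Foo] := sigma_finiteT m.
exists (fun n => g @^-1` F n).
  by rewrite -preimage_bigcup -TF preimage_setT.
move=> k; have [mFk Fkoo] := Foo k; split.
  by rewrite -[X in measurable X]setTI; exact: mg.
rewrite /push_iso /pushforward -comp_preimage.
by rewrite (_ : g \o f = idfun) ?preimage_id//; apply/funext => x /=; rewrite fK.
Qed.

HB.instance Definition _ := Measure_isSigmaFinite.Build _ _ _ nu nu_sigma_finite.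

Lemma ge0_integral_push_iso (h : T2 -> \bar R) :
  measurable_fun setT h -> (forall y, (0 <= h y)%E) ->
  (\int[nu]_y h y = \int[m]_x h (f x))%E.
Proof.
move=> mh h0; rewrite -(@ge0_integral_pushforward _ _ _ _ _ _ mf m setT h)//.
Qed.
End PushIso.

Section RestrictedMeasure.
Context {d : measure_display} {T : measurableType d} {R : realType}.
Variables (m : {sigma_finite_measure set T -> \bar R}) (D : set T).
Hypothesis mD : measurable D.

Definition sigma_restr : set T -> \bar R := mrestr m mD.
Local Notation nu := sigma_restr.
HB.instance Definition _ := Measure.on nu.

Let nu_sigma_finite : sigma_finite setT nu.
Proof.
have [F TF Foo] := sigma_finiteT m.
exists F => // k; have [mFk Fkoo] := Foo k; split => //.
rewrite /sigma_restr /mrestr (le_lt_trans _ Fkoo)// le_measure ?inE//.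
exact: measurableI.
Qed.
HB.instance Definition _ := Measure_isSigmaFinite.Build _ _ _ nu nu_sigma_finite.

Lemma ge0_integral_sigma_restr (h : T -> \bar R) :
  measurable_fun setT h -> (forall y, (0 <= h y)%E) ->
  (\int[nu]_y h y = \int[m]_(x in D) h x)%E.
Proof.
move=> mh h0; rewrite -(setUv D) ge0_integral_setU//=; last 3 first.
- exact: measurableC.
- exact: measurable_funTS.
- exact/disj_setPCl.
rewrite [X in (_ + X)%E](_ : _ = 0%E) ?adde0.
  apply: eq_measure_integral => A mA AD.
  by rewrite /= /sigma_restr /mrestr setIidl.
apply: null_set_integral => //.
- exact: measurableC.
- exact: measurable_funTS.
- by rewrite /= /sigma_restr /mrestr setICl measure0.
Qed.
End RestrictedMeasure.

(* The canonical sigma-finite structure on [m1 \x m2] only applies to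
   subprobabilities, hence this alias. *)
Section SigmaFiniteProd.
Context {d1 d2 : measure_display} {T1 : measurableType d1}
  {T2 : measurableType d2} {R : realType}.
Variables (m1 : {sigma_finite_measure set T1 -> \bar R}).
Variables (m2 : {sigma_finite_measure set T2 -> \bar R}).

Definition sigma_prod : set (T1 * T2)%type -> \bar R := (m1 \x m2)%E.
HB.instance Definition _ := Measure.on sigma_prod.

Let sigma_prod_sigma_finite : sigma_finite setT sigma_prod.
Proof.
have /sigma_finiteP[F [TF ndF Foo]] := sigma_finiteT m1.
have /sigma_finiteP[G [TG ndG Goo]] := sigma_finiteT m2.
exists (fun n => F n `*` G n).
  apply/seteqP; split=> // -[x y] _.
  have [i _ Fx] : (\bigcup_k F k) x by rewrite -TF.
  have [j _ Gy] : (\bigcup_k G k) y by rewrite -TG.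
  by exists (maxn i j) => //; split => /=;
    [apply/(subsetPset _ _ (ndF _ _ (leq_maxl i j)))|
     apply/(subsetPset _ _ (ndG _ _ (leq_maxr i j)))].
move=> k; have [? ?] := Foo k; have [? ?] := Goo k.
split; first exact: measurableX.
by rewrite /sigma_prod product_measure1E// lte_mul_pinfty// ge0_fin_numE.
Qed.
HB.instance Definition _ := Measure_isSigmaFinite.Build _ _ _ sigma_prod
  sigma_prod_sigma_finite.
End SigmaFiniteProd.

Section PowerMeasure.
Context {d : measure_display} {T : measurableType d} {R : realType}.

Definition cons_pair n (p : T * n.-tuple T) : n.+1.-tuple T := cons_tuple p.1 p.2.
Definition uncons n (t : n.+1.-tuple T) : T * n.-tuple T :=
  (thead t, [tuple of behead t]).

Lemma measurable_cons_pair n : measurable_fun setT (@cons_pair n).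
Proof. by apply: measurable_cons; [exact: measurable_fst|exact: measurable_snd]. Qed.

Lemma measurable_uncons n : measurable_fun setT (@uncons n).
Proof.
by apply: measurable_fun_pair; [exact: measurable_tnth|exact: measurable_behead].
Qed.

Lemma cons_pairK n : cancel (@cons_pair n) (@uncons n).
Proof. by move=> [x t]; congr pair; apply/val_inj. Qed.

Lemma unconsK n : cancel (@uncons n) (@cons_pair n).
Proof. by move=> t; rewrite [RHS]tuple_eta; apply/val_inj. Qed.

Variable m : {sigma_finite_measure set T -> \bar R}.

(** Peels off the head coordinate exactly as [iint] does, so that the two can be compared by
    induction; sigma-finiteness is carried along because Tonelli requires it at each stage. *)
Fixpoint power_measure n : {sigma_finite_measure set (n.-tuple T) -> \bar R} :=
  if n is n'.+1 then push_iso (sigma_prod m (power_measure n')) (@measurable_cons_pair n')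
     (@measurable_uncons n') (@cons_pairK n') (@unconsK n')
  else dirac [tuple].

Lemma ge0_integral_power0 (h : 0.-tuple T -> \bar R) :
  measurable_fun setT h -> (forall y, (0 <= h y)%E) ->
  (\int[power_measure 0]_y h y = h [tuple])%E.
Proof. by move=> mh h0; rewrite integral_dirac// diracT mul1e. Qed.

Lemma ge0_integral_powerS n (h : n.+1.-tuple T -> \bar R) :
  measurable_fun setT h -> (forall y, (0 <= h y)%E) ->
  (\int[power_measure n.+1]_y h y =
   \int[m]_x \int[power_measure n]_t h (cons_tuple x t))%E.
Proof.
move=> mh h0; rewrite [LHS]ge0_integral_push_iso//.
rewrite fubini_tonelli1//.
by apply: measurableT_comp => //; exact: measurable_cons_pair.
Qed.

End PowerMeasure.

Section LebesgueReal.
Variable R : realType.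
Local Notation idR := (idfun : measurableTypeR R -> R).
Local Notation idR' := (idfun : R -> measurableTypeR R).

Lemma measurable_idR : measurable_fun setT idR.
Proof. by move=> _ A mA; rewrite setTI preimage_id. Qed.
Lemma measurable_idR' : measurable_fun setT idR'.
Proof. by move=> _ A mA; rewrite setTI preimage_id. Qed.

(** Lebesgue measure is carried by the type [measurableTypeR R], whereas the product structure on
    tuples starts from [R] itself; pushing along the identity moves it there. *)
Definition lebR : {sigma_finite_measure set R -> \bar R} :=
  push_iso (@lebesgue_measure R) measurable_idR measurable_idR'
    (fun=> erefl) (fun=> erefl).

Lemma ge0_integral_lebR (f : R -> \bar R) : measurable_fun setT f ->
  (forall x, (0 <= f x)%E) ->
  (\int[lebR]_x f x = \int[@lebesgue_measure R]_x f x)%E.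
Proof. by move=> mf f0; rewrite ge0_integral_push_iso. Qed.

Lemma ge0_integral_lebR_in (D : set R) (f : R -> \bar R) : measurable D ->
  measurable_fun setT f -> (forall x, (0 <= f x)%E) ->
  (\int[lebR]_(x in D) f x = \int[@lebesgue_measure R]_(x in D) f x)%E.
Proof.
move=> mD mf f0; rewrite integral_mkcond [RHS]integral_mkcond.
apply: ge0_integral_lebR; first by apply/(measurable_restrictT _ _).1 => //; exact: measurable_funTS.
by move=> x; rewrite patchE; case: ifP.
Qed.


Lemma lebR_oc (a b : R) : lebR `]a, b]%classic = (Num.max (b - a) 0)%:E.
Proof.
rewrite /lebR /= /push_iso /pushforward preimage_id lebesgue_measure_itv /=.
rewrite lte_fin; case: ifPn => [ab|]; first by rewrite max_l ?subr_ge0 ?ltW.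
by rewrite -leNgt => ba; rewrite max_r// subr_le0.
Qed.

Lemma lebR_unique (mu : {measure set R -> \bar R}) :
  (forall a b, mu `]a, b]%classic = (Num.max (b - a) 0)%:E) ->
  forall A, measurable A -> lebR A = mu A.
Proof.
move=> muE A mA; rewrite /lebR /= /push_iso /pushforward preimage_id.
pose nu := measure_function_pushforward__canonical__measure_function_Measure
  mu measurable_idR'.
apply: (@lebesgue_measure_unique R nu) => // _ [[a b] _ <-].
transitivity (lebR `]a, b]%classic); last by rewrite lebR_oc -muE.
by rewrite /lebR /= /push_iso /pushforward preimage_id.
Qed.

Lemma ge0_integral_lebR_shift (c : R) (f : R -> \bar R) :
  measurable_fun setT f -> (forall x, (0 <= f x)%E) ->
  (\int[lebR]_x f (x + c)%R = \int[lebR]_x f x)%E.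
Proof.
move=> mf f0.
have ms : measurable_fun setT (fun x : R => x + c) by exact: measurable_funD.
rewrite -(@ge0_integral_pushforward _ _ _ _ _ _ ms lebR setT f)//.
apply: eq_measure_integral => A mA _; rewrite -lebR_unique// => a b.
rewrite /= /pushforward (_ : _ @^-1` _ = `]a - c, b - c]%classic); last first.
  by apply/seteqP; split => x /=; rewrite !in_itv/= ltrBlDr lerBrDr.
by rewrite lebR_oc; congr (Num.max _ _)%:E; ring.
Qed.

Lemma ge0_integral_lebRN (f : R -> \bar R) :
  measurable_fun setT f -> (forall x, (0 <= f x)%E) ->
  (\int[lebR]_x f (- x)%R = \int[lebR]_x f x)%E.
Proof.
move=> mf f0.
have ms : measurable_fun setT (fun x : R => - x) by exact: measurableT_comp.
rewrite -(@ge0_integral_pushforward _ _ _ _ _ _ ms lebR setT f)//.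
apply: eq_measure_integral => A mA _; exact: lebesgue_measureN.
Qed.

Lemma ge0_integral_lebR_affine (s c : R) (f : R -> \bar R) :
  measurable_fun setT f -> (forall x, (0 <= f x)%E) -> s = 1 \/ s = -1 ->
  (\int[lebR]_x f (s * x + c)%R = \int[lebR]_x f x)%E.
Proof.
move=> mf f0 [] ->.
  by under eq_integral do rewrite mul1r; exact: ge0_integral_lebR_shift.
under eq_integral do rewrite mulN1r.
rewrite (@ge0_integral_lebRN (fun x => f (x + c)))//; last first.
  by apply: measurableT_comp => //; exact: measurable_funD.
exact: ge0_integral_lebR_shift.
Qed.
End LebesgueReal.

Section PowerLebesgue.
Variable R : realType.

Lemma measurable_cons_tuple d (T : measurableType d) n (x : T) :
  measurable_fun setT (@cons_tuple n T x).
Proof. by apply: measurable_cons => //; exact: measurable_cst. Qed.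

Lemma measurable_integral_cons d (T : measurableType d) n
    (m : {sigma_finite_measure set (n.-tuple T) -> \bar R})
    (h : n.+1.-tuple T -> \bar R) :
  measurable_fun setT h -> (forall y, (0 <= h y)%E) ->
  measurable_fun setT (fun x => \int[m]_t h (cons_tuple x t))%E.
Proof.
move=> mh h0.
apply: (@measurable_fun_fubini_tonelli_F _ _ _ _ _ m (h \o @cons_pair _ T n)) => //; last by move=> p /=.
by apply: measurableT_comp => //; exact: measurable_cons_pair.
Qed.

Section InCell.
Variables (D : set R) (mD : measurable D).
Definition cell_measure n := power_measure (sigma_restr (lebR R) mD) n.

(** The bridge between the iterated integrals of the definitions and a genuine measure, to which
    dominated convergence, Fubini and Radon-Nikodym apply. *)
Lemma iintE n (f : n.-tuple R -> \bar R) : measurable_fun setT f ->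
  (forall x, (0 <= f x)%E) -> (iint D f = \int[cell_measure n]_x f x)%E.
Proof.
elim: n f => [|n IHn] f mf f0; first by rewrite ge0_integral_power0.
rewrite [RHS]ge0_integral_powerS//.
have mF := measurable_integral_cons (cell_measure n) mf f0.
rewrite [RHS]ge0_integral_sigma_restr//; last by move=> x; exact: integral_ge0.
rewrite ge0_integral_lebR_in//; last by move=> x; exact: integral_ge0.
apply: eq_integral => x _; apply: IHn => //.
by apply: measurableT_comp => //; exact: measurable_cons_tuple.
Qed.

Definition box n : set (n.-tuple R) := [set x | forall i, D (tnth x i)].

Lemma measurable_box n : measurable (@box n).
Proof.
rewrite (_ : @box n = \bigcap_(i in [set: 'I_n]) ((fun x => tnth x i) @^-1` D)).
  apply: fin_bigcap_measurable => // i _; rewrite -[X in measurable X]setTI.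
  exact: measurable_tnth.
by apply/seteqP; split => x /= Dx i; [move=> _|]; exact: Dx.
Qed.

Lemma box_cons n x (t : n.-tuple R) : box (cons_tuple x t) <-> D x /\ box t.
Proof.
split=> [Dxt|[Dx Dt] i].
  by split=> [|i]; [have := Dxt ord0; rewrite tnth0|have := Dxt (lift ord0 i); rewrite tnthS].
by case: (unliftP ord0 i) => [j ->|->]; rewrite ?tnthS ?tnth0.
Qed.

(** By induction: if the head lies outside [D], no tail completes it to a point of the box, and both
    inner integrals vanish. *)
Lemma ge0_integral_cell_measure n (f : n.-tuple R -> \bar R) :
  measurable_fun setT f -> (forall x, (0 <= f x)%E) ->
  (\int[cell_measure n]_x f x = \int[power_measure (lebR R) n]_(x in @box n) f x)%E.
Proof.
have mr k (g : k.-tuple R -> \bar R) : measurable_fun setT g ->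
    measurable_fun setT (g \_ (@box k)).
  move=> mg; apply/(measurable_restrictT _ _).1; first exact: measurable_box.
  exact: measurable_funTS.
have r0 k (g : k.-tuple R -> \bar R) : (forall x, (0 <= g x)%E) ->
    forall x, (0 <= (g \_ (@box k)) x)%E.
  by move=> g0 x; rewrite patchE; case: ifP.
elim: n f => [|n IHn] f mf f0; rewrite [RHS]integral_mkcond.
  rewrite !ge0_integral_power0//; [|exact: mr|exact: r0].
  by rewrite patchE mem_set// => -[].
rewrite /cell_measure [LHS]ge0_integral_powerS// -/(cell_measure n).
rewrite [RHS]ge0_integral_powerS; [|exact: mr|exact: r0].
rewrite [LHS]ge0_integral_sigma_restr; last 2 first.
- exact: measurable_integral_cons.
- by move=> x; exact: integral_ge0.
rewrite [LHS]integral_mkcond; apply: eq_integral => x _; rewrite patchE.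
case: ifPn => [|] xD.
  have mx : measurable_fun setT (f \o cons_tuple x).
    by apply: measurableT_comp => //; exact: measurable_cons_tuple.
  rewrite [LHS](IHn (f \o cons_tuple x) mx (fun t => f0 (cons_tuple x t))).
  rewrite [LHS]integral_mkcond.
  apply: eq_integral => t _; rewrite !patchE.
  have -> // : (cons_tuple x t \in @box n.+1) = (t \in @box n).
  apply/idP/idP => [/[!inE]/box_cons[]//|/[!inE] bt].
  by apply/box_cons; split => //; rewrite inE in xD.
rewrite integral0_eq// => t _; rewrite patchE ifF//; apply/negbTE; move: xD.
by apply: contra; rewrite !inE => /box_cons[].
Qed.
End InCell.

Lemma ge0_integral_power_affine n (s : R) (c : n.-tuple R) (f : n.-tuple R -> \bar R) :
  measurable_fun setT f -> (forall x, (0 <= f x)%E) -> s = 1 \/ s = -1 ->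
  (\int[power_measure (lebR R) n]_x f [tuple (s * tnth x i + tnth c i)%R | i < n]
   = \int[power_measure (lebR R) n]_x f x)%E.
Proof.
move=> + + s1; elim: n c f => [|n IHn] c f mf f0.
  by apply: eq_integral => x _; congr f; apply: eq_from_tnth => -[].
have mT : measurable_fun setT
    (fun x : n.+1.-tuple R => [tuple (s * tnth x i + tnth c i)%R | i < n.+1]).
  apply/measurable_fun_tnthP => i; apply: (eq_measurable_fun
    (fun x : n.+1.-tuple R => s * tnth x i + tnth c i)).
    by move=> x _ /=; rewrite tnth_mktuple.
  apply: measurable_funD => //; apply: measurable_funM => //.
  exact: measurable_tnth.
rewrite [RHS]ge0_integral_powerS// ge0_integral_powerS//; last first.
  exact: (@measurableT_comp _ _ _ _ _ _ f).
rewrite -[RHS](@ge0_integral_lebR_affine R s (thead c))//; last 2 first.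
- exact: measurable_integral_cons.
- by move=> x; exact: integral_ge0.
apply: eq_integral => x _.
rewrite -[RHS](IHn [tuple of behead c])//; last first.
  by apply: measurableT_comp => //; exact: measurable_cons_tuple.
apply: eq_integral => t _; congr f; apply: eq_from_tnth => i.
rewrite tnth_mktuple; case: (unliftP ord0 i) => [j ->|->].
  rewrite !tnthS /= tnth_mktuple (tuple_eta c) tnthS.
  by rewrite [in RHS](tuple_eta c)/=; congr (_ * _ + tnth _ _); apply: val_inj.
by rewrite !tnth0 (tuple_eta c) tnth0.
Qed.

Definition tuple_upd n (i : 'I_n) (a : R) (x : n.-tuple R) : n.-tuple R :=
  [tuple if j == i then a else tnth x j | j < n].

(** Cavalieri's principle: with the other coordinates frozen, the map is a translation of coordinate
    [i]. Rotations are later written as products of such maps. *)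
Lemma ge0_integral_power_shear n (i : 'I_n) (phi : n.-tuple R -> R)
    (f : n.-tuple R -> \bar R) :
  measurable_fun setT phi -> (forall a x, phi (tuple_upd i a x) = phi x) ->
  measurable_fun setT f -> (forall x, (0 <= f x)%E) ->
  (\int[power_measure (lebR R) n]_x f (tuple_upd i (tnth x i + phi x)%R x)
   = \int[power_measure (lebR R) n]_x f x)%E.
Proof.
elim: n i phi f => [[]//|n IHn] i phi f mphi phiE mf f0.
have mT : measurable_fun setT
    (fun x : n.+1.-tuple R => tuple_upd i (tnth x i + phi x) x).
  apply/measurable_fun_tnthP => k; apply: (eq_measurable_fun
    (fun x : n.+1.-tuple R => if k == i then tnth x i + phi x else tnth x k)).
    by move=> x _ /=; rewrite tnth_mktuple.
  case: eqP => _; last exact: measurable_tnth.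
  by apply: measurable_funD => //; exact: measurable_tnth.
rewrite [RHS]ge0_integral_powerS// ge0_integral_powerS//; last first.
  exact: (@measurableT_comp _ _ _ _ _ _ f).
case: (unliftP ord0 i) phiE mT => [j ->|->] phiE mT.
  apply: eq_integral => x _.
  rewrite -[RHS](IHn j (phi \o cons_tuple x))//=.
  - apply: eq_integral => t _; congr f; apply: eq_from_tnth => k.
    rewrite tnth_mktuple; case: (unliftP ord0 k) => [l ->|->].
      by rewrite !tnthS tnth_mktuple (inj_eq lift_inj).
    by rewrite !tnth0 (negbTE (neq_lift _ _)).
  - by apply: measurableT_comp => //; exact: measurable_cons_tuple.
  - move=> a t; rewrite -(phiE a (cons_tuple x t)); congr phi.
    apply: eq_from_tnth => k.
    rewrite tnth_mktuple; case: (unliftP ord0 k) => [l ->|->].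
      by rewrite !tnthS tnth_mktuple (inj_eq lift_inj).
    by rewrite !tnth0 (negbTE (neq_lift _ _)).
  - by apply: measurableT_comp => //; exact: measurable_cons_tuple.
pose psi t := phi (cons_tuple 0 t).
have mpsi : measurable_fun setT psi.
  by apply: measurableT_comp => //; exact: measurable_cons_tuple.
have updE x t : tuple_upd ord0 (tnth (cons_tuple x t) ord0 + phi (cons_tuple x t))
   (cons_tuple x t) = cons_tuple (x + psi t) t.
  apply: eq_from_tnth => k.
  rewrite tnth_mktuple; case: (unliftP ord0 k) => [l ->|->].
    by rewrite !tnthS eq_sym (negbTE (neq_lift _ _)).
  rewrite eqxx !tnth0 /psi -(phiE 0); congr (_ + phi _).
  apply: eq_from_tnth => k'.
  rewrite tnth_mktuple; case: (unliftP ord0 k') => [l ->|->].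
    by rewrite !tnthS eq_sym (negbTE (neq_lift _ _)).
  by rewrite eqxx !tnth0.
under eq_integral do under eq_integral do rewrite updE.
have mcp := @measurable_cons_pair _ R n.
pose q (p : R * n.-tuple R) := cons_tuple (p.1 + psi p.2) p.2.
have mq : measurable_fun setT q.
  apply: (measurable_cons (f := fun p : R * n.-tuple R => (p.1 + psi p.2))).
    apply: measurable_funD; first exact: measurable_fst.
    by apply: measurableT_comp => //; exact: measurable_snd.
  exact: measurable_snd.
(* Tonelli exchanges the order so that the sheared head coordinate is integrated first, where the
   shift [psi t] is a constant. *)
rewrite (@fubini_tonelli _ _ _ _ _ (lebR R) (power_measure (lebR R) n)
   (f \o q)); last 2 first.
- exact: (@measurableT_comp _ _ _ _ _ _ f setT q mf mq).
- by move=> p /=.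
rewrite [RHS](@fubini_tonelli _ _ _ _ _ (lebR R) (power_measure (lebR R) n)
   (f \o @cons_pair _ R n)); last 2 first.
- exact: (@measurableT_comp _ _ _ _ _ _ f setT _ mf mcp).
- by move=> p /=.
apply: eq_integral => t _ /=.
apply: (@ge0_integral_lebR_shift R (psi t) (fun x => f (cons_tuple x t))) => //.
apply: measurableT_comp => //.
by apply: measurable_cons => //; exact: measurable_cst.
Qed.
End PowerLebesgue.

(** * Relative entropy *)

Section RealIneq.
Variable R : realType.

(** The mean value theorem on either side of [x0]. It is applied below with [x0 = 1], where the two
    sides of each logarithmic inequality agree. *)
Lemma le_of_derive_sign (f f' : R -> R) (x0 x : R) :
  (forall y, Num.min x0 x <= y <= Num.max x0 x -> is_derive y 1 f (f' y)) ->
  (forall y, Num.min x0 x <= y <= Num.max x0 x -> 0 <= (y - x0) * f' y) ->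
  f x0 <= f x.
Proof.
move=> df sf.
have mvt a b : a < b -> Num.min x0 x = a -> Num.max x0 x = b ->
    exists2 y, a < y < b & f b - f a = f' y * (b - a) /\ 0 <= (y - x0) * f' y.
  move=> ab ma mb; rewrite ma mb in df sf.
  have dfI y : y \in `]a, b[ -> is_derive y 1 f (f' y).
    by rewrite in_itv/= => /andP[/ltW ay /ltW yb]; apply: df; rewrite ay.
  have cf : {within `[a, b], continuous f}.
    apply: derivable_within_continuous => y; rewrite in_itv/= => yI.
    by have /@ex_derive := df y yI.
  have [y] := MVT ab dfI cf; rewrite in_itv/= => /andP[ay yb] fE.
  by exists y; rewrite ?ay// fE; split => //; apply: sf; rewrite !ltW.
have [x0x|xx0|->//] := ltgtP x0 x.
- have [||y /andP[x0y _] [fE]] := mvt _ _ x0x.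
  + by rewrite min_l// ltW.
  + by rewrite max_r// ltW.
  rewrite pmulr_rge0 ?subr_gt0// => f'0.
  by rewrite -subr_ge0 fE mulr_ge0// subr_ge0 ltW.
- have [||y /andP[_ yx0] [fE]] := mvt _ _ xx0.
  + by rewrite min_r// ltW.
  + by rewrite max_l// ltW.
  rewrite nmulr_rge0 ?subr_lt0// => f'0.
  by rewrite -subr_le0 fE mulr_le0_ge0// subr_ge0 ltW.
Qed.

Section DeriveRules.
Variables (y : R) (f g : R -> R) (a b : R).
Hypotheses (df : is_derive y 1 f a) (dg : is_derive y 1 g b).

Lemma derive1D : is_derive y 1 (fun w => f w + g w) (a + b).
Proof. exact: (is_deriveD df dg). Qed.

Lemma derive1B : is_derive y 1 (fun w => f w - g w) (a - b).
Proof. exact: (is_deriveB df dg). Qed.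

Lemma derive1M : is_derive y 1 (fun w => f w * g w) (f y * b + g y * a).
Proof. exact: (is_deriveM df dg). Qed.
End DeriveRules.

Lemma derive1Z (c y : R) (f : R -> R) (a : R) :
  is_derive y 1 f a -> is_derive y 1 (fun w => c * f w) (c * a).
Proof. by move=> df; exact: (is_deriveZ c df). Qed.

Lemma derive1_subX (y : R) n :
  is_derive y 1 (fun w => (w - 1) ^+ n.+1) (n.+1%:R * (y - 1) ^+ n).
Proof.
have d1 : is_derive y 1 (fun w : R => w - 1) 1.
  by have := derive1B (@is_derive_id R R^o y 1) (is_derive_cst (1 : R^o) (y : R^o) (1 : R^o)); rewrite subr0.
have -> : (fun w : R => (w - 1) ^+ n.+1) = (fun w : R => w - 1) ^+ n.+1.
  by apply/funext => w; rewrite exprfctE.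
by have := is_deriveX n.+1 d1; rewrite /GRing.scale/= mulr1.
Qed.

Lemma derive1_xlnx (y : R) : 0 < y ->
  is_derive y 1 (fun w => w * ln w - w + 1) (ln y).
Proof.
move=> y0; have dl := is_derive1_ln y0.
have di := @is_derive_id R R^o y 1.
have := derive1D (derive1B (derive1M di dl) di) (is_derive_cst (1 : R^o) (y : R^o) (1 : R^o)).
by rewrite mulfV ?gt_eqF// mulr1 addr0 [1 + _]addrC addrK.
Qed.

Lemma xlnxE (r : R) : xlnx r = r * ln r.
Proof. by rewrite /xlnx; case: eqP => [->|//]; rewrite mul0r. Qed.

Lemma ln_le_sub1 (u : R) : 0 < u -> ln u <= u - 1.
Proof. by move=> u0; rewrite -{1}(subrKC 1 u) le_ln1Dx// ltrBrDl addrN. Qed.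

Lemma ln_ge_sub1 (u : R) : 0 < u -> 1 - u^-1 <= ln u.
Proof.
move=> u0; have := @ln_le_sub1 u^-1; rewrite invr_gt0 lnV ?posrE// => /(_ u0).
lra.
Qed.

(** Density of the relative entropy. For [u = m * rho] the affine part integrates to zero, and it
    makes the integrand nonnegative with 1 as its only zero. *)
Definition hrel (u : R) : R := xlnx u - u + 1.

(** For [u > 0] this is [1 - w^-1 <= ln w] at [w = u / v]. Supporting lines give both the uniform
    integrability and the lower semicontinuity of the entropy. *)
Lemma hrel_tangent (u v : R) : 0 <= u -> 0 < v ->
  hrel v + ln v * (u - v) <= hrel u.
Proof.
rewrite /hrel !xlnxE le_eqVlt => /predU1P[<-|u0] v0; first lra.
suff : u - v <= u * (ln u - ln v) by lra.
have -> : ln u - ln v = ln (u / v) by rewrite ln_div ?posrE.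
have := ln_ge_sub1 (divr_gt0 u0 v0); rewrite invf_div => /(ler_wpM2l (ltW u0)).
by rewrite mulrBr mulr1 mulrCA divff ?mulr1// gt_eqF.
Qed.

Lemma hrel1 : hrel 1 = 0.
Proof. by rewrite /hrel xlnxE ln1; lra. Qed.

Lemma hrel_ge0 (u : R) : 0 <= u -> 0 <= hrel u.
Proof.
by move=> u0; have := hrel_tangent u0 ltr01; rewrite ln1 hrel1; lra.
Qed.

(** The second derivative [1 / u] is at least [1 / (1 + k)], hence at least [1 - k]; as [k] tends to
    0 the sharp constant 1/2 is approached, which is what makes every [theta] below [theta#]
    reachable. *)
Lemma hrel_quad (k u : R) : 0 <= k <= 1 -> 0 <= u <= 1 + k ->
  (1 - k) / 2 * (u - 1) ^+ 2 <= hrel u.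
Proof.
move=> /andP[k0 k1] /andP[]; rewrite le_eqVlt => /predU1P[<- _|u0 u1].
  by rewrite /hrel xlnxE; lra.
pose f (w : R) := w * ln w - w + 1 - (1 - k) / 2 * (w - 1) ^+ 2.
suff : f 1 <= f u by rewrite /f /hrel xlnxE ln1; lra.
have pos y : Num.min 1 u <= y <= Num.max 1 u -> 0 < y /\ y <= 1 + k.
  by rewrite ge_min le_max => /andP[/orP[] ? /orP[] ?]; split; lra.
apply: (@le_of_derive_sign f (fun w => ln w - (1 - k) * (w - 1))) => y /pos[y0 yk].
- have H : is_derive y 1 f _ :=
    derive1B (derive1_xlnx y0) (derive1Z ((1 - k) / 2) (derive1_subX y 1)).
  by apply: (is_derive_eq H); field.
- have [y1|y1] := leP 1 y.
    rewrite mulr_ge0 ?subr_ge0//.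
    apply: le_trans (ln_ge_sub1 y0).
    have -> : 1 - y^-1 = (y - 1) * y^-1 by field; rewrite gt_eqF.
    rewrite [leRHS]mulrC ler_wpM2r ?subr_ge0// -(ler_pM2r y0) mulVf ?gt_eqF//; nra.
  rewrite mulr_le0//; first lra.
  have := ln_le_sub1 y0; nra.
Qed.

(** Quadratic control up to height [1 + k], then the tangent at [1 + k], of slope [ln (1 + k)]. The
    two terms match the splitting of a deviation into a bounded part and peaks. *)
Lemma hrel_ge (k u : R) : 0 <= k <= 1 -> 0 <= u ->
  (1 - k) / 2 * Num.min (u - 1) k ^+ 2 + ln (1 + k) * Num.max (u - 1 - k) 0
    <= hrel u.
Proof.
move=> /[dup] kI /andP[k0 k1] u0; have [u1|u1] := leP u (1 + k).
  rewrite min_l ?max_r ?mulr0 ?addr0 ?hrel_quad ?u0//; lra.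
rewrite min_r ?max_l; [|lra..].
apply: le_trans (hrel_tangent u0 (_ : 0 < 1 + k)); last lra.
have := @hrel_quad k (1 + k) kI; rewrite lexx; lra.
Qed.

Lemma hrel_eq0 (u : R) : 0 <= u -> hrel u = 0 -> u = 1.
Proof.
move=> u0 hu; have k2 : 0 <= (1/2 : R) <= 1 by lra.
have := hrel_ge k2 u0; rewrite hu.
have ln0 : 0 < ln (1 + 1 / 2 : R) by rewrite ln_gt0; lra.
have [u1|u1] := leP (u - 1) (1/2).
  rewrite max_r; last lra.
  by move=> H; apply/eqP; rewrite -subr_eq0 -sqrf_eq0 eq_le sqr_ge0 andbT; nra.
by rewrite max_l; [nra|lra].
Qed.

Lemma ln_le_cubic (w : R) : 0 < w ->
  ln w <= (w - 1) - (w - 1) ^+ 2 / 2 + (w - 1) ^+ 3 / 3.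
Proof.
move=> w0; pose f (w : R) := -1 * ln w + (w - 1) - 2^-1 * (w - 1) ^+ 2 + 3^-1 * (w - 1) ^+ 3.
suff : f 1 <= f w by rewrite /f ln1; lra.
have pos y : Num.min 1 w <= y <= Num.max 1 w -> 0 < y.
  by rewrite ge_min le_max => /andP[/orP[] ? _]; lra.
apply: (@le_of_derive_sign f (fun w => (w - 1) ^+ 3 / w)) => y /pos y0.
- have H : is_derive y 1 f _ := (derive1D (derive1B (derive1D (derive1Z (-1) (is_derive1_ln y0))
    (derive1_subX y 0)) (derive1Z 2^-1 (derive1_subX y 1)))
    (derive1Z 3^-1 (derive1_subX y 2))).
  by apply: (is_derive_eq H); field; rewrite gt_eqF.
- by rewrite mulrA -exprS divr_ge0 ?exprn_even_ge0 ?ltW.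
Qed.

(** Doubling the Taylor coefficient 1/3 turns the derivative of the difference into
    [(w - 1) ^+ 2 * (w^-1 - 2)], which is nonpositive exactly from [w = 1/2] on. *)
Lemma ln_ge_cubic (w : R) : 1 / 2 <= w <= 1 ->
  (w - 1) - (w - 1) ^+ 2 / 2 + 2 / 3 * (w - 1) ^+ 3 <= ln w.
Proof.
move=> /andP[w2 w1].
pose f (w : R) := ln w - (w - 1) + 2^-1 * (w - 1) ^+ 2 - 2 / 3 * (w - 1) ^+ 3.
suff : f 1 <= f w by rewrite /f ln1; lra.
have pos y : Num.min 1 w <= y <= Num.max 1 w -> 1 / 2 <= y /\ y <= 1.
  by rewrite ge_min le_max => /andP[/orP[] ? /orP[] ?]; split; lra.
apply: (@le_of_derive_sign f (fun w => (w - 1) ^+ 2 * (w^-1 - 2))) => y /pos[y2 y1].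
- have y0 : 0 < y by lra.
  have H : is_derive y 1 f _ := (derive1B (derive1D (derive1B (is_derive1_ln y0)
    (derive1_subX y 0)) (derive1Z 2^-1 (derive1_subX y 1)))
    (derive1Z (2 / 3) (derive1_subX y 2))).
  by apply: (is_derive_eq H); field; rewrite gt_eqF.
- rewrite mulrA mulr_le0//.
    by rewrite mulr_le0_ge0 ?sqr_ge0//; lra.
  rewrite subr_le0 -[leRHS]invrK lef_pV2 ?posrE; lra.
Qed.

(** The Taylor expansion with its quartic coefficient 1/12 enlarged to 1/6, which absorbs the
    remainder for [u] down to -1/2. The cubic term is kept exact: it decides the sign in the
    perturbation argument. *)
Lemma hrel_le_quartic (u : R) : `|u| <= 1 / 2 ->
  hrel (1 + u) <= u ^+ 2 / 2 - u ^+ 3 / 6 + u ^+ 4 / 6.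
Proof.
rewrite ler_norml => /andP[um up].
pose f (w : R) := 2^-1 * (w - 1) ^+ 2 - 6^-1 * (w - 1) ^+ 3 + 6^-1 * (w - 1) ^+ 4
   - (w * ln w - w + 1).
suff : f 1 <= f (1 + u).
  by rewrite /f /hrel xlnxE ln1 (_ : 1 + u - 1 = u); [lra|ring].
have pos y : Num.min 1 (1 + u) <= y <= Num.max 1 (1 + u) -> 1 / 2 <= y.
  by rewrite ge_min le_max => /andP[/orP[] ? _]; lra.
apply: (@le_of_derive_sign f (fun w => (w - 1) - (w - 1) ^+ 2 / 2
   + 2 / 3 * (w - 1) ^+ 3 - ln w)) => y /pos y2.
- have y0 : 0 < y by lra.
  have H : is_derive y 1 f _ := (derive1B (derive1D (derive1B (derive1Z 2^-1 (derive1_subX y 1))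
    (derive1Z 6^-1 (derive1_subX y 2))) (derive1Z 6^-1 (derive1_subX y 3)))
    (derive1_xlnx y0)).
  by apply: (is_derive_eq H); field.
- have [y1|y1] := leP 1 y.
    have := @ln_le_cubic y; rewrite (_ : 0 < y); last lra.
    move=> /(_ isT) H; rewrite mulr_ge0//; first lra.
    have : 0 <= (y - 1) ^+ 3 by rewrite exprn_ge0//; lra.
    lra.
  have := @ln_ge_cubic y; rewrite y2 (ltW y1) => /(_ isT) H.
  by rewrite mulr_le0//; lra.
Qed.

End RealIneq.

(** * Calculus of real-valued integrals *)

Notation intg mu f := (mu.-integrable setT (EFin \o f)).

Section RealIntegral.
Context {d : measure_display} {T : measurableType d} {R : realType}.
Variable mu : {measure set T -> \bar R}.
Implicit Types f g h : T -> R.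

Lemma intg_meas f : intg mu f -> measurable_fun setT f.
Proof. by move=> /measurable_int/measurable_EFinP. Qed.

Lemma intg_le f g : measurable_fun setT f -> (forall x, `|f x| <= g x) ->
  intg mu g -> intg mu f.
Proof.
move=> mf fg; apply: le_integrable => //; first exact/measurable_EFinP.
by move=> x _; rewrite /= lee_fin (le_trans (fg x))// ler_norm.
Qed.

Lemma intgD f g : intg mu f -> intg mu g -> intg mu (fun x => f x + g x).
Proof. by move=> fi gi; exact: (integrableD measurableT fi gi). Qed.

Lemma intgB f g : intg mu f -> intg mu g -> intg mu (fun x => f x - g x).
Proof. by move=> fi gi; exact: (integrableB measurableT fi gi). Qed.

Lemma intgZ c f : intg mu f -> intg mu (fun x => c * f x).
Proof. by move=> fi; exact: (integrableZl measurableT c fi). Qed.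

Lemma intgN f : intg mu f -> intg mu (fun x => - f x).
Proof. by move=> /(intgZ (-1)); under [X in intg mu X]eq_fun do rewrite mulN1r. Qed.

Lemma intg_abs f : intg mu f -> intg mu (fun x => `|f x|).
Proof. by move=> fi; exact: (integrable_abse fi). Qed.

Lemma intgMb f h c : measurable_fun setT h -> (forall x, `|h x| <= c) ->
  intg mu f -> intg mu (fun x => h x * f x).
Proof.
move=> mh hc fi; apply: (@intg_le _ (fun x => c * `|f x|)).
- by apply: measurable_funM => //; exact: intg_meas.
- by move=> x; rewrite normrM ler_wpM2r.
- exact/intgZ/intg_abs.
Qed.

Lemma intg_sum I (s : seq I) (F : I -> T -> R) :
  (forall i, intg mu (F i)) -> intg mu (fun x => \sum_(i <- s) F i x).
Proof.
move=> Fi; elim: s => [|i s IHs].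
  under [X in intg mu X]eq_fun do rewrite big_nil; exact: integrable0.
by under [X in intg mu X]eq_fun do rewrite big_cons; exact: intgD.
Qed.

Lemma RintD f g : intg mu f -> intg mu g ->
  \int[mu]_x (f x + g x) = \int[mu]_x f x + \int[mu]_x g x.
Proof. exact: RintegralD. Qed.

Lemma RintB f g : intg mu f -> intg mu g ->
  \int[mu]_x (f x - g x) = \int[mu]_x f x - \int[mu]_x g x.
Proof. exact: RintegralB. Qed.

Lemma RintZ c f : intg mu f -> \int[mu]_x (c * f x) = c * \int[mu]_x f x.
Proof. exact: RintegralZl. Qed.

Lemma RintN f : intg mu f -> \int[mu]_x (- f x) = - \int[mu]_x f x.
Proof.
by move=> fi; rewrite -mulN1r -RintZ//; apply: eq_Rintegral => x _; rewrite mulN1r.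
Qed.

Lemma Rint_sum I (s : seq I) (F : I -> T -> R) :
  (forall i, intg mu (F i)) ->
  \int[mu]_x (\sum_(i <- s) F i x) = \sum_(i <- s) \int[mu]_x F i x.
Proof.
move=> Fi; elim: s => [|i s IHs].
  rewrite big_nil; under eq_Rintegral do rewrite big_nil.
  by rewrite /Rintegral integral0.
rewrite big_cons -IHs -RintD//; last exact: intg_sum.
by apply: eq_Rintegral => x _; rewrite big_cons.
Qed.

Lemma Rint_le f g : intg mu f -> intg mu g -> (forall x, f x <= g x) ->
  \int[mu]_x f x <= \int[mu]_x g x.
Proof. by move=> fi gi fg; apply: le_Rintegral. Qed.

Lemma Rint_ge0 f : (forall x, 0 <= f x) -> 0 <= \int[mu]_x f x.
Proof. by move=> f0; apply: Rintegral_ge0. Qed.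

Lemma Rint_abs f : intg mu f -> `|\int[mu]_x f x| <= \int[mu]_x `|f x|.
Proof. exact: le_normr_Rintegral. Qed.

Lemma RintE f : intg mu f -> (\int[mu]_x (f x)%:E)%E = (\int[mu]_x f x)%:E.
Proof. by move=> fi; rewrite /Rintegral fineK//; exact: integrable_fin_num. Qed.

Lemma intg_ge0 f : measurable_fun setT f -> (forall x, 0 <= f x) ->
  (\int[mu]_x (f x)%:E < +oo)%E -> intg mu f.
Proof.
move=> mf f0 foo; apply/integrableP; split; first exact/measurable_EFinP.
by under eq_integral do rewrite /= ger0_norm//.
Qed.

Lemma intg_fin_num f : measurable_fun setT f ->
  (\int[mu]_x (f x)%:E \is a fin_num)%E -> intg mu f.
Proof.
move=> mf ff; apply/integrableP; split; first exact/measurable_EFinP.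
by rewrite integral_fin_num_abs.
Qed.

Lemma Rint_dct (f_ : nat -> T -> R) f g : (forall n, measurable_fun setT (f_ n)) ->
  (forall x, f_ ^~ x @ \oo --> f x) -> intg mu g ->
  (forall n x, `|f_ n x| <= g x) ->
  measurable_fun setT f /\ intg mu f /\
  (fun n => \int[mu]_x f_ n x) @ \oo --> \int[mu]_x f x.
Proof.
move=> mf_ f_f gi f_g.
have mf : measurable_fun setT f.
  by apply: (measurable_fun_cvg (h := f_)) => // x _; exact: f_f.
split => //.
have [||||fi _ cv] := @dominated_convergence _ _ _ mu setT measurableT
    (fun n x => (f_ n x)%:E) (EFin \o f) (EFin \o g) _ _ _ gi _.
- by move=> n; exact/measurable_EFinP.
- exact/measurable_EFinP.
- by apply: aeW => x _; apply/fine_cvgP; split; [exact: nearW|exact: f_f].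
- by apply: aeW => x n _; rewrite /= lee_fin.
by split => //; move: cv; rewrite [X in _ --> X](RintE fi) => /fine_cvg.
Qed.
End RealIntegral.

Section RealFubini.
Context {d1 d2 : measure_display} {T1 : measurableType d1}
  {T2 : measurableType d2} {R : realType}.
Variables (m1 : {sigma_finite_measure set T1 -> \bar R}).
Variables (m2 : {sigma_finite_measure set T2 -> \bar R}).
Local Notation nu := (m1 \x m2)%E.
Implicit Type F : T1 * T2 -> R.

Lemma intg_prod F : measurable_fun setT F ->
  (\int[m1]_x \int[m2]_y (`|F (x, y)|)%:E < +oo)%E -> intg nu F.
Proof. by move=> mF Foo; apply/integrable12ltyP => //; exact/measurable_EFinP. Qed.

(** Integrability is asked of every section, not of almost every one, so that the inner real-valued
    integral is meaningful at each point and no exceptional set has to be tracked. *)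
Lemma Rint_fubini1 F : intg nu F -> (forall x, intg m2 (fun y => F (x, y))) ->
  intg m1 (fun x => \int[m2]_y F (x, y)) /\
  \int[nu]_p F p = \int[m1]_x \int[m2]_y F (x, y).
Proof.
move=> Fi Fxi.
have E x : fubini_F m2 (EFin \o F) x = (\int[m2]_y F (x, y))%:E.
  by rewrite /fubini_F /= RintE.
split.
  by apply: eq_integrable (integrable_fubini_F Fi) => // x _; rewrite E.
rewrite /Rintegral -integral12_prod_meas1//; congr fine.
by apply: eq_integral => x _; rewrite E.
Qed.

Lemma Rint_fubini2 F : intg nu F -> (forall y, intg m1 (fun x => F (x, y))) ->
  intg m2 (fun y => \int[m1]_x F (x, y)) /\
  \int[nu]_p F p = \int[m2]_y \int[m1]_x F (x, y).
Proof.
move=> Fi Fyi.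
have E y : fubini_G m1 (EFin \o F) y = (\int[m1]_x F (x, y))%:E.
  by rewrite /fubini_G /= RintE.
split.
  apply: intg_fin_num.
    apply/measurable_EFinP; apply: (eq_measurable_fun (fubini_G m1 (EFin \o F))).
      by move=> y _; rewrite E.
    exact: (measurable_fubini_G Fi).
  under eq_integral do rewrite -E.
  by rewrite integral21_prod_meas1//; exact: integrable_fin_num.
rewrite /Rintegral -integral21_prod_meas1//; congr fine.
by apply: eq_integral => y _; rewrite E.
Qed.

Lemma Rint_tensor (u : T1 -> R) (v : T2 -> R) : intg m1 u -> intg m2 v ->
  intg nu (fun p => u p.1 * v p.2) /\
  \int[nu]_p (u p.1 * v p.2) = \int[m1]_x u x * \int[m2]_y v y.
Proof.
move=> iu iv.
have iuv : intg nu (fun p => u p.1 * v p.2).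
  apply: intg_prod.
    apply: measurable_funM.
      exact: (measurableT_comp (intg_meas iu) measurable_fst).
    exact: (measurableT_comp (intg_meas iv) measurable_snd).
  have E x : (\int[m2]_y (`|u x * v y|)%:E = (\int[m2]_y `|v y| * `|u x|)%:E)%E.
    rewrite mulrC -RintZ -?RintE; [|exact/intgZ/intg_abs|exact: intg_abs].
    by apply: eq_integral => y _; rewrite normrM.
  under eq_integral do rewrite E.
  by rewrite RintE ?ltry//; exact/intgZ/intg_abs.
split => //; have [|_ ->] := Rint_fubini1 iuv.
  by move=> x /=; exact: (intgZ (u x) iv).
under eq_Rintegral do rewrite /= RintZ//.
by under eq_Rintegral do rewrite mulrC; rewrite RintZ// mulrC.
Qed.
End RealFubini.

Section FiniteMeasure.
Context {d : measure_display} {T : measurableType d} {R : realType}.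
Variable mu : {finite_measure set T -> \bar R}.

Lemma intg_bounded (f : T -> R) c : measurable_fun setT f ->
  (forall x, `|f x| <= c) -> intg mu f.
Proof.
move=> mf fc; apply: (@intg_le _ _ _ mu f (cst c)) => //.
exact: finite_measure_integrable_cst.
Qed.

Lemma intg_cst c : intg mu (fun=> c).
Proof. exact: finite_measure_integrable_cst. Qed.

Lemma Rint_cst c : \int[mu]_x c = c * fine (mu setT).
Proof. by rewrite Rintegral_cst. Qed.
End FiniteMeasure.

(** * Kernels and stability of the uniform density *)

Section Kernel.
Context {d : measure_display} {T : measurableType d} {R : realType}.
Variable mu : {finite_measure set T -> \bar R}.
Local Notation nu := (mu \x mu)%E.
Variables (W : T -> T -> R) (M w0 : R).

Definition pos_excess (K r : R) : R := Num.max (`|r| - K) 0.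

(** An integrable potential gives a kernel unbounded above. [kernel_tail] replaces boundedness: the
    mass of a row above height [K] is small uniformly in the row. [kernel_row] is only almost
    everywhere because the periodized rows are computed at points of the cell. *)
Record admissible_kernel : Prop := AdmissibleKernel {
  kernel_measurable : measurable_fun setT (fun p : T * T => W p.1 p.2);
  kernel_sym : forall x y, W x y = W y x;
  kernel_lb_ge0 : 0 <= M;
  kernel_lb : forall x y, - M <= W x y;
  kernel_tail : forall e, 0 < e -> exists2 K, 0 <= K &
    forall x, (\int[mu]_y (pos_excess K (W x y))%:E <= e%:E)%E;
  kernel_row : {ae mu, forall x, \int[mu]_y W x y = w0} }.

Hypothesis kW : admissible_kernel.

Let mW := kernel_measurable kW.

Lemma kernel_row_measurable x : measurable_fun setT (W x).
Proof. by have := measurableT_comp mW (@measurable_pair1 _ _ _ _ x). Qed.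

Lemma measurable_kernel2 (u v : T -> R) :
  measurable_fun setT u -> measurable_fun setT v ->
  measurable_fun setT (fun p : T * T => W p.1 p.2 * u p.1 * v p.2).
Proof.
move=> mu' mv; apply: measurable_funM; first apply: measurable_funM => //.
  by apply: measurableT_comp => //; exact: measurable_fst.
by apply: measurableT_comp => //; exact: measurable_snd.
Qed.

Lemma measurable_pos_excess K x : measurable_fun setT (fun y => pos_excess K (W x y)).
Proof.
apply: measurable_maxr => //; apply: measurable_funB => //.
by apply: measurableT_comp => //; exact: kernel_row_measurable.
Qed.

Lemma pos_excess_ge0 K r : 0 <= pos_excess K r.
Proof. by rewrite le_max lexx orbT. Qed.

(* The kernel is split at height [K]; the excess has small rows. *)
Lemma kernel_row_le (K e c : R) (u : T -> R) x :
  0 <= K -> (\int[mu]_y (pos_excess K (W x y))%:E <= e%:E)%E ->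
  measurable_fun setT u -> (forall y, `|u y| <= c) ->
  (\int[mu]_y (`|W x y * u y|)%:E <= (K * \int[mu]_y `|u y| + c * e)%:E)%E.
Proof.
move=> K0 Ke mu' uc.
have iu : intg mu (fun y => `|u y|) by exact: intg_abs (intg_bounded mu mu' uc).
have iE : intg mu (fun y => pos_excess K (W x y)).
  apply: intg_ge0 => [|y|]; [exact: measurable_pos_excess|exact: pos_excess_ge0|].
  by rewrite (le_lt_trans Ke)// ltry.
have c0 : 0 <= c by rewrite (le_trans _ (uc x)).
have le1 y : `|W x y * u y| <= K * `|u y| + c * pos_excess K (W x y).
  rewrite normrM; have := uc y; have := normr_ge0 (u y).
  have : `|W x y| <= K + pos_excess K (W x y) by rewrite -lerBlDl le_max lexx.
  have := pos_excess_ge0 K (W x y); have := normr_ge0 (W x y); nra.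
have iD : intg mu (fun y => K * `|u y| + c * pos_excess K (W x y)).
  by apply: intgD; exact: intgZ.
apply: (@le_trans _ _ (\int[mu]_y (K * `|u y| + c * pos_excess K (W x y))%:E)%E).
  apply: ge0_le_integral => //.
  - apply/measurable_EFinP; apply: measurableT_comp => //.
    by apply: measurable_funM => //; exact: kernel_row_measurable.
  - exact/measurable_EFinP/(intg_meas iD).
  - by move=> y _; rewrite lee_fin.
rewrite RintE// lee_fin RintD ?RintZ//; [|exact: intgZ..].
rewrite lerD2l ler_wpM2l//; by move: Ke; rewrite RintE.
Qed.

Lemma intg_kernel_row x : intg mu (W x).
Proof.
have [K K0 /(_ x) Ke] := kernel_tail kW ltr01.
have H := @kernel_row_le K 1 1 (fun=> 1) x K0 Ke _ _.
apply/integrableP; split; first exact/measurable_EFinP/kernel_row_measurable.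
apply: (@le_lt_trans _ _ (\int[mu]_y (`|W x y * 1|)%:E)%E).
  by under [leRHS]eq_integral do rewrite mulr1.
apply: le_lt_trans (H _ _) (ltry _) => //.
by move=> y; rewrite normr1.
Qed.

(** Schur's test: by symmetry columns obey the row bound, so integrating out the bounded factor [u]
    leaves a constant multiple of [|v|]. *)
Lemma kernel_schur (K e c : R) (u v : T -> R) :
  0 <= K -> (forall x, (\int[mu]_y (pos_excess K (W x y))%:E <= e%:E)%E) ->
  measurable_fun setT u -> (forall y, `|u y| <= c) -> intg mu v ->
  intg nu (fun p => W p.1 p.2 * u p.1 * v p.2) /\
  `|\int[nu]_p (W p.1 p.2 * u p.1 * v p.2)| <=
     (K * \int[mu]_y `|u y| + c * e) * \int[mu]_y `|v y|.
Proof.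
move=> K0 Ke mu' uc iv; have mv := intg_meas iv.
have mF := measurable_kernel2 mu' mv.
pose A := K * \int[mu]_y `|u y| + c * e.
have row y : (\int[mu]_x (`|W x y * u x * v y|)%:E <= (A * `|v y|)%:E)%E.
  under eq_integral do rewrite normrM EFinM.
  rewrite ge0_integralZr//; last first.
    apply/measurable_EFinP/measurableT_comp => //; apply: measurable_funM => //.
    by under [X in measurable_fun _ X]eq_fun do rewrite (kernel_sym kW); exact: kernel_row_measurable.
  rewrite EFinM lee_wpmul2r//.
  under eq_integral do rewrite (kernel_sym kW).
  exact: kernel_row_le.
have le2 : (\int[nu]_p `|(W p.1 p.2 * u p.1 * v p.2)%:E| <=
   (A * \int[mu]_y `|v y|)%:E)%E.
  rewrite (@fubini_tonelli2 _ _ _ _ _ mu mu)//; last first.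
    exact/measurableT_comp/measurable_EFinP.
  rewrite /fubini_G /= -RintZ; last exact: intg_abs.
  rewrite -RintE; last exact/intgZ/intg_abs.
  apply: ge0_le_integral => //.
  - by move=> y _; apply: integral_ge0.
  - apply: (@measurable_fun_fubini_tonelli_G _ _ _ _ _ mu
      (fun p => (`|W p.1 p.2 * u p.1 * v p.2|)%:E)) => //.
    exact/measurable_EFinP/measurableT_comp.
  - by apply/measurable_EFinP/(intg_meas (mu := mu)); exact/intgZ/intg_abs.
have iF : intg nu (fun p => W p.1 p.2 * u p.1 * v p.2).
  apply/integrableP; split; first exact/measurable_EFinP.
  exact: le_lt_trans le2 (ltry _).
split => //; apply: le_trans (Rint_abs iF) _; rewrite -lee_fin -RintE//.
exact: intg_abs.
Qed.

Lemma intg_kernel_schur (c : R) (u v : T -> R) :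
  measurable_fun setT u -> (forall y, `|u y| <= c) -> intg mu v ->
  intg nu (fun p => W p.1 p.2 * u p.1 * v p.2).
Proof.
move=> mu' uc iv; have [K K0 Ke] := kernel_tail kW ltr01.
by have [] := @kernel_schur K 1 c u v K0 Ke.
Qed.

Lemma intg_kernel_col y (c : R) (u : T -> R) :
  measurable_fun setT u -> (forall y, `|u y| <= c) ->
  intg mu (fun x => W x y * u x).
Proof.
move=> mu' uc; under [X in intg mu X]eq_fun do rewrite mulrC (kernel_sym kW).
exact: intgMb mu' uc (intg_kernel_row y).
Qed.

Lemma kernel_swap (c : R) (u v : T -> R) :
  measurable_fun setT u -> (forall y, `|u y| <= c) -> intg mu v ->
  intg nu (fun p => W p.1 p.2 * v p.1 * u p.2) /\
  \int[nu]_p (W p.1 p.2 * v p.1 * u p.2) = \int[nu]_p (W p.1 p.2 * u p.1 * v p.2).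
Proof.
move=> mu' uc iv; have iF := intg_kernel_schur mu' uc iv.
have E x y : W x y * v x * u y = W y x * u y * v x by rewrite (kernel_sym kW); ring.
have iG : intg nu (fun p => W p.1 p.2 * v p.1 * u p.2).
  apply: intg_prod; first exact: measurable_kernel2 (intg_meas iv) mu'.
  have /integrable21ltyP : intg nu (fun p => W p.1 p.2 * u p.1 * v p.2) by [].
  move=> /(_ (measurable_int _ iF)); apply: le_lt_trans; rewrite /=.
  by under eq_integral do under eq_integral do rewrite E.
have iFy y : intg mu (fun x => W x y * u x * v y).
  under [X in intg mu X]eq_fun do rewrite mulrC.
  exact/intgZ/intg_kernel_col/uc.
split => //; have [_ ->] := Rint_fubini2 iF iFy.
have [|_ ->] := Rint_fubini1 iG.
  move=> x /=; under [X in intg mu X]eq_fun do rewrite E.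
  exact: iFy.
by apply: eq_Rintegral => x _; apply: eq_Rintegral => y _ /=.
Qed.

Lemma kernel_cst_row (v : T -> R) : intg mu v ->
  \int[nu]_p (W p.1 p.2 * 1 * v p.2) = w0 * \int[mu]_y v y.
Proof.
move=> iv.
have iF : intg nu (fun p => W p.1 p.2 * 1 * v p.2).
  by apply: (@intg_kernel_schur 1 (fun=> 1)) => // y; rewrite normr1.
have iFy y : intg mu (fun x => W x y * 1 * v y).
  under [X in intg mu X]eq_fun do rewrite mulrC.
  by apply: intgZ; apply: (@intg_kernel_col y 1 (fun=> 1)) => // z; rewrite normr1.
have [iFF ->] := Rint_fubini2 iF iFy.
rewrite -RintZ// /Rintegral; congr fine; apply: ae_eq_integral => //.
- exact: measurable_int iFF.
- exact: measurable_int (intgZ w0 iv).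
apply: filterS (kernel_row kW) => y wy _; congr EFin => /=.
transitivity (\int[mu]_x (v y * W y x)).
  by apply: eq_Rintegral => x _; rewrite (kernel_sym kW); ring.
by rewrite RintZ ?wy 1?mulrC//; exact: intg_kernel_row.
Qed.
End Kernel.

(** The scalar part of [entropy_stability], with [A1], [A2], [b1] standing for the integrals of
    [|a|], [a ^+ 2], [b], and [Qa], [X], [Qbb] for the pieces of the form. The term in [A2] of the
    lower bound on [H] pays for [Qa]; all remaining losses are multiples of [b1] whose factors add
    up to at most [c], shared as c/2 + c/4 + c/4. *)
Lemma stability_arith (R : realType)
    (th lam C M K e k c t m H A1 A2 b1 X Qa Qbb : R) :
  0 <= th -> th * lam <= 1 - k -> 0 <= k <= 1 / 2 -> 0 < c -> 0 <= C ->
  0 <= M -> 0 <= K -> 0 < t -> th * e <= c / 4 -> th * K * m * t <= c / 4 ->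
  (th / 2 * (C + M) / c + th * K * 4 / t) * H <= c / 2 ->
  0 <= b1 -> 0 <= A2 -> (1 - k) / 2 * A2 + c * b1 <= H ->
  A1 <= t * m + t^-1 * A2 ->
  0 <= Qa + lam * A2 + C * (- b1) ^+ 2 -> - M * b1 ^+ 2 <= Qbb ->
  `|X| <= (K * A1 + 1 * e) * b1 ->
  - (th / 2 * (Qa + 2 * X + Qbb)) <= H.
Proof.
move=> th0 thk /andP[k0 k1] c0 C0 M0 K0 t0 the tle BH Ib0 Ia2 hlow Ia coa Qb Bab.
have k12 : 1 / 2 <= 1 - k by lra.
have A2H : A2 <= 4 * H by have := mulr_ge0 (ltW c0) Ib0; nra.
have b1H : b1 <= H / c.
  rewrite ler_pdivlMr// mulrC; have : 0 <= (1 - k) / 2 * A2 by rewrite mulr_ge0//; lra.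
  lra.
have eb1 : th / 2 * (C + M) * b1 <= th / 2 * (C + M) / c * H.
  rewrite -[leRHS]mulrA [c^-1 * H]mulrC; apply: ler_wpM2l b1H.
  by rewrite mulr_ge0 ?addr_ge0//; lra.
have eA1 : th * K * A1 <= th * K * m * t + th * K * 4 / t * H.
  apply: le_trans (ler_wpM2l (mulr_ge0 th0 K0) Ia) _.
  rewrite mulrDr lerD//; first by rewrite -!mulrA [t * m]mulrC.
  rewrite -!mulrA ler_wpM2l// ler_wpM2l// [leRHS]mulrCA.
  by apply: ler_wpM2l => //; rewrite invr_ge0 ltW.
have ebrac : th / 2 * (C + M) * b1 + th * K * A1 + th * e <= c.
  have -> : c = c / 2 + c / 4 + c / 4 by field.
  apply: lerD the; apply: le_trans (lerD eb1 eA1) _.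
  by rewrite addrCA addrC -mulrDl lerD.
have eX : - (th * X) <= th * (K * A1 + e) * b1.
  rewrite -mulrN -mulrA ler_wpM2l//; apply: le_trans (ler_norm _) _.
  by rewrite normrN; move: Bab; rewrite mul1r.
have eQa : - (th / 2 * Qa) <= (1 - k) / 2 * A2 + th / 2 * C * b1 ^+ 2.
  have : th * lam * A2 <= (1 - k) * A2 by rewrite ler_wpM2r.
  have : 0 <= th / 2 * (Qa + lam * A2 + C * (- b1) ^+ 2) by rewrite mulr_ge0//; lra.
  rewrite sqrrN; lra.
have eQb : - (th / 2 * Qbb) <= th / 2 * M * b1 ^+ 2.
  have : 0 <= th / 2 * (Qbb - (- M * b1 ^+ 2)) by rewrite mulr_ge0 ?subr_ge0//; lra.
  lra.
have := ler_wpM2r Ib0 ebrac.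
lra.
Qed.

Section Stability.
Context {d : measure_display} {T : measurableType d} {R : realType}.
Variable mu : {finite_measure set T -> \bar R}.
Local Notation nu := (mu \x mu)%E.
Variables (W : T -> T -> R) (M w0 : R).
Hypothesis kW : admissible_kernel mu W M w0.

Definition kernel_form (v : T -> R) := \int[nu]_p (W p.1 p.2 * v p.1 * v p.2).
Local Notation Q := kernel_form.

Lemma kernel_formD (c : R) (u v : T -> R) :
  measurable_fun setT u -> (forall x, `|u x| <= c) -> intg mu v ->
  intg nu (fun p => W p.1 p.2 * (u p.1 + v p.1) * (u p.2 + v p.2)) ->
  intg nu (fun p => W p.1 p.2 * v p.1 * v p.2) /\
  Q (fun x => u x + v x) =
    Q u + 2 * \int[nu]_p (W p.1 p.2 * u p.1 * v p.2) + Q v.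
Proof.
move=> mu' uc iv isum.
have iu := intg_bounded mu mu' uc.
have i1 := intg_kernel_schur kW mu' uc iu.
have i2 := intg_kernel_schur kW mu' uc iv.
have [i3 e3] := kernel_swap kW mu' uc iv.
(* Schur's test needs one bounded factor, which the term with [v] twice does not have; its
   integrability is inherited from the sum by subtracting the other three terms. *)
have i4 : intg nu (fun p => W p.1 p.2 * v p.1 * v p.2).
  pose S p := W p.1 p.2 * (u p.1 + v p.1) * (u p.2 + v p.2)
      - W p.1 p.2 * u p.1 * u p.2 - W p.1 p.2 * u p.1 * v p.2
      - W p.1 p.2 * v p.1 * u p.2.
  have -> : (fun p => W p.1 p.2 * v p.1 * v p.2) = S by apply/funext => p; rewrite /S; ring.
  by do 3!apply: intgB => //.
split => //; rewrite /Q.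
transitivity (\int[nu]_p (W p.1 p.2 * u p.1 * u p.2 + W p.1 p.2 * u p.1 * v p.2
   + W p.1 p.2 * v p.1 * u p.2 + W p.1 p.2 * v p.1 * v p.2)).
  by apply: eq_Rintegral => p _; ring.
rewrite !RintD//; first by rewrite e3; ring.
- exact: intgD.
- by apply: intgD => //; exact: intgD.
Qed.

Local Notation m := (fine (mu setT)).

Record rdensity (rho : T -> R) : Prop := RDensity {
  rdensity_measurable : measurable_fun setT rho;
  rdensity_ge0 : forall x, 0 <= rho x;
  rdensity_intg : intg mu rho;
  rdensity_int : \int[mu]_x rho x = 1 }.

(** The deviation has mean zero and constants are eigenfunctions of the kernel, so the cross term of
    the expansion around the uniform density vanishes. *)
Lemma kernel_form_deviation rho : rdensity rho ->
  intg nu (fun p => W p.1 p.2 * rho p.1 * rho p.2) ->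
  intg nu (fun p => W p.1 p.2 * (m * rho p.1 - 1) * (m * rho p.2 - 1)) /\
  m ^+ 2 * Q rho = m * w0 + Q (fun x => m * rho x - 1).
Proof.
move=> [mr r0 ir r1] iW.
have ieta : intg mu (fun x => m * rho x - 1).
  by apply: intgB; [exact: intgZ|exact: intg_cst].
have eta0 : \int[mu]_x (m * rho x - 1) = 0.
  rewrite RintB; [|exact: intgZ|exact: intg_cst].
  by rewrite RintZ// r1 Rint_cst; ring.
have [||||i4] := @kernel_formD 1 (fun=> 1) (fun x => m * rho x - 1).
- by [].
- by move=> x; rewrite normr1.
- by [].
- have -> : (fun p : T * T => W p.1 p.2 * (1 + (m * rho p.1 - 1)) * (1 + (m * rho p.2 - 1)))
      = (fun p => m ^+ 2 * (W p.1 p.2 * rho p.1 * rho p.2)).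
    by apply/funext => p; ring.
  exact: intgZ.
rewrite (kernel_cst_row kW ieta) eta0 mulr0 mulr0 addr0 => e; split => //.
transitivity (Q (fun x => 1 + (m * rho x - 1))).
  rewrite /Q -RintZ//; apply: eq_Rintegral => p _; ring.
have := kernel_cst_row kW (intg_cst mu (1 : R)); rewrite Rint_cst => e1.
by rewrite e /Q e1; ring.
Qed.

(** [lam] bounds the form only at nonzero frequencies. The last term pays for the zero frequency,
    since the functions to which this is applied are truncations and have lost their zero mean. *)
Definition coercive (lam C : R) := forall g : T -> R, measurable_fun setT g ->
  (exists c, forall x, `|g x| <= c) ->
  0 <= Q g + lam * \int[mu]_x (g x ^+ 2) + C * (\int[mu]_x g x) ^+ 2.

(* Only the part [b] of the deviation above a small height [k] can be
   unbounded; the relative entropy controls [b] linearly, while the kernel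
   couples it to the rest through a small factor. *)
Lemma entropy_stability (lam C th : R) : coercive lam C -> 0 <= C ->
  0 <= lam -> 0 <= th -> th * lam < 1 -> exists2 s, 0 < s &
  forall rho, rdensity rho ->
    intg nu (fun p => W p.1 p.2 * rho p.1 * rho p.2) ->
    intg mu (fun x => hrel (m * rho x)) ->
    \int[mu]_x hrel (m * rho x) <= s ->
    th / 2 * (m * w0 - m ^+ 2 * Q rho) <= \int[mu]_x hrel (m * rho x).
Proof.
move=> co C0 lam0 th0 thlam.
have m0 : 0 <= m by rewrite fine_ge0.
have M0 := kernel_lb_ge0 kW.
(* Then [th * lam = 1 - 2 * k]: the quadratic entropy coefficient [1 - k] still beats the spectral
   loss. *)
pose k := (1 - th * lam) / 2.
have k0 : 0 < k by rewrite /k; lra.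
have thlam0 : 0 <= th * lam by rewrite mulr_ge0.
have k1 : k <= 1 / 2 by rewrite /k; lra.
have kI : 0 <= k <= 1 by apply/andP; split; lra.
pose c := ln (1 + k).
have c0 : 0 < c by rewrite ln_gt0; lra.
(* [e] and below [t] are chosen to make each of their two losses at most [c / 4]; the added 1 keeps
   the denominators positive when [th] or [K] is zero. *)
pose e := c / (4 * (th + 1)).
have e0 : 0 < e by rewrite divr_gt0// mulr_gt0//; lra.
have the : th * e <= c / 4.
  rewrite /e mulrA ler_pdivrMr; last lra.
  rewrite (_ : c / 4 * (4 * (th + 1)) = c * (th + 1)); last by field.
  by rewrite mulrC ler_pM2l; lra.
have [K K0 Ke] := kernel_tail kW e0.
pose t := c / (4 * (th * K * m + 1)).
have tK : 0 <= th * K * m by rewrite !mulr_ge0.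
have t0 : 0 < t by rewrite divr_gt0//; lra.
have tle : th * K * m * t <= c / 4.
  rewrite /t mulrA ler_pdivrMr; last lra.
  rewrite (_ : c / 4 * (4 * (th * K * m + 1)) = c * (th * K * m + 1)); last by field.
  by rewrite mulrC ler_pM2l; lra.
pose B := th / 2 * (C + M) / c + th * K * 4 / t.
have B0 : 0 <= B.
  apply: addr_ge0; apply: divr_ge0; rewrite ?(ltW c0) ?(ltW t0)//.
    by apply: mulr_ge0; [lra|exact: addr_ge0].
  by rewrite !mulr_ge0.
(* [B * H] collects the losses proportional to the entropy; this threshold keeps them below
   [c / 2]. *)
exists (c / (2 * (B + 1))); first by rewrite divr_gt0//; lra.
move=> rho dr iW ih hs.
have [mr r0 ir r1] := dr.
set H := \int[mu]_x hrel (m * rho x) in hs *.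
have BH : B * H <= c / 2.
  apply: le_trans (ler_wpM2l B0 hs) _.
  rewrite mulrA ler_pdivrMr; last lra.
  rewrite (_ : c / 2 * (2 * (B + 1)) = c * (B + 1)); last by field.
  by rewrite mulrC ler_pM2l; lra.
pose eta x := m * rho x - 1.
pose a x := Num.min (eta x) k.
pose b x := Num.max (eta x - k) 0.
have ab x : eta x = a x + b x.
  by rewrite /a /b; have [xk|xk] := leP (eta x) k; [rewrite max_r|rewrite max_l]; lra.
have eta1 x : -1 <= eta x by have := mulr_ge0 m0 (r0 x); rewrite /eta; lra.
have a1 x : `|a x| <= 1.
  by rewrite ler_norml /a le_min ge_min eta1/=; apply/andP; split; [lra|apply/orP; right; lra].
have b0 x : 0 <= b x by rewrite le_max lexx orbT.
have meta : measurable_fun setT eta by apply: measurable_funB => //; exact: measurable_funM.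
have ma : measurable_fun setT a by exact: measurable_minr.
have mb : measurable_fun setT b by apply: measurable_maxr => //; exact: measurable_funB.
have ieta : intg mu eta by apply: intgB; [exact: intgZ|exact: intg_cst].
have ia := intg_bounded mu ma a1.
have ib : intg mu b.
  have -> : b = (fun x => eta x - a x) by apply/funext => x; rewrite ab; ring.
  exact: intgB.
have ia2 : intg mu (fun x => a x ^+ 2).
  apply: (@intg_bounded _ _ _ mu _ 1); first exact: measurable_funX.
  by move=> x; rewrite normrX expr_le1.
have [iee Qe] := kernel_form_deviation dr iW.
have Iab : \int[mu]_x a x + \int[mu]_x b x = 0.
  rewrite -RintD//; transitivity (\int[mu]_x eta x).
    by apply: eq_Rintegral => x _; rewrite ab.
  rewrite RintB; [|exact: intgZ|exact: intg_cst].
  by rewrite RintZ// r1 Rint_cst; ring.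
have etaE : (fun x => m * rho x - 1) = (fun x => a x + b x).
  by apply/funext => x; rewrite -ab.
have iab : intg nu (fun p => W p.1 p.2 * (a p.1 + b p.1) * (a p.2 + b p.2)).
  rewrite (_ : (fun p => _) =
    (fun p => W p.1 p.2 * (m * rho p.1 - 1) * (m * rho p.2 - 1)))//.
  by apply/funext => p; rewrite -!ab.
have [ibb Qab] := kernel_formD ma a1 ib iab.
(* The peaks interact through an unbounded kernel, but as [b >= 0] the lower bound of the kernel is
   enough here. *)
have Qb : - M * (\int[mu]_x b x) ^+ 2 <= Q b.
  have [ibp Eb] := Rint_tensor ib ib.
  rewrite expr2 -Eb -RintZ//.
  apply: Rint_le => //; first exact: intgZ.
  move=> p; rewrite -[leRHS]mulrA; apply: ler_wpM2r; first exact: mulr_ge0.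
  exact: kernel_lb kW _ _.
have [_ Bab] := kernel_schur kW K0 Ke ma a1 ib.
have Ib : \int[mu]_x `|b x| = \int[mu]_x b x.
  by apply: eq_Rintegral => x _; rewrite ger0_norm.
have Ib0 : 0 <= \int[mu]_x b x by exact: Rint_ge0.
have hlow : (1 - k) / 2 * \int[mu]_x (a x ^+ 2) + c * \int[mu]_x b x <= H.
  rewrite -!RintZ// -RintD; [|exact: intgZ|exact: intgZ].
  apply: Rint_le => // [|x]; first by apply: intgD; exact: intgZ.
  exact: (hrel_ge kI (mulr_ge0 m0 (r0 x))).
have Ia2 : 0 <= \int[mu]_x (a x ^+ 2) by apply: Rint_ge0 => x; exact: sqr_ge0.
(* Young's inequality [t * |a| <= t ^+ 2 + a ^+ 2] with the free parameter [t]: the first moment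
   costs a small constant plus a multiple of the entropy. *)
have Ia : \int[mu]_x `|a x| <= t * m + t^-1 * \int[mu]_x (a x ^+ 2).
  rewrite -RintZ// -Rint_cst -RintD; [|exact: intg_cst|exact: intgZ].
  apply: Rint_le => [||x].
  - exact: intg_abs.
  - by apply: intgD; [exact: intg_cst|exact: intgZ].
  rewrite -(ler_pM2l t0) mulrDr [t * (t^-1 * _)]mulrA mulfV ?gt_eqF// mul1r -(real_normK (num_real (a x))).
  have := sqr_ge0 (t - `|a x|); have := normr_ge0 (a x); nra.
have coa := co a ma (ex_intro _ 1 a1).
rewrite Ib in Bab.
rewrite Qe etaE Qab.
have a1E : \int[mu]_x a x = - \int[mu]_x b x by apply/eqP; rewrite -addr_eq0 Iab.
rewrite a1E in coa.
rewrite (_ : _ * _ = - (th / 2 * (Q a + 2 * \int[nu]_p (W p.1 p.2 * a p.1 * b p.2) + Q b))); last by ring.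
apply: (stability_arith th0 _ _ c0 C0 M0 K0 t0 the tle BH Ib0 Ia2 hlow Ia coa Qb Bab).
  by rewrite /k; lra.
by rewrite k1 (ltW k0).
Qed.
End Stability.

(** * Weak compactness and lower semicontinuity *)

Section BoundedSimpleApprox.
Context {d : measure_display} {T : measurableType d} {R : realType}.

Lemma bounded_simple_approx (h : T -> R) (c e : R) : measurable_fun setT h ->
  (forall x, `|h x| <= c) -> 0 < e ->
  exists N (a : nat -> R) (A : nat -> set T), (forall j, measurable (A j)) /\
    forall x, `|h x - \sum_(j < N) a j * \1_(A j) x| <= e.
Proof.
move=> mh hc e0.
pose A j := h @^-1` `[- c + j%:R * e, - c + j.+1%:R * e[%classic.
have mA j : measurable (A j) by rewrite -[A j]setTI; exact: mh.
exists (Num.truncn (2 * c / e)).+1, (fun j => - c + j%:R * e), A; split => // x.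
have c0 : 0 <= c by rewrite (le_trans _ (hc x)).
have /andP[h1 h2] : - c <= h x <= c by rewrite -ler_norml.
pose j := Num.truncn ((h x + c) / e).
have hce : 0 <= (h x + c) / e by rewrite divr_ge0 ?(ltW e0)//; lra.
have /andP[j1 j2] := truncn_itv hce.
rewrite -/j in j1 j2.
have jN : (j < (Num.truncn (2 * c / e)).+1)%N.
  rewrite ltnS; apply: le_truncn; rewrite ler_pM2r ?invr_gt0//; lra.
rewrite ler_pdivlMr// in j1; rewrite ltr_pdivrMr// in j2.
have Aj : A j x by rewrite /A /= in_itv/=; apply/andP; split; lra.
rewrite (bigD1 (Ordinal jN))//= indicE mem_set// mulr1 big1 ?addr0; last first.
  move=> i /eqP ij; rewrite indicE memNset ?mulr0// /A /= in_itv/= => /andP[i1 i2].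
  apply: ij; apply/val_inj/eqP => /=; rewrite eqn_leq; apply/andP; split.
    rewrite -ltnS -(ltr_nat R) -(ltr_pM2r e0); lra.
  rewrite -ltnS -(ltr_nat R) -(ltr_pM2r e0); lra.
rewrite ger0_norm; last lra.
by move: j2; rewrite -natr1 mulrDl; lra.
Qed.
End BoundedSimpleApprox.

Section UltraLimit.
Variables (R : realType) (U : set_system nat).
Context {UF : UltraFilter U}.

(** The image of [U] is an ultrafilter on a compact segment. This replaces every extraction of a
    subsequence, including a diagonal one over uncountably many measurable sets. *)
Lemma ultra_bounded_cvg (a : nat -> R) (c : R) : (forall n, `|a n| <= c) ->
  exists l : R, a @ U --> l.
Proof.
move=> ac.
have aU : UltraFilter (a @ U).
  split=> [|G PG FG]; first exact: fmap_proper_filter.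
  apply/seteqP; split => // B GB.
  have [//|UnB] := in_ultra_setVsetC (a @^-1` B) UF.
  have : G (~` B) by apply: FG.
  by move=> /(filterI GB); rewrite setICr => /filter_ex[].
have := @segment_compact R (- c) c; rewrite compact_ultra => /(_ _ aU).
have : (a @ U) `[- c, c]%classic.
  by rewrite nbhs_simpl /=; apply: filterE => n /=; rewrite in_itv/=; have := ac n; rewrite ler_norml.
by move=> /[swap] /[apply] -[l [_ al]]; exists l.
Qed.
End UltraLimit.

Lemma intg_indicM d (T : measurableType d) (R : realType)
    (mu : {measure set T -> \bar R}) A (f : T -> R) :
  measurable A -> intg mu f -> intg mu (fun x => \1_A x * f x).
Proof.
move=> mA; apply: (@intgMb _ _ _ _ _ _ 1); first exact: measurable_indic.
by move=> x; rewrite indicE; case: (_ \in _); rewrite ?normr1 ?normr0.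
Qed.

Section UltraDensity.
Context {d : measure_display} {T : measurableType d} {R : realType}.
Variable mu : {finite_measure set T -> \bar R}.
Variables (U : set_system nat) (UF : UltraFilter U).
Variables (g : nat -> T -> R) (c : R).
Hypothesis mg : forall n, measurable_fun setT (g n).
Hypothesis g0 : forall n x, 0 <= g n x.
Hypothesis ig : forall n, intg mu (g n).
Hypothesis gc : forall n, \int[mu]_x g n x <= c.

Definition unif_integrable := forall e, 0 < e -> exists2 K, 0 <= K &
  forall n, \int[mu]_x (Num.max (g n x - K) 0) <= e.
Hypothesis gUI : unif_integrable.

Let I (A : set T) n := \int[mu]_x (\1_A x * g n x).

Let iA A n : measurable A -> intg mu (fun x => \1_A x * g n x).
Proof.
by move=> mA; exact: intg_indicM.
Qed.

Let I0 A n : 0 <= I A n.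
Proof. by apply: Rint_ge0 => x; rewrite mulr_ge0. Qed.

Let Ic A n : measurable A -> `|I A n| <= c.
Proof.
move=> mA; rewrite ger0_norm//; apply: le_trans (gc n); apply: Rint_le => //.
  exact: iA.
by move=> x; rewrite indicE; case: (_ \in _); rewrite ?mul1r ?mul0r.
Qed.

(** The limiting set function; 0 is a default value off measurable sets, where no convergence is
    claimed. *)
Let L (A : set T) : R := if `[< measurable A >] then lim (I A @ U) else 0.

Let cvgL A : measurable A -> I A @ U --> L A.
Proof.
move=> mA; rewrite /L asboolT//.
by have [l Il] := ultra_bounded_cvg (fun n => Ic n mA); apply: cvgP Il.
Qed.

Let Lge0 A : 0 <= L A.
Proof.
rewrite /L; case: asboolP => // mA.
have := cvgL mA; rewrite /L asboolT// => cv.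
apply: limr_ge; first exact: cvgP cv.
by apply: filterE => n; exact: I0.
Qed.

Let LU A B : measurable A -> measurable B -> A `&` B = set0 ->
  L (A `|` B) = L A + L B.
Proof.
move=> mA mB AB; have mAB := measurableU _ _ mA mB.
apply: (@cvg_unique _ _ (I (A `|` B) @ U)) => //; first exact: cvgL.
have -> : I (A `|` B) = (fun n => I A n + I B n).
  apply/funext => n; rewrite /I -RintD; [|exact: iA|exact: iA].
  apply: eq_Rintegral => x _; rewrite -mulrDl; congr (_ * _).
  rewrite !indicE; have [xA|xA] := pselect (A x); have [xB|xB] := pselect (B x).
  - by have : set0 x by rewrite -AB.
  - by rewrite (mem_set (or_introl xA : (A `|` B) x)) (mem_set xA) (memNset xB) addr0.
  - by rewrite (mem_set (or_intror xB : (A `|` B) x)) (memNset xA) (mem_set xB) add0r.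
  - by rewrite !memNset//= ?addr0// => -[].
by apply: cvgD; exact: cvgL.
Qed.

(** On [A] the function [g n] is at most [K] plus its excess over [K], whose integral is small
    uniformly in [n]. This bound survives the limit and yields both countable additivity and
    absolute continuity. *)
Let Lle e K A : 0 <= K -> (forall n, \int[mu]_x (Num.max (g n x - K) 0) <= e) ->
  measurable A -> L A <= K * fine (mu A) + e.
Proof.
move=> K0 Ke mA; have cv := cvgL mA.
have -> : L A = lim (I A @ U) by apply/esym/cvg_lim.
apply: limr_le; first exact: cvgP cv.
apply: filterE => n; apply: le_trans (lerD (lexx _) (Ke n)).
have i1 : intg mu (fun x => \1_A x : R) by exact: integrable_indic.
have iK : intg mu (fun x => Num.max (g n x - K) 0).
  apply: (@intg_le _ _ _ _ _ (g n)) => //.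
    by apply: measurable_maxr => //; exact: measurable_funB.
  by move=> x; rewrite ger0_norm ?le_max ?lexx ?orbT// ge_max g0 gerBl K0.
have <- : \int[mu]_x (\1_A x) = fine (mu A) by rewrite /Rintegral integral_indic// setIT.
rewrite -RintZ// -RintD//; last exact: intgZ.
apply: Rint_le => [||x]; [exact: iA|by apply: intgD => //; exact: intgZ|].
have : g n x - K <= Num.max (g n x - K) 0 by rewrite le_max lexx.
have : 0 <= Num.max (g n x - K) 0 by rewrite le_max lexx orbT.
rewrite indicE; case: (_ \in _); rewrite ?mul1r ?mul0r ?mulr0 ?mulr1; lra.
Qed.

Let nu (A : set T) : \bar R := (L A)%:E.

Let L0 : L set0 = 0.
Proof.
have := @LU set0 set0 measurable0 measurable0 (set0I _).
by rewrite setU0 => /eqP; rewrite -subr_eq0 opprD addrA subrr sub0r oppr_eq0 => /eqP.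
Qed.

Let nu0 : nu set0 = 0%E. Proof. by rewrite /nu L0. Qed.
Let nu_ge0 A : (0 <= nu A)%E. Proof. by rewrite lee_fin. Qed.

Let nu_sigma_additive : semi_sigma_additive nu.
Proof.
move=> F mF tF mUF.
pose G n := \big[setU/set0]_(i < n) F i.
have mG n : measurable (G n) by apply: bigsetU_measurable.
have GS n : G n.+1 = G n `|` F n by rewrite /G big_ord_recr.
have GF n : G n `&` F n = set0.
  rewrite /G -bigcup_mkord setI_bigcupl bigcup0// => i /= ltin.
  by move/trivIsetP : tF => /(_ i n Logic.I Logic.I); apply; rewrite ltn_eqF.
have LG n : \sum_(0 <= i < n) nu (F i) = (L (G n))%:E.
  elim: n => [|n IHn]; first by rewrite big_nil /G big_ord0 L0.
  by rewrite big_nat_recr//= IHn GS LU.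
have muG n : (\sum_(0 <= i < n) mu (F i))%E = mu (G n).
  elim: n => [|n IHn]; first by rewrite big_nil /G big_ord0 measure0.
  by rewrite big_nat_recr//= IHn GS measureU.
rewrite [X in X @ _ --> _](_ : _ = (fun n => (L (G n))%:E)); last first.
  by apply/funext => n; rewrite LG.
pose B : set T := \bigcup_k F k.
have mB : measurable B by [].
have GU n : G n `<=` B.
  by rewrite /G -bigcup_mkord => x [i /= _ Fx]; exists i.
apply: cvg_EFin; first exact: nearW.
apply/cvgrPdist_le => /= e e0.
have e20 : 0 < e / 2 by rewrite divr_gt0.
have [K K0 Ke] := gUI e20.
(* The remainder of the union has small [mu]-measure eventually; [Lle] converts this into smallness
   of [L]. *)
have : (fun n => fine (mu (G n))) @ \oo --> fine (mu B).
  apply: (@fine_cvg _ _ _ _ (fun n => mu (G n))); rewrite fineK ?fin_num_measure//.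
  have := @measure_semi_sigma_additive _ _ _ mu F mF tF mUF.
  by under eq_fun do rewrite muG.
move=> /cvgrPdist_le /(_ (e / 2 / (K + 1))); rewrite divr_gt0//; last lra.
move=> /(_ isT); apply: filterS => n.
have mD : measurable (B `\` G n) by exact: measurableD.
have E : (B `\` G n) `|` G n = B by rewrite setUC setDUK.
have DG : (B `\` G n) `&` G n = set0 by rewrite setDE -setIA setICl setI0.
have -> : fine (mu B) - fine (mu (G n)) = fine (mu (B `\` G n)).
  by rewrite -[in LHS]E measureU// fineD ?fin_num_measure// addrK.
have -> : L B - L (G n) = L (B `\` G n) by rewrite -[in LHS]E LU// addrK.
rewrite !ger0_norm ?fine_ge0// => muD.
apply: le_trans (Lle K0 Ke mD) _.
have : K * fine (mu (B `\` G n)) <= e / 2; last lra.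
move: muD; rewrite ler_pdivlMr; last lra.
have : 0 <= fine (mu (B `\` G n)) by rewrite fine_ge0.
nra.
Qed.

HB.instance Definition _ := isMeasure.Build _ _ _ nu nu0 nu_ge0 nu_sigma_additive.
Let nu_fin : fin_num_fun nu. Proof. by []. Qed.
HB.instance Definition _ := Measure_isFinite.Build _ _ _ nu nu_fin.

Let nu_dom : nu `<< mu.
Proof.
apply/null_content_dominatesP => A mA muA0; congr EFin; apply/eqP.
rewrite eq_le Lge0 andbT; apply/ler_addgt0Pr => e e0.
have [K K0 Ke] := gUI e0.
by rewrite add0r; have := Lle K0 Ke mA; rewrite muA0 mulr0 add0r.
Qed.

(* The limit along [U] of the set functions [A |-> \int_A g n] is a measure,
   absolutely continuous by uniform integrability. *)
Lemma ultra_density : exists f : T -> R,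
  [/\ measurable_fun setT f, forall x, 0 <= f x, intg mu f &
    forall (h : T -> R) (c' : R), measurable_fun setT h -> (forall x, `|h x| <= c') ->
      (fun n => \int[mu]_x (h x * g n x)) @ U --> \int[mu]_x (h x * f x)].
Proof.
have [F [F0 Ff iF FA]] := radon_nikodym_sigma_finite nu_dom.
pose f x := fine (F x).
have fE : EFin \o f = F by apply/funext => x /=; rewrite /f fineK.
have if_ : intg mu f by rewrite fE.
have f0 x : 0 <= f x by rewrite fine_ge0.
exists f; split => //; first exact: intg_meas if_.
have fA A : measurable A -> \int[mu]_x (\1_A x * f x) = L A.
  move=> mA; rewrite -[RHS]/(fine (nu A)) FA// integral_mkcond; congr fine.
  apply: eq_integral => x _; rewrite patchE indicE; case: ifP => _.
    by rewrite mul1r -fE.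
  by rewrite mul0r.
have c0 : 0 <= c by apply: le_trans (gc 0%N); exact: Rint_ge0.
move=> h c' mh hc; apply/cvgrPdist_le => e e0.
have If0 : 0 <= \int[mu]_x f x by exact: Rint_ge0.
pose S := c + \int[mu]_x f x + 1.
have S0 : 0 < S by rewrite /S; lra.
pose e' := e / S / 2.
have e'0 : 0 < e' by rewrite !divr_gt0.
(* A uniform approximation of [h] by a simple function reduces the claim to indicators, where it is
   the definition of [L]; the error is controlled by the total masses gathered in [S]. *)
have [N [a [A [mA hs]]]] := bounded_simple_approx mh hc e'0.
pose s x := \sum_(j < N) a j * \1_(A j) x.
have ms : measurable_fun setT s.
  apply: measurable_sum => j; apply: measurable_funM => //.
have diff (u : T -> R) : intg mu u -> (forall x, 0 <= u x) ->
    `|\int[mu]_x (h x * u x) - \int[mu]_x (s x * u x)| <= e' * \int[mu]_x u x.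
  move=> iu u0.
  have ihu : intg mu (fun x => h x * u x) by exact: intgMb mh hc iu.
  have idu : intg mu (fun x => (h x - s x) * u x).
    by apply: intgMb hs iu; exact: measurable_funB.
  have isu : intg mu (fun x => s x * u x).
    have -> : (fun x => s x * u x) = (fun x => h x * u x - (h x - s x) * u x).
      by apply/funext => x; ring.
    exact: intgB.
  rewrite -RintB//; have -> : (fun x => h x * u x - s x * u x) = (fun x => (h x - s x) * u x).
    by apply/funext => x; ring.
  apply: le_trans (Rint_abs idu) _; rewrite -RintZ//; apply: Rint_le.
  - exact: intg_abs.
  - exact: intgZ.
  - by move=> x; rewrite normrM (ger0_norm (u0 x)) ler_wpM2r.
have sE (u : T -> R) : intg mu u -> \int[mu]_x (s x * u x) =
    \sum_(j < N) a j * \int[mu]_x (\1_(A j) x * u x).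
  move=> iu; have i1 j : intg mu (fun x => \1_(A j) x * u x).
    exact: intg_indicM.
  under [RHS]eq_bigr do rewrite -RintZ//.
  rewrite -Rint_sum; last by move=> j; exact: intgZ.
  by apply: eq_Rintegral => x _; rewrite mulr_suml; apply: eq_bigr => j _; rewrite mulrA.
have csum k : (fun n => \sum_(j < k) a j * I (A j) n) @ U -->
    \sum_(j < k) a j * L (A j).
  elim: k => [|k IHk].
    by rewrite big_ord0; under eq_fun do rewrite big_ord0; exact: cvg_cst.
  rewrite big_ord_recr; under eq_fun do rewrite big_ord_recr/=.
  by apply: cvgD IHk _; apply: cvgMl_tmp; exact: cvgL.
have cs : (fun n => \int[mu]_x (s x * g n x)) @ U --> \int[mu]_x (s x * f x).
  have -> : (fun n => \int[mu]_x (s x * g n x)) = (fun n => \sum_(j < N) a j * I (A j) n).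
    by apply/funext => n; rewrite (sE (g n)).
  by rewrite (sE f)//; under [X in _ --> X]eq_bigr do rewrite fA//; exact: csum.
have e2 : 0 < e / 2 by rewrite divr_gt0.
move/cvgrPdist_le : cs => /(_ _ e2); apply: filterS => n sn.
have d1 := diff f if_ f0; have d2 := diff (g n) (ig n) (g0 n).
have : e' * (\int[mu]_x g n x + \int[mu]_x f x) <= e / 2.
  have -> : e / 2 = e' * S by rewrite /e'; field; rewrite gt_eqF.
  by rewrite ler_pM2l// /S; have := gc n; lra.
move: d1 d2 sn; rewrite !ler_norml mulrDr.
by move=> /andP[? ?] /andP[? ?] /andP[? ?] ?; apply/andP; split; lra.
Qed.
End UltraDensity.

Section FatouReal.
Context {d : measure_display} {T : measurableType d} {R : realType}.
Variable mu : {measure set T -> \bar R}.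

Lemma Rint_fatou (g_ : nat -> T -> R) (g : T -> R) (c : R) :
  (forall k x, 0 <= g_ k x) -> (forall k, intg mu (g_ k)) ->
  (forall k, \int[mu]_x g_ k x <= c) -> (forall x, g_ ^~ x @ \oo --> g x) ->
  [/\ forall x, 0 <= g x, intg mu g & \int[mu]_x g x <= c].
Proof.
move=> g0 ig gc gg.
have mg_ k : measurable_fun setT (g_ k) by exact: intg_meas (ig k).
have mg : measurable_fun setT g.
  by apply: (measurable_fun_cvg (h := g_)) => // x _; exact: gg.
have g0' x : 0 <= g x.
  rewrite -(cvg_lim (@Rhausdorff R) (gg x)); apply: limr_ge; first exact: cvgP (gg x).
  exact: nearW.
have mgE k : measurable_fun setT (fun x => (g_ k x)%:E) by exact/measurable_EFinP.
have le1 : (\int[mu]_x (g x)%:E <= c%:E)%E.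
  have := @fatou _ _ _ mu setT measurableT (fun k x => (g_ k x)%:E).
  move=> /(_ mgE (fun k x _ => g0 k x)).
  rewrite (@eq_integral _ _ _ mu setT (EFin \o g)); last first.
    move=> x _; apply: (cvg_limn_einf_sup (_ : (EFin \o g_ ^~ x) @ \oo --> _)).1.
    by apply: cvg_EFin; [exact: nearW|exact: gg].
  move=> /le_trans; apply; rewrite limn_einf_lim; apply: lime_le; first exact: is_cvg_einfs.
  apply: nearW => n; apply: (@le_trans _ _ (\int[mu]_x (g_ n x)%:E)%E).
    by apply: ereal_inf_lbound; exists n => /=.
  by rewrite RintE// lee_fin.
have igg : intg mu g by apply: intg_ge0 => //; rewrite (le_lt_trans le1)// ltry.
by split => //; rewrite -lee_fin -RintE.
Qed.
End FatouReal.

Section FiniteProd.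
Context {d1 d2 : measure_display} {T1 : measurableType d1}
  {T2 : measurableType d2} {R : realType}.
Variables (m1 : {finite_measure set T1 -> \bar R}).
Variables (m2 : {finite_measure set T2 -> \bar R}).

(** An alias carrying a finite-measure structure, so that [ultra_density] applies to densities on
    pairs. *)
Definition finite_prod : set (T1 * T2)%type -> \bar R := (m1 \x m2)%E.
HB.instance Definition _ := Measure.on finite_prod.

Let finite_prod_fin : fin_num_fun finite_prod.
Proof.
move=> A mA; rewrite ge0_fin_numE//.
apply: (@le_lt_trans _ _ (finite_prod setT)); first by rewrite le_measure ?inE.
rewrite /finite_prod -setXTT product_measure1E//.
by rewrite -ge0_fin_numE ?mule_ge0// fin_numM ?fin_num_measure.
Qed.
HB.instance Definition _ := Measure_isFinite.Build _ _ _ finite_prod finite_prod_fin.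
End FiniteProd.

Section EqProd.
Context {d1 d2 : measure_display} {T1 : measurableType d1}
  {T2 : measurableType d2} {R : realType}.
Variable mu : {measure set (T1 * T2)%type -> \bar R}.

(** Dynkin's argument: the sets on which the two integrals agree form a lambda-system containing the
    rectangles, which generate and are stable under intersection. *)
Lemma eq_prod_ae (F G : T1 * T2 -> R) : intg mu F -> intg mu G ->
  (forall A B, measurable A -> measurable B ->
    \int[mu]_p (\1_(A `*` B) p * F p) = \int[mu]_p (\1_(A `*` B) p * G p)) ->
  ae_eq mu setT (EFin \o F) (EFin \o G).
Proof.
move=> iF iG FG.
pose H := [set B : set (T1 * T2) | measurable B /\
  \int[mu]_p (\1_B p * F p) = \int[mu]_p (\1_B p * G p)].
have sH : measurable `<=` H.
  rewrite measurable_prod_measurableType; apply: lambda_system_subset => //.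
  - move=> _ _ [A1 mA1 [B1 mB1 <-]] [A2 mA2 [B2 mB2 <-]]; rewrite -setXI.
    by exists (A1 `&` A2); [exact: measurableI|exists (B1 `&` B2) => //; exact: measurableI].
  - split => //.
    + by split => //; have := FG _ _ measurableT measurableT; rewrite setXTT.
    + move=> A B BA [mA eA] [mB eB]; split; first exact: measurableD.
      have E u p : \1_(A `\` B) p * u p = \1_A p * u p - \1_B p * u p :> R.
        rewrite -mulrBl; congr (_ * _); rewrite !indicE.
        have [pA|pA] := pselect (A p); have [pB|pB] := pselect (B p).
        * by rewrite (mem_set pA) (mem_set pB) memNset ?subrr// => -[].
        * by rewrite (mem_set pA) (memNset pB) mem_set ?subr0.
        * by have := pA (BA _ pB).
        * by rewrite (memNset pA) (memNset pB) memNset ?subr0// => -[].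
      under eq_Rintegral do rewrite E; under [RHS]eq_Rintegral do rewrite E.
      by rewrite !RintB ?eA ?eB//; exact: intg_indicM.
    + move=> A ndA HA.
      have mU : measurable (\bigcup_n A n) by apply: bigcup_measurable => n _; have [] := HA n.
      split => //.
      have cvI (u : T1 * T2 -> R) : intg mu u -> (fun n => \int[mu]_p (\1_(A n) p * u p)) @ \oo -->
          \int[mu]_p (\1_(\bigcup_n A n) p * u p).
        move=> iu; have [||||_ [_ //]] := @Rint_dct _ _ _ mu (fun n p => \1_(A n) p * u p)
          (fun p => \1_(\bigcup_n A n) p * u p) (fun p => `|u p|).
        * by move=> n; apply: intg_meas (intg_indicM _ iu); have [] := HA n.
        * move=> p; apply: cvgMr_tmp; have [[n _ Anp]|nA] := pselect ((\bigcup_n A n) p).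
            rewrite indicE mem_set; last by exists n.
            apply: cvg_near_cst; exists n => // k /= nk; rewrite indicE mem_set//.
            by move/ndA/subsetPset : nk; apply.
          rewrite indicE memNset//; apply: cvg_near_cst; apply: nearW => n.
          by rewrite indicE memNset// => Anp; apply: nA; exists n.
        * exact: intg_abs.
        * move=> n p; rewrite normrM indicE; case: (_ \in _); rewrite ?normr1 ?normr0 ?mul1r ?mul0r//.
      apply: (@cvg_unique _ _ ((fun n => \int[mu]_p (\1_(A n) p * F p)) @ \oo)) => //.
        exact: cvI.
      by rewrite (_ : (fun n => _) = (fun n => \int[mu]_p (\1_(A n) p * G p)));
        [exact: cvI|apply/funext => n; have [] := HA n].
  - move=> _ [A mA [B mB <-]]; split; first exact: measurableX.
    exact: FG.
have E (u : T1 * T2 -> R) B : intg mu u -> measurable B ->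
   (\int[mu]_(p in B) (u p)%:E = (\int[mu]_p (\1_B p * u p))%:E)%E.
  move=> iu mB; rewrite -RintE; last exact: intg_indicM.
  rewrite [LHS]integral_mkcond; apply: eq_integral => p _; rewrite patchE indicE.
  by case: ifP => _; rewrite ?mul1r ?mul0r.
apply: integral_ae_eq => //; first exact: measurable_int iG.
by move=> B _ mB /=; rewrite !E//; have [_ ->] := sH _ mB.
Qed.
End EqProd.

Section Existence.
Context {d : measure_display} {T : measurableType d} {R : realType}.
Variable mu : {finite_measure set T -> \bar R}.
Local Notation nu := (mu \x mu)%E.
Local Notation m := (fine (mu setT)).
Hypothesis m0 : 0 < m.

(** The criterion of de la Vallee Poussin: a bound on a superlinear functional prevents
    concentration. *)
Lemma entropy_unif_integrable (rho : nat -> T -> R) (H : R) :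
  (forall n, rdensity mu (rho n)) ->
  (forall n, intg mu (fun x => hrel (m * rho n x))) ->
  (forall n, \int[mu]_x hrel (m * rho n x) <= H) -> unif_integrable mu rho.
Proof.
move=> dr ih hH e e0.
have h0 n x : 0 <= hrel (m * rho n x).
  by apply: hrel_ge0; exact: mulr_ge0 (ltW m0) (rdensity_ge0 (dr n) x).
have H0 : 0 <= H by apply: le_trans (hH 0%N); exact: Rint_ge0.
(* The tangent of [hrel] at [expR l] has slope [l], so the mass above that level is at most
   [H / (m * l)], and this [l] makes it at most [e]. *)
pose l := H / (m * e) + 1; pose v := expR l.
have l0 : 0 < l.
  by rewrite ltr_wpDl// divr_ge0// mulr_ge0// ltW.
exists (v / m); first by rewrite divr_ge0 ?expR_ge0// ltW.
move=> n.
apply: (@le_trans _ _ (\int[mu]_x ((m * l)^-1 * hrel (m * rho n x)))).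
  apply: Rint_le => [||x].
  - apply: (@intg_le _ _ _ mu _ (rho n)); [|move=> x|exact: rdensity_intg (dr n)].
      by apply: measurable_maxr => //; apply: measurable_funB => //; exact: rdensity_measurable (dr n).
    rewrite ger0_norm ?le_max ?lexx ?orbT// ge_max (rdensity_ge0 (dr n)) andbT.
    by rewrite gerBl divr_ge0 ?expR_ge0// ltW.
  - exact: intgZ.
  rewrite ge_max; apply/andP; split; last first.
    by rewrite mulr_ge0// invr_ge0 mulr_ge0 ?ltW.
  rewrite [leRHS]mulrC ler_pdivlMr ?mulr_gt0//.
  have rx := mulr_ge0 (ltW m0) (rdensity_ge0 (dr n) x).
  have := hrel_tangent rx (expR_gt0 l); rewrite expRK -/v.
  have := hrel_ge0 (expR_ge0 l); rewrite -/v.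
  have -> : (rho n x - v / m) * (m * l) = l * (m * rho n x - v).
    by field; rewrite gt_eqF.
  lra.
rewrite RintZ//; apply: (@le_trans _ _ ((m * l)^-1 * H)).
  by rewrite ler_wpM2l ?invr_ge0 ?mulr_ge0 ?(ltW m0) ?(ltW l0).
rewrite [leLHS]mulrC ler_pdivrMr ?mulr_gt0// /l.
have -> : e * (m * (H / (m * e) + 1)) = H + e * m by field; rewrite !gt_eqF.
by rewrite lerDl mulr_ge0 ?ltW.
Qed.

Variables (U : set_system nat) (UF : UltraFilter U).
Variables (rho : nat -> T -> R) (f : T -> R).
Hypothesis dr : forall n, rdensity mu (rho n).
Hypothesis df : rdensity mu f.
Hypothesis rf : forall (h : T -> R) (c : R), measurable_fun setT h ->
  (forall x, `|h x| <= c) ->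
  (fun n => \int[mu]_x (h x * rho n x)) @ U --> \int[mu]_x (h x * f x).

(* Convexity: [hrel] is the supremum of its tangents, which give weakly
   continuous lower bounds of the entropy. *)
Lemma entropy_lsc (s : nat -> R) (sl : R) :
  (forall n, intg mu (fun x => hrel (m * rho n x))) ->
  (forall n, \int[mu]_x hrel (m * rho n x) <= s n) -> s @ U --> sl ->
  intg mu (fun x => hrel (m * f x)) /\ \int[mu]_x hrel (m * f x) <= sl.
Proof.
move=> ih hs ssl.
(* The point of tangency ought to be [m * f x]; clamping it between [k.+1%:R^-1] and [k.+1%:R] makes
   its logarithm bounded, hence an admissible test function for weak convergence. *)
pose v k x := Num.max k.+1%:R^-1 (Num.min (m * f x) k.+1%:R).
have k0 k : 0 < k.+1%:R^-1 :> R by rewrite invr_gt0 ltr0n.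
have k1 k : k.+1%:R^-1 <= 1 :> R by rewrite invf_le1 ?ltr0n// ler1n.
have k1' k : 1 <= k.+1%:R :> R by rewrite ler1n.
have vlo k x : k.+1%:R^-1 <= v k x by rewrite le_max lexx.
have v0 k x : 0 < v k x by exact: lt_le_trans (k0 k) (vlo k x).
have vhi k x : v k x <= k.+1%:R.
  by rewrite ge_max ge_min lexx orbT andbT (le_trans (k1 k)).
have mf := rdensity_measurable df; have f0 := rdensity_ge0 df.
have mv k : measurable_fun setT (v k).
  by apply: measurable_maxr => //; apply: measurable_minr => //; exact: measurable_funM.
have mln k : measurable_fun setT (fun x => m * ln (v k x)).
  by apply: measurable_funM => //; exact: measurableT_comp (@measurable_ln R) (mv k).
have lnb k x : `|m * ln (v k x)| <= m * ln k.+1%:R.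
  rewrite normrM gtr0_norm// ler_wpM2l ?(ltW m0)// ler_norml -lnV ?posrE ?ltr0n//.
  by rewrite !ler_ln ?posrE ?ltr0n// vlo vhi.
pose g k x := (1 - v k x) + (m * ln (v k x)) * f x.
have gE k (u : R) x : (1 - v k x) + m * ln (v k x) * u =
    hrel (v k x) + ln (v k x) * (m * u - v k x).
  by rewrite /hrel xlnxE; ring.
have i1v k : intg mu (fun x => 1 - v k x).
  apply: (@intg_bounded _ _ _ mu _ (1 + k.+1%:R)); first exact: measurable_funB.
  move=> x; rewrite (le_trans (ler_normB _ _))// normr1 lerD2l gtr0_norm//.
have ilr k (u : T -> R) : intg mu u -> intg mu (fun x => m * ln (v k x) * u x).
  by move=> iu; exact: intgMb (mln k) (lnb k) iu.
have ifm := rdensity_intg df.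
(* [g k] is the value at [m * f] of the tangent at the clamped point. It is nonnegative on either
   side of the clamp and converges to [hrel (m * f)], also where [f] vanishes, so Fatou applies. *)
have [||||_ ig gl] := @Rint_fatou _ _ _ mu g (fun x => hrel (m * f x)) sl.
- move=> k x; rewrite /g gE; apply: addr_ge0; first by apply: hrel_ge0; exact: ltW.
  rewrite /v; have := mulr_ge0 (ltW m0) (f0 x); move: (m * f x) => u u0.
  have [uk|uk] := leP u k.+1%:R.
    have [uk'|uk'] := leP k.+1%:R^-1 u; first by rewrite subrr mulr0.
    rewrite mulr_le0//; last by rewrite subr_le0 ltW.
    by rewrite lnV ?posrE ?ltr0n// oppr_le0 ln_ge0.
  rewrite max_r; last by rewrite (le_trans (k1 k)).
  by rewrite mulr_ge0 ?ln_ge0// subr_ge0 ltW.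
- by move=> k; apply: intgD => //; exact: ilr.
- move=> k; rewrite RintD//; last exact: ilr.
  have cv : (fun n => s n - (\int[mu]_x (1 - v k x) +
      \int[mu]_x (m * ln (v k x) * rho n x))) @ U -->
      sl - (\int[mu]_x (1 - v k x) + \int[mu]_x (m * ln (v k x) * f x)).
    apply: cvgB => //; apply: cvgD; first exact: cvg_cst.
    exact: rf (mln k) (lnb k).
  rewrite -subr_ge0 -[X in _ <= X](cvg_lim (@Rhausdorff R) cv).
  apply: limr_ge; first exact: cvgP cv.
  apply: filterE => n /=; rewrite subr_ge0 -RintD//; last first.
    exact/ilr/(rdensity_intg (dr n)).
  apply: le_trans (hs n); apply: Rint_le => //.
    by apply: intgD => //; exact/ilr/(rdensity_intg (dr n)).
  move=> x; rewrite gE; apply: hrel_tangent => //.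
  by rewrite mulr_ge0 ?(ltW m0)//; exact: rdensity_ge0 (dr n) x.
- move=> x; have := f0 x; rewrite le_eqVlt => /predU1P[fx0|fx].
    rewrite -fx0 mulr0 /g -fx0.
    have -> : hrel 0 = 1 - 0 :> R by rewrite /hrel xlnxE mul0r; ring.
    under eq_fun do rewrite mulr0 addr0.
    apply: cvgB; first exact: cvg_cst.
    under eq_fun do rewrite /v -fx0 mulr0 min_l ?ler0n// max_l ?(ltW (k0 _))//.
    exact: cvg_harmonic.
  have mfx : 0 < m * f x by rewrite mulr_gt0.
  apply: cvg_near_cst.
  have [N1 N1P] : exists N, m * f x <= N.+1%:R.
    exists (Num.truncn (m * f x)); apply: ltW; exact: truncnS_gt.
  have [N2 N2P] : exists N, (m * f x)^-1 <= N.+1%:R.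
    exists (Num.truncn (m * f x)^-1); apply: ltW; exact: truncnS_gt.
  exists (maxn N1 N2) => // k /=; rewrite geq_max => /andP[N1k N2k].
  have -> : g k x = (1 - v k x) + m * ln (v k x) * f x by [].
  rewrite gE; have -> : v k x = m * f x; last by ring.
  rewrite /v min_l; last by rewrite (le_trans N1P)// ler_nat ltnS.
  rewrite max_r// -[leRHS]invrK lef_pV2 ?posrE ?invr_gt0 ?ltr0n//.
  by rewrite (le_trans N2P)// ler_nat ltnS.
by [].
Qed.

Variables (W : T -> T -> R) (M w0 : R).
Hypothesis kW : admissible_kernel mu W M w0.
Hypothesis UI : unif_integrable mu rho.

(** With [t] the excess over [K], the product exceeds [K ^+ 2] by at most [t] times one factor plus
    [t] times the other, and each of these integrates to at most [e / 2]. *)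
Lemma tensor_unif_integrable :
  unif_integrable (finite_prod mu mu) (fun n p => rho n p.1 * rho n p.2).
Proof.
move=> e e0; have e2 : 0 < e / 2 by rewrite divr_gt0.
have [K K0 Ke] := UI e2.
exists (K ^+ 2); first exact: sqr_ge0.
move=> n; have [mr r0 ir r1] := dr n.
pose t x := Num.max (rho n x - K) 0.
have t0 x : 0 <= t x by rewrite le_max lexx orbT.
have mt : measurable_fun setT t by apply: measurable_maxr => //; exact: measurable_funB.
have it : intg mu t.
  apply: (intg_le mt _ ir) => x; rewrite ger0_norm// ge_max r0 andbT gerBl//.
have [i1 e1] := Rint_tensor ir ir; have [i2 e2'] := Rint_tensor it ir.
have [i3 e3] := Rint_tensor ir it.
apply: (@le_trans _ _ (\int[nu]_p (t p.1 * rho n p.2 + rho n p.1 * t p.2))).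
  apply: Rint_le => [||p].
  - apply: (intg_le _ _ i1) => [|p].
      by apply: measurable_maxr => //; apply: measurable_funB => //; exact: intg_meas i1.
    rewrite ger0_norm ?le_max ?lexx ?orbT// ge_max mulr_ge0// andbT gerBl sqr_ge0//.
  - exact: intgD.
  rewrite ge_max; apply/andP; split; last by rewrite addr_ge0// mulr_ge0.
  have := r0 p.1; have := r0 p.2; have := t0 p.1; have := t0 p.2.
  have : rho n p.1 <= K + t p.1 by rewrite -lerBlDl le_max lexx.
  have : rho n p.2 <= K + t p.2 by rewrite -lerBlDl le_max lexx.
  rewrite /t; have [a|a] := leP (rho n p.1 - K) 0; have [b|b] := leP (rho n p.2 - K) 0;
   move: (rho n p.1) (rho n p.2) a b => x y; nra.
rewrite RintD// e2' e3 r1 mulr1 mul1r.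
by have := Ke n; rewrite -/t; lra.
Qed.

(** The energy is quadratic, so weak convergence of [rho n] alone does not suffice: the tensor
    products converge weakly as well, and the kernel, truncated from above, becomes a bounded test
    function for them. *)
Lemma energy_lsc (s : nat -> R) (sl : R) :
  (forall n, intg nu (fun p => W p.1 p.2 * rho n p.1 * rho n p.2)) ->
  (forall n, kernel_form mu W (rho n) <= s n) -> s @ U --> sl ->
  intg nu (fun p => W p.1 p.2 * f p.1 * f p.2) /\ kernel_form mu W f <= sl.
Proof.
move=> iW ws ssl.
have ten n := Rint_tensor (rdensity_intg (dr n)) (rdensity_intg (dr n)).
have [if2 ef2] := Rint_tensor (rdensity_intg df) (rdensity_intg df).
have i2 n : intg nu (fun p => rho n p.1 * rho n p.2) by have [] := ten n.
have [|||||F [mF F0 iF cvF]] := @ultra_density _ _ _ (finite_prod mu mu) U UF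
  (fun n p => rho n p.1 * rho n p.2) 1.
- by move=> n; exact: intg_meas (i2 n).
- by move=> n p; rewrite mulr_ge0//; exact: rdensity_ge0 (dr n) _.
- exact: i2.
- by move=> n; have [_ ->] := ten n; rewrite !(rdensity_int (dr n)) mulr1.
- exact: tensor_unif_integrable.
(* Identification of the weak limit of the tensor products: on rectangles the integrals factor, and
   the limit of a product is the product of the limits. *)
have Fae : ae_eq nu setT (EFin \o F) (EFin \o (fun p => f p.1 * f p.2)).
  apply: eq_prod_ae => // A B mA mB.
  have E (u : T -> R) p : \1_(A `*` B) p * (u p.1 * u p.2) =
      (\1_A p.1 * u p.1) * (\1_B p.2 * u p.2) :> R.
    by rewrite !indicE in_setX -mulnb natrM; ring.
  have EE u : intg mu u -> \int[nu]_p (\1_(A `*` B) p * (u p.1 * u p.2)) =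
     \int[mu]_x (\1_A x * u x) * \int[mu]_x (\1_B x * u x).
    move=> iu; have [_ <-] := Rint_tensor (intg_indicM mA iu) (intg_indicM mB iu).
    by apply: eq_Rintegral => p _; rewrite E.
  have b1 C x : `|\1_C x| <= 1 :> R.
    by rewrite indicE; case: (_ \in _); rewrite ?normr1 ?normr0.
  apply: (@cvg_unique _ (@Rhausdorff R) ((fun n => \int[nu]_p (\1_(A `*` B) p * (rho n p.1 * rho n p.2))) @ U)).
    apply: (cvF _ 1) => [|p]; last first.
      by rewrite indicE; case: (_ \in _); rewrite ?normr1 ?normr0.
    by apply: measurable_indic; exact: measurableX.
  rewrite (EE f (rdensity_intg df)).
  rewrite (_ : (fun n => _) = (fun n => \int[mu]_x (\1_A x * rho n x) *
    \int[mu]_x (\1_B x * rho n x))); last first.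
    by apply/funext => n; rewrite (EE (rho n) (rdensity_intg (dr n))).
  by apply: cvgM; apply: (rf (c := 1)) => //; exact: measurable_indic.
pose Wk (k : nat) (p : T * T) := Num.min (W p.1 p.2) k%:R.
have M0 := kernel_lb_ge0 kW; have lbW := kernel_lb kW.
have mW := kernel_measurable kW.
have mWk k : measurable_fun setT (Wk k) by exact: measurable_minr.
have Wklo k p : - M <= Wk k p.
  by rewrite le_min lbW/= (@le_trans _ _ 0) ?oppr_le0.
have Wkb k p : `|Wk k p| <= M + k%:R.
  rewrite ler_norml (le_trans _ (Wklo k p)) ?lerN2 ?lerDl//= (le_trans (_ : _ <= k%:R)) ?lerDr//.
  by rewrite ge_min lexx orbT.
have iWk k (u : T * T -> R) : intg nu u -> intg nu (fun p => Wk k p * u p).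
  by move=> iu; exact: intgMb (mWk k) (Wkb k) iu.
have Wkle k : \int[nu]_p (Wk k p * (f p.1 * f p.2)) <= sl.
  have -> : \int[nu]_p (Wk k p * (f p.1 * f p.2)) = \int[nu]_p (Wk k p * F p).
    congr fine; apply: ae_eq_integral => //.
    - by apply: measurable_int (iWk k _ if2).
    - by apply: measurable_int (iWk k _ iF).
    - by apply: filterS Fae => p H /H /= [->].
  have cv2 : (fun n => s n - \int[nu]_p (Wk k p * (rho n p.1 * rho n p.2))) @ U -->
      sl - \int[nu]_p (Wk k p * F p).
    by apply: cvgB => //; exact: cvF (mWk k) (Wkb k).
  rewrite -subr_ge0 -[X in _ <= X](cvg_lim (@Rhausdorff R) cv2).
  apply: limr_ge; first exact: cvgP cv2.
  apply: filterE => n /=; rewrite subr_ge0; apply: le_trans (ws n).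
  apply: Rint_le => //; first exact: iWk.
  move=> p; rewrite -[leRHS]mulrA ler_wpM2r//.
    by rewrite mulr_ge0//; exact: rdensity_ge0 (dr n) _.
  by rewrite ge_min lexx.
have f0 := rdensity_ge0 df.
(* Adding [M] makes the truncated kernels nonnegative; since [f] has mass one this shifts every
   integral by [M], and Fatou removes the truncation. *)
have [||||_ ig gl] := @Rint_fatou _ _ _ nu (fun k p => (Wk k p + M) * (f p.1 * f p.2))
  (fun p => (W p.1 p.2 + M) * (f p.1 * f p.2)) (sl + M).
- by move=> k p; rewrite mulr_ge0 ?mulr_ge0// -(opprK M) subr_ge0.
- move=> k; under [X in intg nu X]eq_fun do rewrite mulrDl.
  by apply: intgD; [exact: iWk|exact: intgZ].
- move=> k; under eq_Rintegral do rewrite mulrDl.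
  rewrite RintD; [|exact: iWk|exact: intgZ].
  by rewrite RintZ// ef2 !(rdensity_int df) !mulr1 lerD2r.
- move=> p; apply: cvgMr_tmp; apply: cvgD; last exact: cvg_cst.
  apply: cvg_near_cst; exists (Num.truncn (W p.1 p.2)).+1 => // k /= kW'.
  rewrite /Wk min_l//; apply: ltW; apply: lt_le_trans (truncnS_gt _) _.
  by rewrite ler_nat.
have iWf : intg nu (fun p => W p.1 p.2 * f p.1 * f p.2).
  rewrite (_ : (fun p => _) = (fun p => (W p.1 p.2 + M) * (f p.1 * f p.2) - M * (f p.1 * f p.2))).
    by apply: intgB => //; exact: intgZ.
  by apply/funext => p; ring.
split => //; move: gl; rewrite (_ : \int[nu]_p _ = kernel_form mu W f + M).
  by rewrite lerD2r.
transitivity (\int[nu]_p (W p.1 p.2 * f p.1 * f p.2 + M * (f p.1 * f p.2))).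
  by apply: eq_Rintegral => p _; ring.
rewrite RintD//; last exact: intgZ.
by rewrite RintZ// ef2 !(rdensity_int df) !mulr1.
Qed.
End Existence.

(** * Discontinuity of the transition *)

Section Transition.
Context {d : measure_display} {T : measurableType d} {R : realType}.
Variable mu : {finite_measure set T -> \bar R}.
Local Notation nu := (mu \x mu)%E.
Local Notation m := (fine (mu setT)).
Hypothesis m0 : 0 < m.
Variables (W : T -> T -> R) (M w0 : R).
Hypothesis kW : admissible_kernel mu W M w0.

Definition finite_energy (rho : T -> R) : Prop :=
  [/\ rdensity mu rho, intg nu (fun p => W p.1 p.2 * rho p.1 * rho p.2) &
      intg mu (fun x => hrel (m * rho x))].

Definition rel_entropy (rho : T -> R) := \int[mu]_x hrel (m * rho x).
(** Normalized to vanish at the uniform density, whose kernel form is [w0 / m]; the factor 1/2 is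
    the one of the interaction term in the free energy. *)
Definition energy_gain (rho : T -> R) := (m * w0 - m ^+ 2 * kernel_form mu W rho) / 2.

Lemma rel_entropy_ge0 rho : rdensity mu rho -> 0 <= rel_entropy rho.
Proof.
move=> dr; apply: Rint_ge0 => x; apply: hrel_ge0.
exact: mulr_ge0 (ltW m0) (rdensity_ge0 dr x).
Qed.

Lemma kernel_form_lb rho : rdensity mu rho ->
  intg nu (fun p => W p.1 p.2 * rho p.1 * rho p.2) -> - M <= kernel_form mu W rho.
Proof.
move=> dr iW; have [i2 e2] := Rint_tensor (rdensity_intg dr) (rdensity_intg dr).
have -> : - M = \int[nu]_p (- M * (rho p.1 * rho p.2)).
  by rewrite RintZ// e2 (rdensity_int dr) !mulr1.
apply: Rint_le => //; first exact: intgZ.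
move=> p; rewrite -[leRHS]mulrA ler_wpM2r ?(kernel_lb kW)//.
by rewrite mulr_ge0// (rdensity_ge0 dr).
Qed.

(* The transition point is the infimum of entropy cost over energy gain; a
   minimizing sequence stays away from the uniform state by
   [entropy_stability], so its weak limit is a nontrivial minimizer. *)
Theorem discontinuous_transition (lam C th1 : R) (sigma : T -> R) :
  coercive mu W lam C -> 0 <= C -> 0 < lam -> 0 <= th1 -> th1 * lam < 1 ->
  finite_energy sigma -> rel_entropy sigma < th1 * energy_gain sigma ->
  exists th, [/\ 0 < th, th < th1,
    forall rho, finite_energy rho -> th * energy_gain rho <= rel_entropy rho &
    exists rho, [/\ finite_energy rho, 0 < rel_entropy rho &
      rel_entropy rho = th * energy_gain rho]].
Proof.
move=> co C0 lam0 th10 th1lam asig sig.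
have [s s0 sP] := entropy_stability kW co C0 (ltW lam0) th10 th1lam.
have th1_gt0 : 0 < th1.
  rewrite lt_neqAle th10 andbT; apply/eqP => th1E; move: sig.
  by rewrite -th1E mul0r ltNge rel_entropy_ge0//; case: asig.
have stab rho : finite_energy rho -> rel_entropy rho < th1 * energy_gain rho ->
    s < rel_entropy rho.
  move=> [dr iW ih] lt; rewrite ltNge; apply/negP => le; move: lt.
  apply/negP; rewrite -leNgt; apply: le_trans (sP rho dr iW ih le).
  by rewrite /energy_gain; lra.
pose A := [set rel_entropy rho / energy_gain rho | rho in
   [set rho | finite_energy rho /\ 0 < energy_gain rho]].
have gsig : 0 < energy_gain sigma.
  rewrite -(pmulr_rgt0 _ th1_gt0); apply: le_lt_trans sig.
  by apply: rel_entropy_ge0; case: asig.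
have A0 : A !=set0 by exists (rel_entropy sigma / energy_gain sigma); exists sigma.
have lbA : has_lbound A.
  exists 0 => _ [rho [[dr _ _] g] <-]; by rewrite divr_ge0 ?rel_entropy_ge0// ltW.
have infA : has_inf A by split.
pose th := inf A.
have thle rho : finite_energy rho -> 0 < energy_gain rho ->
    th * energy_gain rho <= rel_entropy rho.
  move=> ar g; rewrite -ler_pdivlMr//; apply: ge_inf => //.
  by exists rho.
have th_ge0 : 0 <= th.
  apply: lb_le_inf => // _ [rho [[dr _ _] g] <-].
  by rewrite divr_ge0 ?rel_entropy_ge0// ltW.
have thth1 : th < th1.
  apply: (@le_lt_trans _ _ (rel_entropy sigma / energy_gain sigma)).
    by apply: ge_inf => //; exists sigma.
  by rewrite ltr_pdivrMr.
(* The slack is a fraction of [th1 - th], so every member has ratio below [th1] and the lower bound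
   [s] on its entropy holds along the whole sequence. *)
have seq n : exists rho, [/\ finite_energy rho, 0 < energy_gain rho &
    rel_entropy rho < (th + (th1 - th) / n.+1%:R) * energy_gain rho].
  have e0 : 0 < (th1 - th) / n.+1%:R by rewrite divr_gt0 ?subr_gt0.
  have [_ [rho [ar g] <-] lt] := inf_adherent e0 infA.
  by exists rho; split => //; rewrite -ltr_pdivrMr.
have [rho rhoP] := choice seq.
have ar n : finite_energy (rho n) by have [] := rhoP n.
have dr n : rdensity mu (rho n) by have [] := ar n.
have gr n : 0 < energy_gain (rho n) by have [] := rhoP n.
have hr n : s < rel_entropy (rho n).
  apply: stab => //; have [_ _] := rhoP n; move=> /lt_le_trans; apply.
  rewrite ler_wpM2r ?(ltW (gr n))// -lerBrDl ler_pdivrMr// ler_peMr ?subr_ge0 ?(ltW thth1)//.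
  by rewrite ler1n.
pose Dm := (m * w0 + m ^+ 2 * M) / 2.
have gD n : energy_gain (rho n) <= Dm.
  have [dn iW _] := ar n; have := kernel_form_lb dn iW.
  rewrite /energy_gain /Dm => H; have := ler_wpM2l (sqr_ge0 m) H; lra.
have hD n : rel_entropy (rho n) <= th1 * Dm.
  have [_ _ H] := rhoP n; apply: le_trans (ltW H) _.
  apply: (@le_trans _ _ (th1 * energy_gain (rho n))); last by rewrite ler_wpM2l.
  rewrite ler_wpM2r ?(ltW (gr n))// -lerBrDl ler_pdivrMr// ler_peMr ?subr_ge0 ?(ltW thth1)//.
  by rewrite ler1n.
have ih n : intg mu (fun x => hrel (m * rho n x)) by have [] := ar n.
have UI := entropy_unif_integrable m0 dr ih hD.
(* An ultrafilter finer than the neighborhoods of infinity, so that ordinary limits persist along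
   it. *)
have [U [UF oU]] := ultraFilterLemma (@eventually_filter).
have [|||||f [mf f0 if_ rf]] := @ultra_density _ _ _ mu U UF rho 1.
- by move=> n; exact: rdensity_measurable (dr n).
- by move=> n x; exact: rdensity_ge0 (dr n) x.
- by move=> n; exact: rdensity_intg (dr n).
- by move=> n; rewrite (rdensity_int (dr n)).
- exact: UI.
have df : rdensity mu f.
  have b1 (x : T) : `|1 : R| <= 1 by rewrite normr1.
  have E (u : T -> R) : \int[mu]_x (1 * u x) = \int[mu]_x u x.
    by apply: eq_Rintegral => x _; rewrite mul1r.
  split => //; rewrite -E.
  apply: (@cvg_unique _ (@Rhausdorff R) ((fun=> 1) @ U)); last exact: cvg_cst.
  have -> : (fun=> 1) = (fun n => \int[mu]_x (1 * rho n x)).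
    by apply/funext => n; rewrite E (rdensity_int (dr n)).
  exact: rf (measurable_cst _) b1.
have [Hl HlP] : exists l : R, (fun n => rel_entropy (rho n)) @ U --> l.
  apply: (ultra_bounded_cvg (c := th1 * Dm)) => n.
  by rewrite ger0_norm ?hD// rel_entropy_ge0.
have [Dl DlP] : exists l : R, (fun n => energy_gain (rho n)) @ U --> l.
  apply: (ultra_bounded_cvg (c := Dm)) => n.
  by rewrite ger0_norm ?gD// ltW.
have Hls : s <= Hl.
  rewrite -(cvg_lim (@Rhausdorff R) HlP); apply: limr_ge; first exact: cvgP HlP.
  by apply: filterE => n; exact: ltW.
have HlDl : Hl <= th * Dl.
  have cve : (fun n => (th1 - th) * n.+1%:R^-1) @ U --> (0 : R).
    apply: cvg_trans (_ : (fun n => (th1 - th) * n.+1%:R^-1) @ \oo --> (0 : R)).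
      by move=> B /oU.
    by rewrite -[X in _ --> X](mulr0 (th1 - th)); apply: cvgMl_tmp; exact: cvg_harmonic.
  have cv : (fun n => (th + (th1 - th) / n.+1%:R) * energy_gain (rho n)
      - rel_entropy (rho n)) @ U --> (th + 0) * Dl - Hl.
    apply: cvgB => //; apply: cvgM => //; apply: cvgD => //; exact: cvg_cst.
  rewrite addr0 in cv.
  rewrite -subr_ge0 -[X in _ <= X](cvg_lim (@Rhausdorff R) cv).
  apply: limr_ge; first exact: cvgP cv.
  by apply: filterE => n; rewrite subr_ge0 ltW//; have [] := rhoP n.
have [ihf hf] := entropy_lsc m0 UF dr df rf ih (fun n => lexx _) HlP.
have cvQ : (fun n => kernel_form mu W (rho n)) @ U --> (m * w0 - 2 * Dl) / m ^+ 2.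
  rewrite (_ : (fun n => _) = (fun n => (m * w0 - 2 * energy_gain (rho n)) / m ^+ 2)).
    apply: cvgMr_tmp; apply: cvgB; first exact: cvg_cst.
    exact: cvgMl_tmp.
  by apply/funext => n; rewrite /energy_gain; field; rewrite gt_eqF.
have [iWf Wf] := energy_lsc UF dr df rf kW UI (fun n => let: And3 _ i _ := ar n in i)
  (fun n => lexx _) cvQ.
have gf : Dl <= energy_gain f.
  move: Wf; rewrite ler_pdivlMr ?exprn_gt0// => Wf.
  rewrite /energy_gain; lra.
have af : finite_energy f by split.
(* Here the separation from the uniform state pays off: the limit entropy is at least [s > 0], which
   forces both [th] and the limiting gain to be positive. *)
have Dl0 : 0 < th * Dl by apply: lt_le_trans s0 (le_trans Hls HlDl).
have th0 : 0 < th.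
  rewrite lt_neqAle th_ge0 andbT; apply/eqP => thE.
  by move: Dl0; rewrite -thE mul0r ltxx.
have Dl_gt0 : 0 < Dl by rewrite -(pmulr_rgt0 _ th0).
have gf0 := lt_le_trans Dl_gt0 gf.
exists th; split => //.
  move=> r ra; have [g|g] := ltP 0 (energy_gain r); first exact: thle.
  rewrite (@le_trans _ _ 0) ?rel_entropy_ge0//; last by case: ra.
  by rewrite mulr_ge0_le0.
have le1 := thle f af gf0.
have le2 : rel_entropy f <= th * energy_gain f.
  by apply: le_trans hf (le_trans HlDl _); rewrite ler_wpM2l.
have e : rel_entropy f = th * energy_gain f by apply/eqP; rewrite eq_le le2.
by exists f; split => //; rewrite e mulr_gt0.
Qed.

Lemma rel_entropy_eq0 rho : rdensity mu rho -> intg mu (fun x => hrel (m * rho x)) ->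
  rel_entropy rho <= 0 -> ae_eq mu setT rho (cst m^-1).
Proof.
move=> dr ih le0.
have h0 x : 0 <= hrel (m * rho x).
  by apply: hrel_ge0; exact: mulr_ge0 (ltW m0) (rdensity_ge0 dr x).
have : ae_eq mu setT (fun x => (hrel (m * rho x))%:E) (cst 0%E).
  apply: (ae_eq_integral_abs mu measurableT (measurable_int _ ih)).1.
  apply/eqP; rewrite eq_le integral_ge0// andbT.
  under eq_integral do rewrite /= ger0_norm//.
  by rewrite RintE// lee_fin.
apply: filterS => x H _; have /eqP := H Logic.I; rewrite eqe => /eqP.
move=> /(hrel_eq0 (mulr_ge0 (ltW m0) (rdensity_ge0 dr x))) E /=.
by rewrite -[LHS](mulKf (lt0r_neq0 m0)) E mulr1.
Qed.
End Transition.

(** * Trigonometric polynomials on the torus *)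

Section TorusMeasure.
Variable R : realType.
Implicit Types L : R.

Lemma measurable_cell L : measurable (cell L).
Proof.
rewrite (_ : cell L = `[0, L[%classic); first exact: measurable_itv.
by apply/seteqP; split => x /=; rewrite in_itv.
Qed.

Definition torus_measure L n : set (n.-tuple R) -> \bar R :=
  cell_measure (measurable_cell L) n.
Arguments torus_measure : clear implicits.
HB.instance Definition _ L n := SigmaFiniteMeasure.on (torus_measure L n).

Lemma ge0_integral_torusS L n (h : n.+1.-tuple R -> \bar R) :
  measurable_fun setT h -> (forall y, (0 <= h y)%E) ->
  (\int[torus_measure L n.+1]_y h y = \int[lebR R]_(x in cell L)
     \int[torus_measure L n]_t h (cons_tuple x t))%E.
Proof.
move=> mh h0; rewrite /torus_measure /cell_measure [LHS]ge0_integral_powerS//.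
rewrite ge0_integral_sigma_restr//; first exact: measurable_integral_cons.
by move=> x; exact: integral_ge0.
Qed.

Lemma lebR_cell L : lebR R (cell L) = (Num.max L 0)%:E.
Proof.
rewrite /lebR /= /push_iso /pushforward preimage_id.
rewrite (_ : cell L = `[0, L[%classic); last first.
  by apply/seteqP; split => x /=; rewrite in_itv.
rewrite lebesgue_measure_itv /= lte_fin; case: ltP => [|]; first by rewrite sube0.
by [].
Qed.

Lemma sigma_restr_cell_setT L :
  sigma_restr (lebR R) (measurable_cell L) setT = (Num.max L 0)%:E.
Proof. by rewrite /sigma_restr /mrestr setTI lebR_cell. Qed.

Lemma torus_measure_setT L n : torus_measure L n setT = (Num.max L 0 ^+ n)%:E.
Proof.
rewrite -[LHS]mul1e -integral_cst//.
elim: n => [|n IHn].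
  by rewrite expr0; apply: (@ge0_integral_power0 _ _ _
    (sigma_restr (lebR R) (measurable_cell L)) (cst 1%E)).
rewrite (@ge0_integral_torusS L n (cst 1%E))//.
under eq_integral do rewrite IHn.
rewrite (integral_cst _ (measurable_cell L)).
by rewrite [X in (_ * X)%E]lebR_cell -EFinM -exprSr.
Qed.

(** The measure is defined on all tuples but sees only the cell; statements restricted to the box
    are therefore almost everywhere statements. *)
Lemma torus_measure_cell L n : torus_measure L n (~` box (cell L) (n:=n)) = 0%E.
Proof.
have mb : measurable (@box R (cell L) n) by exact: (@measurable_box R (cell L) (measurable_cell L) n).
rewrite -[X in torus_measure _ _ X]setIT -integral_indic//; last exact: measurableC.
rewrite [LHS]ge0_integral_cell_measure//.
- rewrite integral0_eq// => x bx; rewrite indicE memNset//; exact.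
- by apply/measurable_EFinP/measurable_indic; exact: measurableC.
Qed.
Let torus_measure_fin L n : fin_num_fun (torus_measure L n).
Proof.
move=> A mA; rewrite ge0_fin_numE//.
apply: (@le_lt_trans _ _ (torus_measure L n setT)).
  by rewrite le_measure ?inE.
by rewrite torus_measure_setT ltry.
Qed.
HB.instance Definition _ L n := Measure_isFinite.Build _ _ _ (torus_measure L n)
  (@torus_measure_fin L n).
End TorusMeasure.
Arguments torus_measure {R} L n.


Section Transfer.
Context {d1 d2 : measure_display} {X : measurableType d1} {Y : measurableType d2}
  {R : realType}.
Variables (m1 : {measure set X -> \bar R}) (m2 : {measure set Y -> \bar R}).
Variable (phi : X -> Y).
Hypothesis transfer : forall h : Y -> \bar R, measurable_fun setT h ->
  (forall y, (0 <= h y)%E) -> (\int[m2]_y h y = \int[m1]_x h (phi x))%E.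

Lemma integral_transfer (f : Y -> \bar R) : measurable_fun setT f ->
  (\int[m2]_y f y = \int[m1]_x f (phi x))%E.
Proof.
move=> mf; rewrite -[RHS]/(\int[m1]_x (f \o phi) x)%E integralE [RHS]integralE.
rewrite (transfer (measurable_funepos mf)); last by move=> y; exact: funepos_ge0.
rewrite (transfer (measurable_funeneg mf)); last by move=> y; exact: funeneg_ge0.
by rewrite (funepos_comp f phi) (funeneg_comp f phi).
Qed.

Lemma Rint_transfer (f : Y -> R) : measurable_fun setT f ->
  \int[m2]_y f y = \int[m1]_x f (phi x).
Proof. by move=> mf; congr fine; apply: integral_transfer; exact/measurable_EFinP. Qed.

Lemma intg_transfer (f : Y -> R) : measurable_fun setT phi ->
  measurable_fun setT f -> intg m2 f <-> intg m1 (fun x => f (phi x)).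
Proof.
move=> mphi mf; have mEf : measurable_fun setT (EFin \o f) by exact/measurable_EFinP.
have mfp : measurable_fun setT (EFin \o (fun x => f (phi x))).
  exact: measurableT_comp mEf mphi.
have E : (\int[m2]_y `|(f y)%:E| = \int[m1]_x `|(f (phi x))%:E|)%E.
  by apply: (@transfer (fun y => `|(f y)%:E|%E)) => //; exact: measurableT_comp.
by split=> /integrableP[_ H]; apply/integrableP; split=> //; move: H; rewrite /= E.
Qed.
End Transfer.

Section TrigIntegral.
Variables (R : realType) (L : R).
Hypothesis L0 : 0 < L.
Local Notation mu1 := (sigma_restr (lebR R) (measurable_cell L)).

Lemma Rint_cell_itv (f : R -> R) : measurable_fun setT f ->
  (\int[mu1]_x (f x)%:E = \int[@lebesgue_measure R]_(x in `[0%R, L]) (f x)%:E)%E.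
Proof.
move=> mf; have mEf : measurable_fun setT (EFin \o f) by exact/measurable_EFinP.
rewrite -integral_itv_bndo_bndc; last exact: measurable_funTS.
rewrite (_ : [set` `[0, L[] = cell L); last first.
  by apply/seteqP; split => x /=; rewrite in_itv.
rewrite integralE [RHS]integralE; congr (_ - _)%E.
  rewrite ge0_integral_sigma_restr ?ge0_integral_lebR_in//;
    [exact: measurable_cell|exact: measurable_funepos..].
rewrite ge0_integral_sigma_restr ?ge0_integral_lebR_in//;
    [exact: measurable_cell|exact: measurable_funeneg..].
Qed.

Lemma measurable_cosD (c k : R) : measurable_fun setT (fun x : R => cos (c + k * x)).
Proof.
apply: (measurableT_comp (@continuous_measurable_fun _ _ (@continuous_cos R))).
by apply: measurable_funD => //; exact: measurable_funM.
Qed.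

Lemma sin_2pi_int (x : R) (j : int) : sin (x + j%:~R * (pi *+ 2)) = sin x.
Proof.
have H (a : nat) y : sin (y + a%:R * (pi *+ 2)) = sin y :> R.
  elim: a y => [|a IHa] y; first by rewrite mul0r addr0.
  by rewrite -natr1 mulrDl mul1r addrA sinD2pi IHa.
case: j => a; first by rewrite -[a%:~R]/(a%:R) H.
by rewrite NegzE mulrNz mulNr -[a.+1%:~R]/(a.+1%:R) -(H a.+1) subrK.
Qed.

Lemma Rint_cos_cell (c : R) (j : int) : j != 0 ->
  \int[mu1]_x cos (c + 2 * pi / L * j%:~R * x) = 0.
Proof.
move=> j0; pose k := 2 * pi / L * j%:~R.
have k0 : k != 0.
  by rewrite mulf_neq0 ?intr_eq0// gt_eqF// divr_gt0// mulr_gt0// pi_gt0.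
rewrite /Rintegral Rint_cell_itv; last exact: measurable_cosD.
pose F x := k^-1 * sin (c + k * x).
have dF (x : R) : is_derive x 1 F (cos (c + k * x)).
  have d1 : is_derive x 1 (fun x : R => c + k * x) k.
    have := derive1D (is_derive_cst (c : R^o) (x : R^o) (1 : R^o))
      (derive1Z k (@is_derive_id R R^o x 1)).
    by rewrite add0r mulr1.
  have ds : is_derive (c + k * x) 1 (@sin R) (cos (c + k * x)) by exact: is_derive_sin.
  have dc := @is_derive1_comp _ (@sin R) (fun x : R => c + k * x) x _ _ ds d1.
  have := derive1Z k^-1 dc.
  by rewrite mulrCA mulVf// mulr1.
rewrite (@continuous_FTC2 _ _ F)//=.
- have -> : F L = F 0.
    rewrite /F mulr0 addr0 (_ : k * L = j%:~R * (pi *+ 2)); last first.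
      by rewrite /k; field; rewrite gt_eqF.
    congr (_ * _); exact: sin_2pi_int.
  by rewrite subrr.
- apply: continuous_subspaceT => x; apply: continuous_comp; last exact: continuous_cos.
  by apply: cvgD; [exact: cvg_cst|apply: cvgM; [exact: cvg_cst|exact: cvg_id]].
- have cF (x : R) : {for x, continuous F}.
    by apply/differentiable_continuous/derivable1_diffP/ex_derive.
  split => [x _||]; first exact: ex_derive.
  + by apply: cvg_at_right_filter; exact: cF.
  + by apply: cvg_at_left_filter; exact: cF.
- by move=> x _; rewrite derive1E; apply: derive_val.
Qed.
End TrigIntegral.

Section Waves.
Variables (R : realType) (L : R).
Hypothesis L0 : 0 < L.
Implicit Types n : nat.

(** The phase [c] covers sines as well, with phase [- (pi / 2)], so real trigonometric polynomials
    need a single family. *)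
Definition wave n (m : n.-tuple int) (c : R) (x : n.-tuple R) : R :=
  cos (c + kdot L m x).

Lemma measurable_kdot n (m : n.-tuple int) : measurable_fun setT (kdot L m).
Proof.
apply: measurable_sum => i; apply: measurable_funM => //.
exact: measurable_tnth.
Qed.

Lemma measurable_wave n (m : n.-tuple int) c : measurable_fun setT (wave m c).
Proof.
apply: (measurableT_comp (@continuous_measurable_fun _ _ (@continuous_cos R))).
by apply: measurable_funD => //; exact: measurable_kdot.
Qed.

Lemma wave_le1 n (m : n.-tuple int) c x : `|wave m c x| <= 1.
Proof. by rewrite ler_norml cos_geN1 cos_le1. Qed.

Lemma intg_wave n (m : n.-tuple int) c : intg (torus_measure L n) (wave m c).
Proof. exact: intg_bounded (measurable_wave m c) (wave_le1 m c). Qed.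

Lemma torus_mass n : fine (torus_measure L n setT) = L ^+ n.
Proof. by rewrite torus_measure_setT max_l// ltW. Qed.

Lemma Rint_torusS n (h : n.+1.-tuple R -> R) (c : R) : measurable_fun setT h ->
  (forall x, `|h x| <= c) -> \int[torus_measure L n.+1]_y h y =
  \int[sigma_restr (lebR R) (measurable_cell L)]_x
     \int[torus_measure L n]_t h (cons_tuple x t).
Proof.
move=> mh hc.
have mcp := @measurable_cons_pair _ R n.
pose mu1 := sigma_restr (lebR R) (measurable_cell L).
have tr := @ge0_integral_push_iso _ _ _ _ _ (sigma_prod mu1 (torus_measure L n)) _ _
  mcp (@measurable_uncons _ R n) (@cons_pairK _ R n) (@unconsK _ R n).
have ih : intg (torus_measure L n.+1) h by exact: intg_bounded mh hc.
have ihc : intg (mu1 \x torus_measure L n)%E (fun p => h (cons_pair p)).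
  exact: (intg_transfer tr mcp mh).1.
have hx (x : R) : intg (torus_measure L n) (fun t => h (cons_pair (x, t))).
  apply: (@intg_bounded _ _ _ _ _ c) => //.
  exact: measurableT_comp mh (@measurable_cons_tuple _ R n x).
have [_ <-] := Rint_fubini1 ihc hx.
exact: (Rint_transfer tr mh).
Qed.

Lemma kdot_cons n (m : n.+1.-tuple int) (x : R) (t : n.-tuple R) :
  kdot L m (cons_tuple x t) =
  2 * pi / L * (thead m)%:~R * x + kdot L [tuple of behead m] t.
Proof.
rewrite /kdot big_ord_recl tnth0; congr (_ + _).
by apply: eq_bigr => i _; rewrite tnthS {1}(tuple_eta m) tnthS.
Qed.

Definition zero_freq n (m : n.-tuple int) : bool := [forall i, tnth m i == 0].

Lemma zero_freqS n (m : n.+1.-tuple int) :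
  zero_freq m = (thead m == 0) && zero_freq [tuple of behead m].
Proof.
apply/forallP/andP => [H|[H0 /forallP H] i].
  split; first exact: H.
  by apply/forallP => i; have := H (lift ord0 i); rewrite {1}(tuple_eta m) tnthS.
case: (unliftP ord0 i) => [j ->|->//].
by rewrite (tuple_eta m) tnthS; exact: H.
Qed.

Lemma Rint_wave n (m : n.-tuple int) (c : R) :
  \int[torus_measure L n]_x wave m c x = if zero_freq m then L ^+ n * cos c else 0.
Proof.
elim: n m c => [|n IHn] m c.
  have -> : zero_freq m by apply/forallP => -[].
  have -> : wave m c = (fun=> cos c).
    by apply/funext => x; rewrite /wave /kdot big_ord0 addr0.
  by rewrite Rint_cst torus_mass expr0 mul1r mulr1.
rewrite (Rint_torusS (measurable_wave m c) (wave_le1 m c)).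
pose k := 2 * pi / L * (thead m)%:~R.
have E x : \int[torus_measure L n]_t wave m c (cons_tuple x t) =
    if zero_freq [tuple of behead m] then L ^+ n * cos (c + k * x) else 0.
  by rewrite -IHn; apply: eq_Rintegral => t _; rewrite /wave kdot_cons addrA.
under eq_Rintegral do rewrite E.
rewrite zero_freqS; case: (zero_freq [tuple of behead m]); rewrite ?andbF ?andbT; last first.
  by rewrite /Rintegral integral0.
rewrite RintZ; last first.
  apply: measurable_bounded_integrable => //.
  - by have := ltry (Num.max L 0); rewrite -(sigma_restr_cell_setT L).
  - exact: measurable_cosD.
  - exists 1; split => // M M1 x _; apply: (le_trans _ (ltW M1)).
    by rewrite ler_norml cos_geN1 cos_le1.
rewrite /k; case: eqP => [->|/eqP m0]; last by rewrite Rint_cos_cell ?mulr0.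
under eq_Rintegral do rewrite mulr0 mul0r addr0.
rewrite Rintegral_cst//; have := congr1 fine (sigma_restr_cell_setT L).
by rewrite /= (max_l (ltW L0)) => ->; rewrite exprS; ring.
Qed.

Lemma wave_mul n (m m' : n.-tuple int) c c' x :
  wave m c x * wave m' c' x =
   1 / 2 * wave [tuple tnth m i + tnth m' i | i < n] (c + c') x +
   1 / 2 * wave [tuple tnth m i - tnth m' i | i < n] (c - c') x.
Proof.
have kD : kdot L [tuple tnth m i + tnth m' i | i < n] x = kdot L m x + kdot L m' x.
  rewrite /kdot -big_split; apply: eq_bigr => i _ /=.
  by rewrite tnth_mktuple intrD; ring.
have kB : kdot L [tuple tnth m i - tnth m' i | i < n] x = kdot L m x - kdot L m' x.
  rewrite /kdot -sumrB; apply: eq_bigr => i _ /=.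
  by rewrite tnth_mktuple intrB; ring.
rewrite /wave kD kB.
rewrite (_ : c + c' + _ = (c + kdot L m x) + (c' + kdot L m' x)); last by ring.
rewrite (_ : c - c' + _ = (c + kdot L m x) - (c' + kdot L m' x)); last by ring.
by move: (c + kdot L m x) (c' + kdot L m' x) => A B; rewrite cosD cosB; field.
Qed.
End Waves.

(** * Bounded measurable functions as iterated limits of trigonometric polynomials *)

Section StepLimit.
Variable R : realType.

Lemma bernoulli_ge (t : R) N : 0 <= t -> 1 + N%:R * t <= (1 + t) ^+ N.
Proof.
move=> t0; elim: N => [|N IHN]; first by rewrite mul0r addr0 expr0.
rewrite exprS; apply: (@le_trans _ _ ((1 + t) * (1 + N%:R * t))).
  have := mulr_ge0 (ler0n R N) (sqr_ge0 t); rewrite -natr1; nra.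
by rewrite ler_wpM2l// addr_ge0.
Qed.

Lemma bernoulli_le (t : R) N : 0 <= t <= 1 -> 1 - N%:R * t <= (1 - t) ^+ N.
Proof.
move=> /andP[t0 t1]; elim: N => [|N IHN]; first by rewrite mul0r subr0 expr0.
rewrite exprS; apply: (@le_trans _ _ ((1 - t) * (1 - N%:R * t))).
  have := mulr_ge0 (ler0n R N) (sqr_ge0 t); rewrite -natr1; nra.
by rewrite ler_wpM2l// subr_ge0.
Qed.

Lemma squeeze_seq (g f h : nat -> R) (l : R) : (forall k, f k <= g k <= h k) ->
  f @ \oo --> l -> h @ \oo --> l -> g @ \oo --> l.
Proof. by move=> fgh; apply: squeeze_cvgr; exact: nearW. Qed.

(** [x] is at most the square of [r = (1 + x) / 2]; Bernoulli bounds [k%:R * r ^+ k], and the other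
    factor [r ^+ k] tends to 0. *)
Lemma cvg_nat_geometric (x : R) : 0 <= x < 1 ->
  (fun k => k%:R * x ^+ k) @ \oo --> 0.
Proof.
move=> /andP[x0 x1]; pose r := (1 + x) / 2.
have r0 : 0 < r by rewrite /r; lra.
have r1 : r < 1 by rewrite /r; lra.
have xr : x <= r ^+ 2 by have := sqr_ge0 (1 - x); rewrite /r; nra.
have rB : 0 < r^-1 - 1 by rewrite subr_gt0 invf_gt1.
have cv : (fun k => (r^-1 - 1)^-1 * r ^+ k) @ \oo --> 0.
  rewrite -[X in _ --> X](mulr0 (r^-1 - 1)^-1); apply: cvgMl_tmp.
  by apply: cvg_expr; rewrite ger0_norm// ltW.
apply: (squeeze_seq _ (cvg_cst (0 : R)) cv) => k.
rewrite mulr_ge0 ?exprn_ge0//=.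
apply: (@le_trans _ _ (k%:R * r ^+ k * r ^+ k)).
  rewrite -mulrA ler_wpM2l// -exprD addnn -mul2n exprM.
  by apply: lerXn2r => //; rewrite nnegrE// sqr_ge0.
rewrite ler_wpM2r ?exprn_ge0 ?(ltW r0)// -[leRHS]mul1r ler_pdivlMr//.
have := bernoulli_ge k (ltW rB); rewrite subrKC => H.
have : r ^+ k * (1 + k%:R * (r^-1 - 1)) <= r ^+ k * r^-1 ^+ k.
  by rewrite ler_wpM2l// exprn_ge0// ltW.
rewrite -exprMn mulfV ?gt_eqF// expr1n mulrDr mulr1.
have := exprn_ge0 k (ltW r0); rewrite mulrA [r ^+ k * k%:R]mulrC; lra.
Qed.

(* Polynomials converging to a step function on [0, 1], as in the
   Brosowski-Deutsch proof of the Stone-Weierstrass theorem. *)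
Definition step_poly k (v : R) := (1 - v ^+ k) ^+ (k * 2 ^ k).

Lemma step_poly_itv k v : 0 <= v <= 1 -> 0 <= step_poly k v <= 1.
Proof.
move=> /andP[v0 v1]; have vk : 0 <= v ^+ k <= 1 by rewrite exprn_ge0// exprn_ile1.
have /andP[v0' v1'] := vk.
by rewrite /step_poly exprn_ge0 ?subr_ge0//= exprn_ile1 ?subr_ge0// lerBlDr lerDl.
Qed.

(** The threshold comes from [k * 2 ^ k] times [v ^+ k] being [k%:R * (2 * v) ^+ k]. Below 1/2 this
    tends to 0 and Bernoulli gives the limit 1; from 1/2 on it is at least [k], and
    [(1 - y) * (1 + y) <= 1] bounds the power by [k.+1%:R^-1]. *)
Lemma cvg_step_poly v : 0 <= v <= 1 ->
  step_poly ^~ v @ \oo --> ((v < 1 / 2)%R%:R : R).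
Proof.
move=> vI; have /andP[v0 v1] := vI.
have vk k : 0 <= v ^+ k <= 1 by rewrite exprn_ge0// exprn_ile1.
have kE k : (k * 2 ^ k)%:R * v ^+ k = k%:R * (2 * v) ^+ k.
  by rewrite natrM natrX exprMn; ring.
case: (ltP v (1 / 2)) => v2.
  have cv : (fun k => 1 - k%:R * (2 * v) ^+ k) @ \oo --> (1 : R).
    rewrite -[X in _ --> X]subr0; apply: cvgB; first exact: cvg_cst.
    by apply: cvg_nat_geometric; apply/andP; split; lra.
  apply: (squeeze_seq _ cv (cvg_cst (1 : R))) => k.
  have /andP[_ ->] := step_poly_itv k vI; rewrite andbT -kE.
  exact: bernoulli_le.
apply: (squeeze_seq _ (cvg_cst (0 : R)) (@cvg_harmonic R)) => k.
have /andP[-> _] := step_poly_itv k vI; rewrite /=.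
have /andP[vk0 vk1] := vk k.
have le1 : (1 - v ^+ k) ^+ (k * 2 ^ k) * (1 + v ^+ k) ^+ (k * 2 ^ k) <= 1.
  rewrite -exprMn exprn_ile1//; first by rewrite mulr_ge0//; lra.
  have := sqr_ge0 (v ^+ k); nra.
have k1 : k.+1%:R <= (1 + v ^+ k) ^+ (k * 2 ^ k).
  apply: le_trans (bernoulli_ge _ vk0); rewrite kE -natr1 addrC lerD2l.
  by rewrite ler_peMr// exprn_ege1//; lra.
rewrite -[leRHS]mul1r ler_pdivlMr ?ltr0n//; apply: le_trans le1.
rewrite ler_wpM2l// exprn_ge0//; lra.
Qed.
End StepLimit.

Section TrigClosure.
Variables (R : realType) (L : R).
Hypothesis L0 : 0 < L.
Variable n : nat.
Implicit Types g h u : n.-tuple R -> R.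

Definition trig_sum (s : seq (n.-tuple int * R * R)) (x : n.-tuple R) : R :=
  \sum_(w <- s) w.2 * wave L w.1.1 w.1.2 x.

(** Positivity of the quadratic form is preserved by bounded pointwise limits, so it is enough to
    reach all bounded measurable functions by such limits. Convergence is asked only on the cell,
    outside of which the measure vanishes and periodicity would get in the way. *)
Inductive trig_closure : (n.-tuple R -> R) -> Prop :=
| trig_closure_sum s : trig_closure (trig_sum s)
| trig_closure_lim (g_ : nat -> n.-tuple R -> R) (g : n.-tuple R -> R) (c : R) :
    (forall k, trig_closure (g_ k)) -> measurable_fun setT g ->
    (forall k x, `|g_ k x| <= c) -> (forall x, `|g x| <= c) ->
    (forall x, box (cell L) x -> g_ ^~ x @ \oo --> g x) -> trig_closure g.

Lemma trig_sum_measurable s : measurable_fun setT (trig_sum s).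
Proof.
rewrite /trig_sum; elim: s => [|w s IHs].
  by under eq_fun do rewrite big_nil; exact: measurable_cst.
under eq_fun do rewrite big_cons; apply: measurable_funD => //.
by apply: measurable_funM => //; exact: measurable_wave.
Qed.

Lemma trig_sum_bounded s x : `|trig_sum s x| <= \sum_(w <- s) `|w.2|.
Proof.
rewrite /trig_sum; apply: le_trans (ler_norm_sum _ _ _) _; apply: ler_sum => w _.
by rewrite normrM ler_piMr// wave_le1.
Qed.

Lemma trig_closure_bounded g : trig_closure g ->
  measurable_fun setT g /\ exists c, forall x, `|g x| <= c.
Proof.
case=> [s|g_ {}g c _ mg _ gc _]; last by split => //; exists c.
by split; [exact: trig_sum_measurable|eexists; exact: trig_sum_bounded].
Qed.

Lemma trig_closureD g h : trig_closure g -> trig_closure h ->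
  trig_closure (fun x => g x + h x).
Proof.
move=> tg; elim: tg h => [s h|g_ {}g c tg IHg mg gc gc' cv h th].
  elim=> [s'|h_ {}h c th IHh mh hc hc' cv].
    rewrite (_ : (fun x => _) = trig_sum (s ++ s')); first exact: trig_closure_sum.
    by apply/funext => x; rewrite /trig_sum big_cat.
  apply: (@trig_closure_lim (fun k x => trig_sum s x + h_ k x) _
    (\sum_(w <- s) `|w.2| + c)) => //.
  - by apply: measurable_funD => //; exact: trig_sum_measurable.
  - by move=> k x; rewrite (le_trans (ler_normD _ _))// lerD// trig_sum_bounded.
  - by move=> x; rewrite (le_trans (ler_normD _ _))// lerD// trig_sum_bounded.
  - by move=> x bx; apply: cvgD; [exact: cvg_cst|exact: cv].
have [mh [c' hc']] := trig_closure_bounded th.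
apply: (@trig_closure_lim (fun k x => g_ k x + h x) _ (c + c')).
- by move=> k; exact: IHg.
- exact: measurable_funD.
- by move=> k x; rewrite (le_trans (ler_normD _ _))// lerD.
- by move=> x; rewrite (le_trans (ler_normD _ _))// lerD.
- by move=> x bx; apply: cvgD; [exact: cv|exact: cvg_cst].
Qed.

Lemma trig_closureZ a g : trig_closure g -> trig_closure (fun x => a * g x).
Proof.
elim=> [s|g_ {}g c tg IHg mg gc gc' cv].
  rewrite (_ : (fun x => _) = trig_sum [seq (w.1, a * w.2) | w <- s]).
    exact: trig_closure_sum.
  apply/funext => x; rewrite /trig_sum big_map mulr_sumr.
  by apply: eq_bigr => w _; rewrite mulrA.
apply: (@trig_closure_lim (fun k x => a * g_ k x) _ (`|a| * c)) => //.
- exact: measurable_funM.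
- by move=> k x; rewrite normrM ler_wpM2l.
- by move=> x; rewrite normrM ler_wpM2l.
- by move=> x bx; apply: cvgMl_tmp; exact: cv.
Qed.

Lemma trig_closure_wave m c : trig_closure (wave L m c).
Proof.
rewrite (_ : wave L m c = trig_sum [:: (m, c, 1)]); first exact: trig_closure_sum.
by apply/funext => x; rewrite /trig_sum big_seq1 mul1r.
Qed.

Lemma trig_closure_cst a : trig_closure (fun=> a).
Proof.
rewrite (_ : (fun=> a) = (fun x => a * wave L [tuple 0 | i < n] 0 x)).
  exact/trig_closureZ/trig_closure_wave.
apply/funext => x; rewrite /wave /kdot big1 ?addr0 ?cos0 ?mulr1// => i _.
by rewrite tnth_mktuple mulr0 mul0r.
Qed.

Lemma trig_closureM_sum s s' : trig_closure (fun x => trig_sum s x * trig_sum s' x).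
Proof.
elim: s => [|[[m c] a] s IHs].
  rewrite (_ : (fun x => _) = (fun=> 0)); first exact: trig_closure_cst.
  by apply/funext => x; rewrite /trig_sum big_nil mul0r.
rewrite (_ : (fun x => _) = (fun x => a * (wave L m c x * trig_sum s' x) +
   trig_sum s x * trig_sum s' x)); last first.
  by apply/funext => x; rewrite {1}/trig_sum big_cons /= -/(trig_sum s x); ring.
apply: trig_closureD => //; apply: trig_closureZ.
elim: s' {IHs} => [|[[m' c'] a'] s' IHs].
  rewrite (_ : (fun x => _) = (fun=> 0)); first exact: trig_closure_cst.
  by apply/funext => x; rewrite /trig_sum big_nil mulr0.
rewrite (_ : (fun x => _) = (fun x => a' * (wave L m c x * wave L m' c' x) +
   wave L m c x * trig_sum s' x)); last first.
  by apply/funext => x; rewrite {1}/trig_sum big_cons /= -/(trig_sum s' x); ring.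
apply: trig_closureD => //; apply: trig_closureZ.
under [X in trig_closure X]eq_fun do rewrite wave_mul.
by apply: trig_closureD; apply: trig_closureZ; exact: trig_closure_wave.
Qed.

Lemma trig_closureM g h : trig_closure g -> trig_closure h ->
  trig_closure (fun x => g x * h x).
Proof.
move=> tg; elim: tg h => [s h|g_ {}g c tg IHg mg gc gc' cv h th].
  elim=> [s'|h_ {}h c th IHh mh hc hc' cv]; first exact: trig_closureM_sum.
  apply: (@trig_closure_lim (fun k x => trig_sum s x * h_ k x) _
    ((\sum_(w <- s) `|w.2|) * c)) => //.
  - by apply: measurable_funM => //; exact: trig_sum_measurable.
  - by move=> k x; rewrite normrM ler_pM// trig_sum_bounded.
  - by move=> x; rewrite normrM ler_pM// trig_sum_bounded.
  - by move=> x bx; apply: cvgMl_tmp; exact: cv.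
have [mh [c' hc']] := trig_closure_bounded th.
apply: (@trig_closure_lim (fun k x => g_ k x * h x) _ (c * c')).
- by move=> k; exact: IHg.
- exact: measurable_funM.
- by move=> k x; rewrite normrM ler_pM.
- by move=> x; rewrite normrM ler_pM.
- by move=> x bx; apply: cvgMr_tmp; exact: cv.
Qed.

Lemma trig_closureX g k : trig_closure g -> trig_closure (fun x => g x ^+ k).
Proof.
move=> tg; elim: k => [|k IHk]; first exact: trig_closure_cst.
by under [X in trig_closure X]eq_fun do rewrite exprS; exact: trig_closureM.
Qed.

Lemma trig_closure_sumr (s : nat) (a : nat -> R) (F : nat -> n.-tuple R -> R) :
  (forall j, trig_closure (F j)) ->
  trig_closure (fun x => \sum_(j < s) a j * F j x).
Proof.
move=> tF; elim: s => [|s IHs].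
  by under [X in trig_closure X]eq_fun do rewrite big_ord0; exact: trig_closure_cst.
under [X in trig_closure X]eq_fun do rewrite big_ord_recr.
by apply: trig_closureD => //; exact: trig_closureZ.
Qed.

(** The closure is an algebra, so polynomials of [u] belong to it, and step polynomials converge to
    the indicator of a sublevel set. *)
Lemma trig_closure_lt u c : trig_closure u -> trig_closure \1_[set x | u x < c].
Proof.
move=> tu; have [mu' [b ub]] := trig_closure_bounded tu.
have b0 : 0 <= b by rewrite (le_trans _ (ub (nseq_tuple n 0))).
(* This [K] places the affine image [v] of [u] in [0, 1] with the level [c] sent to the threshold
   1/2. *)
pose K := 2 * (b + `|c| + 1).
have K0 : 0 < K by rewrite /K; have := normr_ge0 c; lra.
pose v x := 1 / 2 + (u x - c) / K.
have vI x : 0 <= v x <= 1.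
  have := ub x; rewrite ler_norml => /andP[u1 u2].
  have := ler_norm c; have := ler_norm (- c); rewrite normrN => c1 c2.
  have : - (1 / 2) <= (u x - c) / K by rewrite ler_pdivlMr// /K; lra.
  have : (u x - c) / K <= 1 / 2 by rewrite ler_pdivrMr// /K; lra.
  by rewrite /v => *; apply/andP; split; lra.
have vc x : (v x < 1 / 2) = (u x < c).
  by rewrite /v gtrDl pmulr_llt0 ?invr_gt0// subr_lt0.
have tv : trig_closure v.
  rewrite (_ : v = (fun x => (1 / 2 - c / K) + K^-1 * u x)).
    by apply: trig_closureD; [exact: trig_closure_cst|exact: trig_closureZ].
  by apply/funext => x; rewrite /v; ring.
apply: (@trig_closure_lim (fun k x => step_poly k (v x)) _ 1).
- move=> k; apply: trig_closureX.
  rewrite (_ : (fun x => _) = (fun x => 1 + -1 * v x ^+ k)).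
    apply: trig_closureD; [exact: trig_closure_cst|].
    exact/trig_closureZ/trig_closureX.
  by apply/funext => x; rewrite mulN1r.
- apply: measurable_indic; rewrite -[X in measurable X]setTI.
  rewrite (_ : [set x | u x < c] = u @^-1` `]-oo, c[%classic); first exact: mu'.
  by apply/seteqP; split => x /=; rewrite in_itv.
- by move=> k x; have /andP[p0 p1] := step_poly_itv k (vI x); rewrite ger0_norm.
- by move=> x; rewrite indicE; case: (_ \in _); rewrite ?normr1 ?normr0.
- move=> x _; have := cvg_step_poly (vI x); rewrite vc indicE.
  by rewrite (_ : (x \in [set x | u x < c]) = (u x < c))//; apply/idP/idP; rewrite inE.
Qed.
End TrigClosure.

Section CosineSign.
Variable R : realType.

Lemma cos_reflect (t : R) : cos (pi *+ 2 - t) = cos t.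
Proof. by rewrite cosB cos2pi sin2pi mul1r mul0r addr0. Qed.

Lemma sin_reflect (t : R) : sin (pi *+ 2 - t) = - sin t.
Proof. by rewrite sinB cos2pi sin2pi mul1r mul0r add0r. Qed.

Lemma sin_lt0E (t : R) : 0 <= t < pi *+ 2 -> (sin t < 0) = (pi < t).
Proof.
move=> /andP[t0 t2]; have p0 := pi_gt0 R; move: t2; rewrite mulr2n => t2.
case: (leP t pi) => tp.
  by apply/negbTE; rewrite -leNgt sin_ge0_pi// t0.
rewrite -oppr_gt0 -sin_reflect sin_gt0_pi// mulr2n.
by apply/andP; split; lra.
Qed.

(** The cosine does not distinguish an angle from its reflection; the sign of the sine tells which
    half of the circle it is on, and on each half the cosine is monotone. *)
Lemma arc_ltE_low (t c : R) : 0 <= t < pi *+ 2 -> 0 <= c <= pi ->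
  (t < c) = ~~ (sin t < 0) && (cos c < cos t).
Proof.
move=> tI /andP[c0 cp]; rewrite sin_lt0E// -leNgt.
have /andP[t0 t2] := tI.
case: (leP t pi) => tp /=; last by apply/negbTE; rewrite -leNgt; lra.
by rewrite ltr_cos// in_itv/= ?t0 ?c0.
Qed.

Lemma arc_ltE_high (t c : R) : 0 <= t < pi *+ 2 -> pi < c <= pi *+ 2 ->
  (t < c) = ~~ ((sin t < 0) && ~~ (cos t < cos c)).
Proof.
move=> tI cI; rewrite sin_lt0E//; move: cI; rewrite mulr2n => /andP[c0 cp].
have /andP[t0 t2] := tI; move: t2; rewrite mulr2n => t2.
case: (ltP pi t) => tp /=; last by apply/idP; lra.
rewrite negbK -cos_reflect -[in RHS](cos_reflect c) ltr_cos ?in_itv/= ?mulr2n.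
- by apply/idP/idP; lra.
- by apply/andP; split; lra.
- by apply/andP; split; lra.
Qed.
End CosineSign.

Section TrigClosureTotal.
Variables (R : realType) (L : R).
Hypothesis L0 : 0 < L.
Variable n : nat.
Local Notation tc := (@trig_closure R L n).
Implicit Types g h u : n.-tuple R -> R.

Lemma trig_closure_eq g h c : tc g -> measurable_fun setT h ->
  (forall x, `|h x| <= c) -> (forall x, box (cell L) x -> g x = h x) -> tc h.
Proof.
move=> tg mh hc gh; have [mg [c' gc']] := trig_closure_bounded tg.
apply: (@trig_closure_lim _ _ _ (fun=> g) _ (Num.max c c')) => //.
- by move=> k x; rewrite le_max gc' orbT.
- by move=> x; rewrite le_max hc.
- by move=> x bx; rewrite -gh//; exact: cvg_cst.
Qed.

Definition trig_set : set_system (n.-tuple R) := [set A | measurable A /\ tc \1_A].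

Lemma trig_set_indic A (b : bool -> bool) (P : set (n.-tuple R)) :
  trig_set A -> (forall x, (x \in P) = b (x \in A)) -> trig_set P.
Proof.
move=> [mA tA] PA.
have PE (Q : set (n.-tuple R)) : (forall x, b (x \in A) = (x \in Q)) -> P = Q.
  by move=> bQ; apply/seteqP; split => x /mem_set;
    [rewrite PA bQ|rewrite -bQ -PA] => /set_mem.
case bt : (b true); case bf : (b false).
- rewrite (PE setT) => [|x]; last by rewrite in_setT; case: (x \in A).
  by split => //; rewrite indicT; exact: trig_closure_cst.
- by rewrite (PE A)// => x; case: (x \in A).
- rewrite (PE (~` A)) => [|x]; last by rewrite in_setC; case: (x \in A).
  split; first exact: measurableC.
  rewrite (_ : \1_(~` A) = (fun x => 1 + -1 * \1_A x)).
    by apply: trig_closureD; [exact: trig_closure_cst|exact: trig_closureZ].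
  by apply/funext => x; rewrite !indicE in_setC; case: (x \in A) => /=; ring.
- rewrite (PE set0) => [|x]; last by rewrite in_set0; case: (x \in A).
  by split => //; rewrite indic0; exact: trig_closure_cst.
Qed.

Lemma trig_setC A : trig_set A -> trig_set (~` A).
Proof. by move=> tA; apply: (trig_set_indic (b := negb) tA) => x; rewrite in_setC. Qed.

Lemma trig_setI A B : trig_set A -> trig_set B -> trig_set (A `&` B).
Proof.
move=> [mA tA] [mB tB]; split; first exact: measurableI.
by rewrite indicI; exact: trig_closureM.
Qed.

Lemma sigma_algebra_trig_set : sigma_algebra setT trig_set.
Proof.
have t0 : trig_set set0 by split => //; rewrite indic0; exact: trig_closure_cst.
split => // [A tA|A tA]; first by rewrite setTD; exact: trig_setC.
have tU N : trig_set (\bigcup_(k < N) A k).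
  elim: N => [|N IHN]; first by rewrite bigcup_mkord big_ord0.
  rewrite bigcup_mkord big_ord_recr /= -bigcup_mkord -[X in trig_set X]setCK setCU.
  by apply/trig_setC/trig_setI; apply: trig_setC => //; exact: tA.
split; first by apply: bigcup_measurable => k _; exact: (tA k).1.
apply: (@trig_closure_lim _ _ _ (fun N => \1_(\bigcup_(k < N) A k)) _ 1).
- by move=> N; exact: (tU N).2.
- by apply: measurable_indic; apply: bigcup_measurable => k _; exact: (tA k).1.
- by move=> k x; rewrite indicE; case: (_ \in _); rewrite ?normr1 ?normr0.
- by move=> x; rewrite indicE; case: (_ \in _); rewrite ?normr1 ?normr0.
move=> x _; apply: cvg_near_cst; case: (pselect ((\bigcup_k A k) x)) => [|nA].
  move=> /[dup] UA [j _ Aj]; exists j.+1 => // N /= jN.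
  by rewrite !indicE !mem_set//; exists j.
apply: nearW => N; rewrite !indicE !memNset// => -[j _ Aj]; apply: nA.
by exists j.
Qed.

(** On the cell, coordinate [i] is an angle up to the factor [2 * pi / L]; a bound on it is a
    Boolean combination of sublevel sets of its sine and cosine. Thresholds outside the cell give
    constant indicators. *)
Lemma trig_set_coord_lt (i : 'I_n) c : trig_set [set x | tnth x i < c].
Proof.
have mi (b : R) : measurable [set x : n.-tuple R | tnth x i < b].
  rewrite -[X in measurable X]setTI.
  rewrite (_ : [set x | _] = (fun x : n.-tuple R => tnth x i) @^-1` `]-oo, b[%classic).
    exact: measurable_tnth.
  by apply/seteqP; split => x /=; rewrite in_itv.
split; first exact: mi.
have i1 (A : set (n.-tuple R)) x : `|\1_A x : R| <= 1.
  by rewrite indicE; case: (_ \in _); rewrite ?normr1 ?normr0.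
have mind : measurable_fun setT (\1_[set x : n.-tuple R | tnth x i < c] : _ -> R).
  exact: measurable_indic.
have boxE x : box (cell L) x -> 0 <= tnth x i < L by move=> /(_ i).
case: (leP c 0) => c0.
  apply: (trig_closure_eq (trig_closure_cst _ _ 0) mind (i1 _)) => x /boxE/andP[x0 _].
  by rewrite indicE memNset//=; apply/negP; rewrite -leNgt (le_trans c0).
case: (leP L c) => cL.
  apply: (trig_closure_eq (trig_closure_cst _ _ 1) mind (i1 _)) => x /boxE/andP[_ x0].
  by rewrite indicE mem_set//=; exact: lt_le_trans cL.
pose e := [tuple (i == j)%:Z | j < n].
pose k := 2 * pi / L; have k0 : 0 < k by rewrite divr_gt0// mulr_gt0// pi_gt0.
have kL : k * L = pi *+ 2 by rewrite /k mulfVK ?gt_eqF// mulr2n; ring.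
have kE x : kdot L e x = k * tnth x i.
  rewrite /kdot (bigD1 i)//= big1 ?addr0 => [|j ji].
    by rewrite tnth_mktuple eqxx mulr1.
  by rewrite tnth_mktuple eq_sym (negbTE ji) mulr0 mul0r.
have cE x : wave L e 0 x = cos (k * tnth x i) by rewrite /wave kE add0r.
have sE x : wave L e (- (pi / 2)) x = sin (k * tnth x i).
  by rewrite /wave kE addrC cosBpihalf.
have tI x : box (cell L) x -> 0 <= k * tnth x i < pi *+ 2.
  by move=> /boxE/andP[x0 xL]; rewrite mulr_ge0 ?(ltW k0)//= -kL ltr_pM2l.
have tw m b : trig_closure L (@wave R L n m b) by exact: trig_closure_wave.
have ts := trig_closure_lt 0 (tw e (- (pi / 2))).
have tS : trig_set [set x | wave L e (- (pi / 2)) x < 0].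
  split => //; have := (trig_closure_bounded ts).1.
  move=> /(_ measurableT [set 1]) /(_ (measurable_set1 1)); rewrite setTI.
  congr measurable; apply/seteqP; split => x /=; rewrite indicE.
    by case: (boolP (_ \in _)) => [/set_mem//|_ /eqP]; rewrite eq_sym oner_eq0.
  by move=> sx; rewrite mem_set.
have tCg u b : tc u -> trig_set [set x | u x < b].
  move=> tu; split; last exact: trig_closure_lt.
  rewrite -[X in measurable X]setTI.
  rewrite (_ : [set x | u x < b] = u @^-1` `]-oo, b[%classic).
    exact: (trig_closure_bounded tu).1.
  by apply/seteqP; split => x /=; rewrite in_itv.
have inE1 (P : set (n.-tuple R)) (b : bool) x : (P x <-> b) -> (\1_P x : R) = b%:R.
  by move=> Pb; rewrite indicE; case: b Pb => Pb; [rewrite mem_set ?Pb|rewrite memNset// => /Pb].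
case: (leP c (L / 2)) => c2.
  have cI : 0 <= k * c <= pi.
    rewrite mulr_ge0 ?(ltW k0) ?(ltW c0)//=.
    by rewrite (le_trans (ler_wpM2l (ltW k0) c2))// mulrA kL mulr2n; lra.
  have tB := tCg _ (- cos (k * c)) (trig_closureZ (-1) (tw e 0)).
  have [_ tA] := trig_setI (trig_setC tS) tB.
  apply: (trig_closure_eq tA mind (i1 _)) => x bx.
  rewrite (inE1 _ (tnth x i < c))// -(ltr_pM2l k0) (arc_ltE_low (tI x bx) cI).
  apply: inE1 => /=; rewrite sE cE mulN1r ltrN2; split=> [[/negP-> ->]//|/andP[/negP]].
  by split.
have cI : pi < k * c <= pi *+ 2.
  rewrite -kL ler_pM2l// (ltW cL) andbT.
  by move: c2; rewrite -(ltr_pM2l k0) mulrA kL mulr2n; lra.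
have tB := tCg _ (cos (k * c)) (tw e 0).
have [_ tA] := trig_setC (trig_setI tS (trig_setC tB)).
apply: (trig_closure_eq tA mind (i1 _)) => x bx.
rewrite (inE1 _ (tnth x i < c))// -(ltr_pM2l k0) (arc_ltE_high (tI x bx) cI).
apply: inE1 => /=; rewrite sE cE; split=> [H|/negP H [s0 /negP c1]]; last first.
  by apply: H; rewrite s0.
by apply/negP => /andP[s0 /negP c1]; apply: H.
Qed.

(** The sigma-algebra on tuples is generated by preimages under the coordinates, and that of the
    line by open rays. *)
Lemma trig_set_total (A : set (n.-tuple R)) : measurable A -> trig_set A.
Proof.
apply: smallest_sub; first exact: sigma_algebra_trig_set.
apply: (big_ind (fun S => S `<=` trig_set)) => [B []|S1 S2 H1 H2 B []|i _ _ [Y mY <-]].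
- exact: H1.
- exact: H2.
have : (@RGenInftyO.G R).-sigma.-measurable Y by rewrite -RGenInftyO.measurableE.
move: Y {mY}; apply: smallest_sub.
  exact/sigma_algebra_image/sigma_algebra_trig_set.
move=> _ [c ->]; rewrite /image_set_system/= setTI.
rewrite (_ : _ @^-1` _ = [set x | tnth x i < c]); first exact: trig_set_coord_lt.
by apply/seteqP; split => x /=; rewrite in_itv.
Qed.

Lemma trig_closure_total g : measurable_fun setT g ->
  (exists c, forall x, `|g x| <= c) -> tc g.
Proof.
move=> mg [c gc].
have ex k : exists2 h, tc h & forall x, `|g x - h x| <= (k.+1%:R)^-1.
  have [|N [a [A [mA hg]]]] := @bounded_simple_approx _ _ R g c (k.+1%:R)^-1 mg gc.
    by rewrite invr_gt0.
  exists (fun x => \sum_(j < N) a j * \1_(A j) x) => //.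
  by apply: (trig_closure_sumr _ _ (F := fun j => \1_(A j))) => j; exact: (trig_set_total (mA j)).2.
have /choice[h_ hP] : forall k, exists h, tc h /\ forall x, `|g x - h x| <= (k.+1%:R)^-1.
  by move=> k; have [h ? ?] := ex k; exists h.
apply: (@trig_closure_lim _ _ _ h_ _ (c + 1)) => //.
- by move=> k; exact: (hP k).1.
- move=> k x; rewrite -[h_ k x](subKr (g x)) (le_trans (ler_normB _ _))// lerD//.
  by rewrite (le_trans ((hP k).2 x))// invf_le1// ler1n.
- by move=> x; rewrite (le_trans (gc x))// lerDl.
move=> x _.
have cm : (fun k => g x - k.+1%:R^-1) @ \oo --> g x.
  by rewrite -[X in _ --> X]subr0; apply: cvgB; [exact: cvg_cst|exact: cvg_harmonic].
have cp : (fun k => g x + k.+1%:R^-1) @ \oo --> g x.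
  by rewrite -[X in _ --> X]addr0; apply: cvgD; [exact: cvg_cst|exact: cvg_harmonic].
apply: (squeeze_seq _ cm cp) => k.
have := (hP k).2 x; move: (k.+1%:R^-1) => e; rewrite ler_norml => /andP[? ?].
by apply/andP; split; lra.
Qed.
End TrigClosureTotal.

Lemma Rint_eq_null d (T : measurableType d) (R : realType)
    (mu : {measure set T -> \bar R}) (B : set T) (f g : T -> R) :
  measurable B -> mu (~` B) = 0%E -> measurable_fun setT f -> measurable_fun setT g ->
  (forall x, B x -> f x = g x) -> \int[mu]_x f x = \int[mu]_x g x.
Proof.
move=> mB B0 mf mg fg; congr fine; apply: ae_eq_integral => //.
- exact/measurable_EFinP.
- exact/measurable_EFinP.
exists (~` B); split => //; first exact: measurableC.
by move=> x /= + Bx; apply => _; rewrite fg.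
Qed.

(** * The spectral lower bound on the torus *)

Section TorusCoercive.
Variables (R : realType) (L : R).
Hypothesis L0 : 0 < L.
Variable n : nat.
Local Notation mu := (torus_measure L n).
Local Notation nu := (mu \x mu)%E.
Variables (W : n.-tuple R -> n.-tuple R -> R) (M w0 : R).
Hypothesis kW : admissible_kernel mu W M w0.
Variables (vh : n.-tuple int -> R) (lam : R).
Hypothesis eigen : forall m c x, box (cell L) x ->
  \int[mu]_y (W x y * wave L m c y) = vh m * wave L m c x.
Hypothesis vh_even : forall m, vh [tuple - tnth m i | i < n] = vh m.
Hypothesis lam_ge0 : 0 <= lam.
Hypothesis vh_lam : forall m, ~~ zero_freq m -> 0 <= vh m + lam.

Local Notation B := (box (cell L) (n:=n)).
Let mB : measurable B := @measurable_box R (cell L) (measurable_cell L) n.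
Let B0 : mu (~` B) = 0%E := torus_measure_cell L n.
Let C := `|vh [tuple 0 | i < n]| / L ^+ n.
Let Q := kernel_form mu W.
Let Phi g := Q g + lam * \int[mu]_x (g x ^+ 2) + C * (\int[mu]_x g x) ^+ 2.
(** Approximants converge only on the cell; setting them to zero elsewhere gives convergence
    everywhere, as dominated convergence is stated, without changing the form. *)
Let cut (g : n.-tuple R -> R) x := g x * \1_B x.

Lemma kernel_form_row (g : n.-tuple R -> R) c : measurable_fun setT g ->
  (forall x, `|g x| <= c) ->
  measurable_fun setT (fun x => g x * \int[mu]_y (W x y * g y)) /\
  Q g = \int[mu]_x (g x * \int[mu]_y (W x y * g y)).
Proof.
move=> mg gc; have ig := intg_bounded mu mg gc.
have iF := intg_kernel_schur kW mg gc ig.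
have iW x : intg mu (fun y => W x y * g y).
  under [X in intg mu X]eq_fun do rewrite mulrC.
  exact: intgMb mg gc (intg_kernel_row kW x).
have iR x : intg mu (fun y => W x y * g x * g y).
  by under [X in intg mu X]eq_fun do rewrite mulrAC mulrC; exact: intgZ.
have E x : \int[mu]_y (W x y * g x * g y) = g x * \int[mu]_y (W x y * g y).
  by rewrite -RintZ//; apply: eq_Rintegral => y _; ring.
have [iO eO] := @Rint_fubini1 _ _ _ _ _ mu mu
  (fun p => W p.1 p.2 * g p.1 * g p.2) iF iR.
split; last by rewrite [LHS]eO; apply: eq_Rintegral => x _; rewrite E.
by under eq_fun do rewrite -E; exact: intg_meas iO.
Qed.

Lemma measurable_cut (g : n.-tuple R -> R) : measurable_fun setT g -> measurable_fun setT (cut g).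
Proof. by move=> mg; apply: measurable_funM => //; exact: measurable_indic. Qed.

Lemma cut_bounded (g : n.-tuple R -> R) c : (forall x, `|g x| <= c) -> forall x, `|cut g x| <= c.
Proof.
move=> gc x; rewrite /cut indicE; case: (_ \in _); rewrite ?mulr1 ?mulr0 ?normr0//.
exact: le_trans (gc x).
Qed.

Lemma cut_box (g : n.-tuple R -> R) x : B x -> cut g x = g x.
Proof. by move=> Bx; rewrite /cut indicE mem_set// mulr1. Qed.

Lemma form_cut (g : n.-tuple R -> R) c : measurable_fun setT g -> (forall x, `|g x| <= c) ->
  Phi (cut g) = Phi g.
Proof.
move=> mg gc; have [m1 Q1] := kernel_form_row (measurable_cut mg) (cut_bounded gc).
have [m2 Q2] := kernel_form_row mg gc.
have e1 : Q (cut g) = Q g.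
  apply: (etrans Q1); apply: (etrans _ (esym Q2)).
  apply: (Rint_eq_null mB B0) => // x Bx; rewrite cut_box//; congr (_ * _).
  have mW := kernel_row_measurable kW x.
  apply: (Rint_eq_null mB B0) => [||y By]; last by rewrite cut_box.
  + by apply: measurable_funM => //; exact: measurable_cut.
  + exact: measurable_funM.
have e2 : \int[mu]_x (cut g x ^+ 2) = \int[mu]_x (g x ^+ 2).
  apply: (Rint_eq_null mB B0) => [||y By]; last by rewrite cut_box.
  + by apply: measurable_funX; exact: measurable_cut.
  + exact: measurable_funX.
have e3 : \int[mu]_x cut g x = \int[mu]_x g x.
  by apply: (Rint_eq_null mB B0) => //; [exact: measurable_cut|exact: cut_box].
by rewrite /Phi e1 e2 e3.
Qed.

Lemma form_lim (g_ : nat -> n.-tuple R -> R) (g : n.-tuple R -> R) c :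
  (forall k, measurable_fun setT (g_ k)) -> (forall k x, `|g_ k x| <= c) ->
  (forall x, g_ ^~ x @ \oo --> g x) -> (fun k => Phi (g_ k)) @ \oo --> Phi g.
Proof.
move=> mg_ gc cv; have c0 : 0 <= c by rewrite (le_trans _ (gc 0 (nseq_tuple n 0))).
have ic a : intg mu (fun=> a : R) by exact: intg_cst.
have iW : intg nu (fun p => c ^+ 2 * `|W p.1 p.2 * 1 * 1|).
  apply: intgZ; apply: intg_abs.
  by apply: (@intg_kernel_schur _ _ _ mu W M w0 kW 1 (fun=> 1) (fun=> 1)) => // ?; rewrite normr1.
have mQ k : measurable_fun setT (fun p => W p.1 p.2 * g_ k p.1 * g_ k p.2).
  exact: (measurable_kernel2 kW (mg_ k) (mg_ k)).
have cQ p : (fun k => W p.1 p.2 * g_ k p.1 * g_ k p.2) @ \oo -->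
    W p.1 p.2 * g p.1 * g p.2.
  by apply: cvgM; [apply: cvgMl_tmp|]; exact: cv.
have bQ k p : `|W p.1 p.2 * g_ k p.1 * g_ k p.2| <= c ^+ 2 * `|W p.1 p.2 * 1 * 1|.
  rewrite !mulr1 normrM normrM -mulrA mulrC ler_wpM2r// expr2.
  by apply: ler_pM => //; exact: gc.
have m2 k : measurable_fun setT (fun x => g_ k x ^+ 2) by exact: measurable_funX.
have c2 x : (fun k => g_ k x ^+ 2) @ \oo --> g x ^+ 2 by apply: cvgM; exact: cv.
have b2 k x : `|g_ k x ^+ 2| <= c ^+ 2 by rewrite normrX lerXn2r// nnegrE.
have [_ [_ cvQ]] := Rint_dct mQ cQ iW bQ.
have [_ [_ cv2]] := Rint_dct m2 c2 (ic _) b2.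
have [_ [_ cv1]] := Rint_dct mg_ cv (ic _) gc.
apply: cvgD; first apply: cvgD; first exact: cvQ.
  by apply: cvgMl_tmp; exact: cv2.
by apply: cvgMl_tmp; apply: cvgM; exact: cv1.
Qed.

Lemma Rint_wave_mul m m' c c' :
  \int[mu]_x (wave L m c x * wave L m' c' x) =
  1 / 2 * (if zero_freq [tuple tnth m i + tnth m' i | i < n]
           then L ^+ n * cos (c + c') else 0) +
  1 / 2 * (if zero_freq [tuple tnth m i - tnth m' i | i < n]
           then L ^+ n * cos (c - c') else 0).
Proof.
under eq_Rintegral do rewrite wave_mul.
have iw k b : intg mu (fun x => 1 / 2 * wave L k b x) by apply: intgZ; exact: intg_wave.
by rewrite RintD// !RintZ ?Rint_wave//; exact: intg_wave.
Qed.

Lemma zero_freqP k (m : k.-tuple int) : reflect (m = [tuple 0 | i < k]) (zero_freq m).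
Proof.
apply: (iffP forallP) => [m0|-> i]; last by rewrite tnth_mktuple.
by apply: eq_from_tnth => i; rewrite tnth_mktuple; exact/eqP.
Qed.

(** The Fourier multiplier of [Phi]: [C] was chosen so that at frequency zero the extra term is
    [|vh 0|], which makes the multiplier nonnegative there too. *)
Let weight m := vh m + lam + (if zero_freq m then C * L ^+ n else 0).

Lemma weight_ge0 m : 0 <= weight m.
Proof.
rewrite /weight; case: ifPn => [/zero_freqP->|m0]; last by rewrite addr0 vh_lam.
rewrite /C divfK ?gt_eqF ?exprn_gt0//.
by have := lam_ge0; move: (vh _) => v; have := ler_norm (- v); rewrite normrN; lra.
Qed.

(** Two waves are orthogonal unless their frequencies are equal or opposite, and then [vh_even]
    makes their weights coincide, so the square roots multiply to the weight itself. *)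
Lemma weight_inner m m' c c' :
  Num.sqrt (weight m) * Num.sqrt (weight m') * \int[mu]_x (wave L m c x * wave L m' c' x) =
  (vh m' + lam) * \int[mu]_x (wave L m c x * wave L m' c' x) +
  C * (\int[mu]_x wave L m c x * \int[mu]_x wave L m' c' x).
Proof.
have sq k : Num.sqrt (weight k) * Num.sqrt (weight k) = weight k.
  by rewrite -expr2 sqr_sqrtr // weight_ge0.
rewrite Rint_wave_mul !(Rint_wave L0).
have zD k : zero_freq [tuple tnth k i - tnth m' i | i < n] = (k == m').
  apply/forallP/eqP => [H|-> i]; last by rewrite tnth_mktuple subrr.
  by apply: eq_from_tnth => i; have := H i; rewrite tnth_mktuple subr_eq0 => /eqP.
case: (boolP (zero_freq m)) => [/zero_freqP m0|m0].
  have zm : zero_freq [tuple tnth m i + tnth m' i | i < n] = zero_freq m'.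
    rewrite m0; congr zero_freq; apply: eq_from_tnth => i.
    by rewrite !tnth_mktuple add0r.
  have zm' : (m == m') = zero_freq m' by rewrite m0 eq_sym; apply/eqP/zero_freqP.
  rewrite zm zD zm'; case: (boolP (zero_freq m')) => [/[dup] zz /zero_freqP m'0|_]; last first.
    by rewrite !mulr0 addr0 !mulr0 addr0.
  rewrite m'0 -m0 sq /weight (_ : zero_freq m); last by apply/zero_freqP.
  by rewrite cosD cosB; field.
rewrite mul0r mulr0 addr0 zD.
have [mm'|mm'] := eqVneq m m'.
  by rewrite mm' sq /weight; move: m0; rewrite mm' => /negbTE->; rewrite addr0.
case: ifPn => [zm|_]; last by rewrite !mulr0 addr0 !mulr0.
have mE : m = [tuple - tnth m' i | i < n].
  apply: eq_from_tnth => i; rewrite tnth_mktuple; apply/eqP.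
  by have /forallP/(_ i) := zm; rewrite tnth_mktuple addr_eq0.
have -> : weight m = weight m'.
  have zE : zero_freq m = zero_freq m'.
    by rewrite mE; apply/forallP/forallP => H i; have := H i; rewrite tnth_mktuple oppr_eq0.
  have vE : vh m = vh m' by rewrite mE vh_even.
  by rewrite /weight zE vE.
rewrite sq /weight (_ : zero_freq m' = false) ?addr0//.
apply/negbTE; apply: contra m0 => /zero_freqP m'0.
by apply/zero_freqP; rewrite mE m'0; apply: eq_from_tnth => i; rewrite !tnth_mktuple oppr0.
Qed.

Let wv (w : n.-tuple int * R * R) := wave L w.1.1 w.1.2.

Lemma Rint_trig_sum_mul (s : seq (n.-tuple int * R * R)) (u v : n.-tuple int * R * R -> R) :
  \int[mu]_x ((\sum_(w <- s) u w * wv w x) * (\sum_(w <- s) v w * wv w x)) =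
  \sum_(w <- s) \sum_(w' <- s) u w * v w' * \int[mu]_x (wv w x * wv w' x).
Proof.
have iww w w' : intg mu (fun x => wv w x * wv w' x).
  apply: (@intg_bounded _ _ _ mu _ 1); first by apply: measurable_funM; exact: measurable_wave.
  by move=> x; rewrite normrM mulr_ile1// wave_le1.
have E x : (\sum_(w <- s) u w * wv w x) * (\sum_(w <- s) v w * wv w x) =
    \sum_(w <- s) \sum_(w' <- s) u w * v w' * (wv w x * wv w' x).
  rewrite mulr_suml; apply: eq_bigr => w _; rewrite mulr_sumr.
  by apply: eq_bigr => w' _; ring.
under eq_Rintegral do rewrite E.
rewrite Rint_sum => [|w]; last by apply: intg_sum => w'; exact: intgZ.
apply: eq_bigr => w _; rewrite Rint_sum => [|w']; last exact: intgZ.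
by apply: eq_bigr => w' _; rewrite RintZ.
Qed.

Lemma kernel_form_trig_sum s : Q (trig_sum L s) = \sum_(w <- s) \sum_(w' <- s)
  w.2 * (w'.2 * vh w'.1.1) * \int[mu]_x (wv w x * wv w' x).
Proof.
pose g := @trig_sum R L n s.
have iw (w : n.-tuple int * R * R) : intg mu (wv w) by exact: intg_wave.
have [mQ QE] := kernel_form_row (@trig_sum_measurable R L n s) (@trig_sum_bounded R L n s).
have rowE x : B x -> \int[mu]_y (W x y * g y) = \sum_(w <- s) (w.2 * vh w.1.1) * wv w x.
  move=> Bx; have iW w : intg mu (fun y => W x y * wv w y).
    under [X in intg mu X]eq_fun do rewrite mulrC.
    exact: intgMb (measurable_wave L _ _) (wave_le1 L _ _) (intg_kernel_row kW x).
  have E y : W x y * g y = \sum_(w <- s) w.2 * (W x y * wv w y).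
    by rewrite mulr_sumr; apply: eq_bigr => w _; rewrite /wv; ring.
  under eq_Rintegral do rewrite E.
  rewrite Rint_sum => [|w]; last exact: intgZ.
  by apply: eq_bigr => w _; rewrite RintZ// eigen// mulrA.
rewrite [LHS]QE.
have -> : \int[mu]_x (g x * \int[mu]_y (W x y * g y)) =
    \int[mu]_x (g x * \sum_(w <- s) (w.2 * vh w.1.1) * wv w x).
  apply: (Rint_eq_null mB B0) => // [|x Bx]; last by rewrite -rowE.
  apply: measurable_funM; first exact: trig_sum_measurable.
  by apply: (intg_meas (mu := mu)); apply: intg_sum => w; exact: intgZ.
exact: (Rint_trig_sum_mul s (fun w => w.2) (fun w => w.2 * vh w.1.1)).
Qed.

Lemma Rint_trig_sum_sqr s : \int[mu]_x (trig_sum L s x ^+ 2) =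
  \sum_(w <- s) \sum_(w' <- s) w.2 * w'.2 * \int[mu]_x (wv w x * wv w' x).
Proof.
under eq_Rintegral do rewrite expr2.
exact: (Rint_trig_sum_mul s (fun w => w.2) (fun w => w.2)).
Qed.

Lemma Rint_trig_sum s : \int[mu]_x trig_sum L s x = \sum_(w <- s) w.2 * \int[mu]_x wv w x.
Proof.
have iw (w : n.-tuple int * R * R) : intg mu (wv w) by exact: intg_wave.
rewrite Rint_sum => [|w]; last by apply: intgZ; exact: iw.
by apply: eq_bigr => w _; rewrite RintZ//; exact: iw.
Qed.

Lemma form_trig_sum s : 0 <= Phi (trig_sum L s).
Proof.
(* Applying the square root of the multiplier exhibits [Phi] as the integral of a square. *)
pose h x := \sum_(w <- s) (w.2 * Num.sqrt (weight w.1.1)) * wv w x.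
suff -> : Phi (trig_sum L s) = \int[mu]_x (h x * h x).
  by apply: Rint_ge0 => x; rewrite -expr2 sqr_ge0.
rewrite /Phi kernel_form_trig_sum Rint_trig_sum_sqr Rint_trig_sum Rint_trig_sum_mul.
rewrite expr2 mulr_suml !mulr_sumr -!big_split.
apply: eq_bigr => w _ /=.
rewrite mulr_sumr !mulr_sumr -!big_split; apply: eq_bigr => w' _ /=.
have := weight_inner w.1.1 w'.1.1 w.1.2 w'.1.2.
rewrite -/(wv w) -/(wv w') => E.
transitivity (w.2 * w'.2 * (Num.sqrt (weight w.1.1) * Num.sqrt (weight w'.1.1) *
  \int[mu]_x (wv w x * wv w' x))); last by ring.
by rewrite E; ring.
Qed.

Lemma torus_coercive : coercive mu W lam C.
Proof.
suff H g : trig_closure L g -> 0 <= Phi g.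
  by move=> g mg gc; apply: H; exact: trig_closure_total.
elim=> [s|g_ {}g c tg IHg mg gc gc' cv]; first exact: form_trig_sum.
rewrite -(form_cut mg gc').
have cvP : (fun k => Phi (cut (g_ k))) @ \oo --> Phi (cut g).
  apply: (@form_lim _ _ c).
  - by move=> k; apply: measurable_cut; exact: (trig_closure_bounded (tg k)).1.
  - by move=> k; exact: cut_bounded.
  move=> x; rewrite /cut indicE; case: (boolP (x \in B)) => [/set_mem/cv ?|_].
    by apply: cvgMr_tmp.
  by under eq_fun do rewrite mulr0; rewrite mulr0; exact: cvg_cst.
rewrite -[leRHS](cvg_lim (@Rhausdorff R) cvP); apply: limr_ge; first exact: cvgP cvP.
apply: nearW => k; rewrite (form_cut (trig_closure_bounded (tg k)).1 (gc k)).
exact: IHg.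
Qed.
End TorusCoercive.

(** * Fourier transform of an isotropic potential *)

Lemma cos_lipschitz (R : realType) (u v : R) : `|cos u - cos v| <= `|u - v|.
Proof.
wlog vu : u v / v < u.
  move=> H; case: (ltgtP u v) => [uv|/H//|->]; last by rewrite !subrr.
  by rewrite distrC [leRHS]distrC; exact: H.
have [|z _ ->] := @MVT _ cos (fun x => - sin x) v u vu (fun x _ => is_derive_cos x).
  by apply: continuous_subspaceT => x; exact: continuous_cos.
by rewrite normrM normrN ler_piMl// sin_max.
Qed.

Section Rotation.
Variables (R : realType) (d : nat).
Local Notation vol := (power_measure (lebR R) d).
Implicit Types k x : d.-tuple R.

Definition dot k x : R := \sum_(i < d) tnth k i * tnth x i.

Definition rot (i j : 'I_d) (c s : R) x : d.-tuple R :=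
  [tuple if l == i then c * tnth x i - s * tnth x j
         else if l == j then s * tnth x i + c * tnth x j else tnth x l | l < d].

Definition shear (i j : 'I_d) (t : R) x := tuple_upd i (tnth x i + t * tnth x j) x.

(** The classical factorization of a rotation by an angle with cosine [c] and sine [s]:
    [s / (1 + c)] is the tangent of the half angle, which excludes the half turn [c = -1]. *)
Lemma rot_shear i j c s x : i != j -> c ^+ 2 + s ^+ 2 = 1 -> c != -1 ->
  rot i j c s x =
  shear i j (- (s / (1 + c))) (shear j i s (shear i j (- (s / (1 + c))) x)).
Proof.
move=> ij cs c1; have c1' : 1 + c != 0 by rewrite addrC addr_eq0.
have ji : (j == i) = false by rewrite eq_sym; exact: negbTE.
have sE : s ^+ 2 = (1 - c) * (1 + c) by apply: (@addrI _ (c ^+ 2)); rewrite cs; ring.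
apply: eq_from_tnth => l; rewrite !tnth_mktuple (negbTE ij) ji !eqxx.
case: (eqVneq l i) => [_|_]; last by case: (eqVneq l j) => [_|//]; field: sE.
by field: sE.
Qed.

Lemma measurable_shear i j t : measurable_fun setT (shear i j t).
Proof.
apply/measurable_fun_tnthP => l; apply: (eq_measurable_fun
  (fun x : d.-tuple R => if l == i then tnth x i + t * tnth x j else tnth x l)).
  by move=> x _ /=; rewrite tnth_mktuple.
case: eqP => _; last exact: measurable_tnth.
apply: measurable_funD; first exact: measurable_tnth.
by apply: measurable_funM => //; exact: measurable_tnth.
Qed.

Lemma ge0_integral_shear i j t (f : d.-tuple R -> \bar R) : i != j ->
  measurable_fun setT f -> (forall x, (0 <= f x)%E) ->
  (\int[vol]_x f (shear i j t x) = \int[vol]_x f x)%E.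
Proof.
move=> ij mf f0.
apply: (@ge0_integral_power_shear R d i (fun x => t * tnth x j)) => //.
  by apply: measurable_funM => //; exact: measurable_tnth.
by move=> a x; rewrite tnth_mktuple eq_sym (negbTE ij).
Qed.

Lemma ge0_integral_rot i j c s (f : d.-tuple R -> \bar R) :
  i != j -> c ^+ 2 + s ^+ 2 = 1 -> c != -1 ->
  measurable_fun setT f -> (forall x, (0 <= f x)%E) ->
  (\int[vol]_x f x = \int[vol]_x f (rot i j c s x))%E.
Proof.
move=> ij cs c1 mf f0; pose t := - (s / (1 + c)).
under [RHS]eq_integral do rewrite rot_shear//.
have m1 : measurable_fun setT (fun x => f (shear i j t x)).
  exact: measurableT_comp mf (measurable_shear i j t).
have m2 : measurable_fun setT (fun x => f (shear i j t (shear j i s x))).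
  exact: measurableT_comp m1 (measurable_shear j i s).
rewrite -(ge0_integral_shear t ij mf f0).
have ji : j != i by rewrite eq_sym.
rewrite -(ge0_integral_shear s ji m1)//.
by rewrite -(ge0_integral_shear t ij m2).
Qed.

Lemma sum_pair (i j : 'I_d) (F : 'I_d -> R) : i != j ->
  \sum_(l < d) F l = F i + F j + \sum_(l < d | (l != i) && (l != j)) F l.
Proof.
by move=> ij; rewrite (bigD1 i)//= (bigD1 j)/= ?addrA// eq_sym.
Qed.

Lemma vnorm_rot i j c s x : i != j -> c ^+ 2 + s ^+ 2 = 1 ->
  vnorm (rot i j c s x) = vnorm x.
Proof.
move=> ij cs; have ji : (j == i) = false by rewrite eq_sym; exact: negbTE.
congr Num.sqrt; rewrite !(sum_pair _ ij); congr (_ + _).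
  rewrite !tnth_mktuple !eqxx ji.
  transitivity ((c ^+ 2 + s ^+ 2) * (tnth x i ^+ 2 + tnth x j ^+ 2)); first by ring.
  by rewrite cs mul1r.
by apply: eq_bigr => l /andP[/negbTE li /negbTE lj]; rewrite tnth_mktuple li lj.
Qed.

Lemma dot_rot i j c s k x : i != j -> dot k (rot i j c s x) = dot (rot i j c (- s) k) x.
Proof.
move=> ij; have ji : (j == i) = false by rewrite eq_sym; exact: negbTE.
rewrite /dot !(sum_pair _ ij); congr (_ + _).
  by rewrite !tnth_mktuple !eqxx ji; ring.
by apply: eq_bigr => l /andP[/negbTE li /negbTE lj]; rewrite !tnth_mktuple li lj.
Qed.

Lemma measurable_dot k : measurable_fun setT (dot k).
Proof.
apply: measurable_sum => i; apply: measurable_funM => //.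
exact: measurable_tnth.
Qed.

Lemma measurable_cos_dot (c : R) k : measurable_fun setT (fun x => cos (c + dot k x)).
Proof.
apply: (measurableT_comp (@continuous_measurable_fun _ _ (@continuous_cos R))).
by apply: measurable_funD => //; exact: measurable_dot.
Qed.

Lemma tnth_le_vnorm x i : `|tnth x i| <= vnorm x.
Proof.
rewrite -sqrtr_sqr ler_wsqrtr// (bigD1 i)//= lerDl.
by apply: sumr_ge0 => j _; exact: sqr_ge0.
Qed.
End Rotation.

Section Fourier.
Variables (R : realType) (d : nat) (V : d.-tuple R -> R).
Local Notation vol := (power_measure (lebR R) d).
Hypothesis mV : measurable_fun setT V.
Hypothesis iV : intg vol V.
Hypothesis isoV : isotropic V.
Implicit Types k x : d.-tuple R.

Definition fourier k : R := \int[vol]_x (V x * cos (dot k x)).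

Lemma intg_fourier k : intg vol (fun x => V x * cos (dot k x)).
Proof.
under [X in intg vol X]eq_fun do rewrite mulrC.
apply: (@intgMb _ _ _ _ _ _ 1) => // [|x]; last by rewrite ler_norml cos_geN1 cos_le1.
by have := measurable_cos_dot 0 k; under eq_fun do rewrite add0r.
Qed.

Lemma fourier_rot i j c s k : i != j -> c ^+ 2 + s ^+ 2 = 1 -> c != -1 ->
  fourier (rot i j c s k) = fourier k.
Proof.
move=> ij cs c1; have cs' : c ^+ 2 + (- s) ^+ 2 = 1 by rewrite sqrrN.
rewrite /fourier [RHS](@Rint_transfer _ _ _ _ R vol vol (rot i j c (- s))).
- by apply: eq_Rintegral => x _; rewrite dot_rot// opprK (isoV (vnorm_rot _ ij cs')).
- by move=> f mf f0; exact: ge0_integral_rot.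
- exact: intg_meas (intg_fourier k).
Qed.

(** A Givens rotation in the plane of [i] and [j] moves the content of coordinate [j] into [i]. It
    is not a half turn since its sine is nonzero, and coordinates already killed stay zero. *)
Lemma fourier_kill_coord i j k : j != i -> (exists l, tnth k l != 0) ->
  exists k', [/\ fourier k' = fourier k, exists l, tnth k' l != 0, tnth k' j = 0 &
    forall l, l != i -> tnth k l = 0 -> tnth k' l = 0].
Proof.
move=> ji k0; have ij : i != j by rewrite eq_sym.
have [kj|kj] := eqVneq (tnth k j) 0; first by exists k.
pose q := tnth k i ^+ 2 + tnth k j ^+ 2; pose r := Num.sqrt q.
have kj2 : 0 < tnth k j ^+ 2 by rewrite exprn_even_gt0.
have q0 : 0 < q by rewrite ltr_wpDl ?sqr_ge0.
have r0 : 0 < r by rewrite sqrtr_gt0.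
have r2 : r ^+ 2 = q by rewrite sqr_sqrtr// ltW.
have rN0 : r != 0 by rewrite gt_eqF.
pose c := tnth k i / r; pose s := - tnth k j / r.
have cs : c ^+ 2 + s ^+ 2 = 1.
  by rewrite /c /s !expr_div_n sqrrN -mulrDl r2 divff// gt_eqF.
have c1 : c != -1.
  apply/eqP => c1; move: cs; rewrite c1 sqrrN expr1n => /eqP.
  rewrite -subr_eq0 addrAC subrr add0r expf_eq0/= mulf_eq0 oppr_eq0 (negbTE kj).
  by rewrite invr_eq0 (negbTE rN0).
exists (rot i j c s k); split.
- exact: fourier_rot.
- exists i; rewrite tnth_mktuple eqxx.
  rewrite (_ : _ - _ = q / r) ?mulf_neq0 ?invr_eq0 ?gt_eqF//.
  by rewrite /q /c /s; ring.
- rewrite tnth_mktuple (negbTE ji) eqxx /c /s; ring.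
- by move=> l li kl; rewrite tnth_mktuple (negbTE li); case: eqP => // lj; move: kj; rewrite -lj kl eqxx.
Qed.

Definition plane_tuple (i j : 'I_d) (a b : R) : d.-tuple R :=
  [tuple if l == i then a else if l == j then b else 0 | l < d].

Lemma fourier_axis i j k : j != i -> (exists l, tnth k l != 0) ->
  exists2 t, t != 0 & fourier (plane_tuple i j t 0) = fourier k.
Proof.
move=> ji k0.
have H (s : seq 'I_d) : i \notin s -> exists k',
    [/\ fourier k' = fourier k, exists l, tnth k' l != 0 & forall l, l \in s -> tnth k' l = 0].
  elim: s => [_|l s IHs]; first by exists k.
  rewrite inE negb_or => /andP[il si]; have [k1 [F1 N1 Z1]] := IHs si.
  have li : l != i by rewrite eq_sym.
  have [k2 [F2 N2 Z2 Y2]] := fourier_kill_coord li N1.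
  exists k2; split => //; first by rewrite F2.
  move=> l'; rewrite inE => /orP[/eqP->//|l's]; apply: Y2; last exact: Z1.
  by apply: contraNneq si => <-.
have [|k1 [F1 [l N1] Z1]] := H [seq l <- enum 'I_d | l != i].
  by rewrite mem_filter eqxx.
have {}Z1 b : b != i -> tnth k1 b = 0.
  by move=> bi; apply: Z1; rewrite mem_filter bi mem_enum.
exists (tnth k1 i).
  by apply: contraNneq N1 => k1i; have [->|/Z1->] := eqVneq l i; rewrite ?k1i.
rewrite -F1; congr fourier; apply: eq_from_tnth => b; rewrite tnth_mktuple.
by case: (eqVneq b i) => [->//|/Z1->]; case: (_ == _).
Qed.

(** Rotations by a third of a turn, with cosine -1/2 and sine plus or minus half the root of 3,
    produce the other two vertices. *)
Lemma fourier_triangle i j t : j != i ->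
  fourier (plane_tuple i j (- (1 / 2) * t) (Num.sqrt 3 / 2 * t)) = fourier (plane_tuple i j t 0) /\
  fourier (plane_tuple i j (- (1 / 2) * t) (- (Num.sqrt 3 / 2) * t)) =
    fourier (plane_tuple i j t 0).
Proof.
move=> ji; have ij : i != j by rewrite eq_sym.
have s3 : Num.sqrt 3 ^+ 2 = 3 :> R by rewrite sqr_sqrtr.
have cs : (- (1 / 2)) ^+ 2 + (Num.sqrt 3 / 2) ^+ 2 = 1 :> R.
  by rewrite expr_div_n s3; field.
have cs' : (- (1 / 2)) ^+ 2 + (- (Num.sqrt 3 / 2)) ^+ 2 = 1 :> R by rewrite [X in _ + X]sqrrN.
have c1 : - (1 / 2) != -1 :> R by apply/eqP; lra.
rewrite -(fourier_rot (plane_tuple i j t 0) ij cs c1).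
split; last rewrite (fourier_rot _ ij cs c1) -(fourier_rot (plane_tuple i j t 0) ij cs' c1).
  congr fourier; apply: eq_from_tnth => l; rewrite !tnth_mktuple !eqxx (negbTE ji).
  by case: (l == i); [|case: (l == j)]; ring.
congr fourier; apply: eq_from_tnth => l; rewrite !tnth_mktuple !eqxx (negbTE ji).
by case: (l == i); [|case: (l == j)]; ring.
Qed.

Variable a : R.
Hypothesis V_supp : forall x, a < vnorm x -> V x = 0.

(** On the support the coordinates of [x] are at most [a], so the cosines differ by at most [a]
    times the distance of the frequencies. This controls rounding to the lattice. *)
Lemma fourier_lipschitz k k' : 0 <= a ->
  `|fourier k - fourier k'| <=
  (\sum_(i < d) `|tnth k i - tnth k' i|) * (a * \int[vol]_x `|V x|).
Proof.
move=> a0; rewrite /fourier -RintB; [|exact: intg_fourier..].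
pose S := \sum_(i < d) `|tnth k i - tnth k' i|.
have iA : intg vol (fun x => `|V x|) by exact: intg_abs.
apply: le_trans (Rint_abs _) _.
  by apply: intgB; exact: intg_fourier.
rewrite mulrA -RintZ//; apply: Rint_le => [||x].
- by apply: intg_abs; apply: intgB; exact: intg_fourier.
- exact: intgZ.
rewrite -mulrBr normrM mulrC; case: (leP (vnorm x) a) => xa; last first.
  by rewrite V_supp// normr0 !mulr0.
rewrite ler_wpM2r// (le_trans (cos_lipschitz _ _))//.
rewrite /dot -sumrB (le_trans (ler_norm_sum _ _ _))// mulr_suml.
apply: ler_sum => i _; rewrite -mulrBl normrM ler_wpM2l//.
exact: le_trans (tnth_le_vnorm x i) xa.
Qed.
End Fourier.

(** * Periodization *)

Lemma cos_2pi_int (R : realType) (x : R) (j : int) : cos (x + j%:~R * (pi *+ 2)) = cos x.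
Proof. by rewrite -!sinDpihalf addrAC sin_2pi_int. Qed.

Section TorusRestriction.
Variables (R : realType) (L : R) (d : nat).
Local Notation mu := (torus_measure L d).
Local Notation vol := (power_measure (lebR R) d).
Local Notation B := (box (cell L) (n:=d)).

Lemma integral_torus (f : d.-tuple R -> \bar R) : measurable_fun setT f ->
  (\int[mu]_x f x = \int[vol]_(x in B) f x)%E.
Proof.
move=> mf; rewrite [LHS]integralE [RHS]integralE.
have H := @ge0_integral_cell_measure R (cell L) (measurable_cell L) d.
have e1 := H _ (measurable_funepos mf) (funepos_ge0 f).
have e2 := H _ (measurable_funeneg mf) (funeneg_ge0 f).
exact: (congr2 (fun u v => (u - v)%E) e1 e2).
Qed.

Lemma measurable_box_cell : measurable B.
Proof. exact: (@measurable_box R (cell L) (measurable_cell L)). Qed.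

Lemma Rint_torus (f : d.-tuple R -> R) : measurable_fun setT f ->
  \int[mu]_x f x = \int[vol]_x (\1_B x * f x).
Proof.
move=> /measurable_EFinP mf; rewrite [LHS](congr1 fine (integral_torus mf)).
rewrite -[LHS]/(\int[vol]_(x in B) f x) Rintegral_mkcond; apply: eq_Rintegral => x _.
by rewrite patch_indic /= mulrC.
Qed.

Lemma intg_torus (f : d.-tuple R -> R) : measurable_fun setT f ->
  intg vol (fun x => \1_B x * f x) -> intg mu f.
Proof.
pose g x := \1_B x * f x; move=> mf /integrableP[_ H].
apply/integrableP; split; first exact/measurable_EFinP.
have -> : (\int[mu]_x `|(EFin \o f) x| = \int[vol]_(x in B) `|(EFin \o f) x|)%E.
  apply: integral_torus; apply: measurableT_comp => //; exact/measurable_EFinP.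
rewrite integral_mkcond (eq_integral (fun x => `|(EFin \o g) x|)%E)// => x _.
rewrite patchE /g /= indicE; case: (boolP (x \in B)) => _; rewrite ?mul1r//.
by rewrite mul0r normr0.
Qed.
End TorusRestriction.

Section Periodization.
Variables (R : realType) (L : R) (d : nat).
Hypothesis L0 : 0 < L.
Local Notation mu := (torus_measure L d).
Local Notation vol := (power_measure (lebR R) d).
Local Notation B := (box (cell L) (n:=d)).
Implicit Types (x y z : d.-tuple R) (n : d.-tuple 'I_3).

Definition translate n z : d.-tuple R :=
  [tuple tnth z i + L * ((tnth n i : nat)%:R - 1) | i < d].

(* The change of variables that unfolds the periodization. *)
Definition reflect_translate x n y := translate n (vsub x y).

Lemma reflect_translateK x n : involutive (reflect_translate x n).
Proof.
move=> y; apply: eq_from_tnth => i; rewrite !tnth_mktuple; ring.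
Qed.

Lemma reflect_translateE x n y : reflect_translate x n y =
  [tuple (-1) * tnth y i + tnth (translate n x) i | i < d].
Proof. by apply: eq_from_tnth => i; rewrite !tnth_mktuple; ring. Qed.

Lemma measurable_reflect_translate x n : measurable_fun setT (reflect_translate x n).
Proof.
apply/measurable_fun_tnthP => i; apply: (eq_measurable_fun
  (fun y : d.-tuple R => (-1) * tnth y i + tnth (translate n x) i)).
  by move=> y _ /=; rewrite reflect_translateE [RHS]tnth_mktuple.
apply: measurable_funD => //; apply: measurable_funM => //.
exact: measurable_tnth.
Qed.

Lemma ge0_integral_reflect_translate x n (f : d.-tuple R -> \bar R) :
  measurable_fun setT f -> (forall y, (0 <= f y)%E) ->
  (\int[vol]_y f y = \int[vol]_y f (reflect_translate x n y))%E.
Proof.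
move=> mf f0; under [RHS]eq_integral do rewrite reflect_translateE.
by rewrite ge0_integral_power_affine//; right.
Qed.

(** The cell is half-open, so its translates are disjoint and at most one of them contains a given
    point. *)
Lemma sum_translate_le1 z : \sum_n (\1_B (translate n z) : R) <= 1.
Proof.
case: (pselect (exists n, B (translate n z))) => [[n0 B0]|nB]; last first.
  rewrite big1// => n _; rewrite indicE memNset// => Bn; apply: nB; by exists n.
rewrite (bigD1 n0)//= big1 ?addr0 => [|n nn0].
  by rewrite indicE mem_set.
rewrite indicE memNset// => Bn; move: nn0 => /eqP; apply; apply: eq_from_tnth => i.
have := Bn i; have := B0 i; rewrite !tnth_mktuple /cell/= => /andP[a1 a2] /andP[b1 b2].
move: (tnth n i) (tnth n0 i) a1 a2 b1 b2 => [[|[|[|//]]] p] [[|[|[|//]]] q] /= *;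
  apply/val_inj => //=; exfalso; lra.
Qed.

(** The digits 0, 1, 2 stand for shifts by [- L], 0 and [L]; together they cover exactly the
    coordinates in [-L, 2L). *)
Lemma sum_translate_eq1 z : (forall i, - L <= tnth z i < 2 * L) ->
  \sum_n (\1_B (translate n z) : R) = 1.
Proof.
move=> zL; apply/eqP; rewrite eq_le sum_translate_le1/=.
have i3 (k : nat) : (k < 3)%N -> exists j : 'I_3, (j : nat) = k by move=> k3; exists (Ordinal k3).
have ex i : exists j : 'I_3, cell L (tnth z i + L * ((j : nat)%:R - 1)).
  have /andP[z1 z2] := zL i.
  case: (ltP (tnth z i) 0) => z0.
    by exists (@Ordinal 3 2 isT); rewrite /cell/=; apply/andP; split; lra.
  case: (ltP (tnth z i) L) => zL'.
    by exists (@Ordinal 3 1 isT); rewrite /cell/=; apply/andP; split; lra.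
  by exists (@Ordinal 3 0 isT); rewrite /cell/=; apply/andP; split; lra.
have [f fP] := choice ex.
rewrite (bigD1 [tuple f i | i < d])//= indicE mem_set/= ?lerDl; last first.
  by move=> i; rewrite !tnth_mktuple.
by apply: sumr_ge0 => n _; rewrite indicE.
Qed.

Section Unfold.
Variables (G h : d.-tuple R -> R) (c : R).
Hypotheses (iG : intg vol G) (mh : measurable_fun setT h) (hc : forall y, `|h y| <= c).

Let mG : measurable_fun setT G := intg_meas iG.

Lemma intg_torus_unfold x n : intg mu (fun y => G (reflect_translate x n y) * h y).
Proof.
have mr := measurable_reflect_translate x n.
have iGr : intg vol (fun y => G (reflect_translate x n y)).
  have tr := @ge0_integral_reflect_translate x n.
  exact: (intg_transfer tr mr mG).1.
apply: intg_torus.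
  by apply: measurable_funM => //; exact: measurableT_comp.
under [X in intg vol X]eq_fun do rewrite mulrCA mulrC.
apply: (intgMb (c := c) _ _ iGr).
  by apply: measurable_funM => //; apply: measurable_indic; exact: measurable_box_cell.
move=> y; rewrite normrM indicE; case: (_ \in _); rewrite ?normr1 ?normr0 ?mul1r ?mul0r//.
exact: le_trans (hc y).
Qed.

(** Each summand is moved to the whole space by its own change of variables; the indicator remembers
    which points came from the cell. *)
Lemma Rint_torus_unfold x :
  \int[mu]_y (\sum_n G (reflect_translate x n y) * h y) =
  \int[vol]_z (\sum_n \1_B (reflect_translate x n z) * (G z * h (reflect_translate x n z))).
Proof.
have mB := @measurable_box_cell R L d.
have mr n := measurable_reflect_translate x n.
pose F n z := \1_B (reflect_translate x n z) * (G z * h (reflect_translate x n z)).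
have mF n : measurable_fun setT (F n).
  apply: measurable_funM.
    by apply: measurableT_comp => //; exact: measurable_indic.
  by apply: measurable_funM => //; exact: measurableT_comp.
have iF n : intg vol (F n).
  rewrite /F; under [X in intg vol X]eq_fun do rewrite mulrCA mulrC.
  apply: (intgMb (c := c) _ _ iG).
    apply: measurable_funM; last exact: measurableT_comp.
    by apply: measurableT_comp => //; exact: measurable_indic.
  move=> y; rewrite normrM indicE; case: (_ \in _); rewrite ?normr1 ?normr0 ?mul1r ?mul0r//.
  exact: le_trans (hc y).
rewrite (Rint_sum _ iF) (Rint_sum _ (intg_torus_unfold x)); apply: eq_bigr => n _.
rewrite Rint_torus; last by apply: measurable_funM => //; exact: measurableT_comp.
rewrite [RHS](Rint_transfer (@ge0_integral_reflect_translate x n) (mF n)).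
by apply: eq_Rintegral => y _; rewrite /F reflect_translateK.
Qed.
End Unfold.
End Periodization.

Lemma sintE (R : realType) (L : R) (d : nat) (f : d.-tuple R -> R) :
  measurable_fun setT f ->
  (sint (cell L) f = \int[torus_measure L d]_x (f x)%:E)%E.
Proof.
move=> mf; have pE (g : d.-tuple R -> R) : measurable_fun setT g ->
    (iint (cell L) (fun x => ppart (g x)) = \int[torus_measure L d]_x (Num.max (g x) 0)%:E)%E.
  move=> mg; apply: (@iintE _ _ (measurable_cell L)) => [|x].
    by apply/measurable_EFinP; exact: measurable_maxr.
  by rewrite lee_fin le_max lexx orbT.
rewrite /sint pE// pE; last exact: measurableT_comp.
rewrite [RHS]integralE; congr (_ - _)%E; apply: eq_integral => x _.
  by rewrite funeposE EFin_max.
by rewrite funenegE EFin_max EFinN.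
Qed.

Section PeriodizedKernel.
Variables (R : realType) (d : nat) (V : d.-tuple R -> R) (L a : R).
Hypothesis L0 : 0 < L.
Hypothesis aL : a < L / 2.
Local Notation mu := (torus_measure L d).
Local Notation vol := (power_measure (lebR R) d).
Local Notation B := (box (cell L) (n:=d)).
Hypothesis mV : measurable_fun setT V.
Hypothesis iV : intg vol V.
Hypothesis V_even : forall x, V x = V (vopp x).
Hypothesis V_supp : forall x, a < vnorm x -> V x = 0.
Implicit Types (x y z : d.-tuple R) (n : d.-tuple 'I_3) (m : d.-tuple int).

Definition freq m : d.-tuple R := [tuple 2 * pi / L * (tnth m i)%:~R | i < d].

Lemma dot_freq m x : dot (freq m) x = kdot L m x.
Proof. by apply: eq_bigr => i _; rewrite tnth_mktuple. Qed.

Lemma Vper_reflect x y : Vper L V (vsub x y) = \sum_n V (reflect_translate L x n y).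
Proof. by []. Qed.

(** [rev_ord] sends digit [n] to [2 - n], which reverses the lattice shift; evenness of [V] does the
    rest. *)
Lemma Vper_sym x y : Vper L V (vsub x y) = Vper L V (vsub y x).
Proof.
pose r n : d.-tuple 'I_3 := [tuple rev_ord (tnth n i) | i < d].
have rK : involutive r.
  by move=> n; apply: eq_from_tnth => i; rewrite !tnth_mktuple rev_ordK.
rewrite !Vper_reflect (reindex_inj (inv_inj rK)); apply: eq_bigr => n _.
rewrite V_even; congr V; apply: eq_from_tnth => i; rewrite !tnth_mktuple /=.
by case: (tnth n i) => [[|[|[|//]]] p] /=; rewrite ?subSS ?subn0; ring.
Qed.

Lemma measurable_Vper : measurable_fun setT
  (fun p : d.-tuple R * d.-tuple R => Vper L V (vsub p.1 p.2)).
Proof.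
apply: measurable_sum => n; apply: measurableT_comp => //.
apply/measurable_fun_tnthP => i; apply: (eq_measurable_fun
  (fun p : d.-tuple R * d.-tuple R => tnth p.1 i - tnth p.2 i +
     L * ((tnth n i : nat)%:R - 1))).
  by move=> p _ /=; rewrite !tnth_mktuple.
apply: measurable_funD => //; apply: measurable_funB.
  exact: (measurableT_comp (@measurable_tnth _ _ _ i) measurable_fst).
exact: (measurableT_comp (@measurable_tnth _ _ _ i) measurable_snd).
Qed.

Lemma measurable_Vper_row x : measurable_fun setT (fun y => Vper L V (vsub x y)).
Proof. exact: (measurableT_comp measurable_Vper (@measurable_pair1 _ _ _ _ x)). Qed.

Lemma wave_reflect_translate x n m c z :
  wave L m c (reflect_translate L x n z) = cos (c + kdot L m x - dot (freq m) z).
Proof.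
rewrite /wave dot_freq.
have -> : kdot L m (reflect_translate L x n z) = kdot L m x - kdot L m z +
    (\sum_(i < d) tnth m i * ((tnth n i : nat)%:Z - 1))%:~R * (pi *+ 2).
  rewrite /kdot -sumrB rmorph_sum mulr_suml -big_split; apply: eq_bigr => i _ /=.
  rewrite !tnth_mktuple intrM intrB -[1%:~R]/(1 : R) -[(nat_of_ord _)%:~R]/((tnth n i : nat)%:R : R) mulr2n.
  by field; rewrite gt_eqF.
by rewrite !addrA cos_2pi_int.
Qed.

Lemma sum_translate_supp x z : B x -> vnorm z <= a ->
  \sum_n (\1_B (reflect_translate L x n z) : R) = 1.
Proof.
move=> Bx za; have := @sum_translate_eq1 R L d (vsub x z); apply => i.
rewrite tnth_mktuple.
have := Bx i; rewrite /cell/= => /andP[x0 xL].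
have := le_trans (tnth_le_vnorm z i) za; rewrite ler_norml => /andP[z1 z2].
have a2 : a < L / 2 := aL.
have H (u v : R) : 0 <= u -> u < L -> - a <= v -> v <= a -> - L <= u - v < 2 * L.
  by move=> *; apply/andP; split; lra.
exact: H.
Qed.

(** Evenness allows [A - k.z] to be averaged with [A + k.z], which removes the sine part. *)
Lemma Rint_phase (A : R) m :
  \int[vol]_z (V z * cos (A - dot (freq m) z)) = fourier V (freq m) * cos A.
Proof.
set k := freq m.
have bc (b : R) (q : d.-tuple R) : intg vol (fun z => V z * cos (b + dot q z)).
  under [X in intg vol X]eq_fun do rewrite mulrC.
  apply: (@intgMb _ _ _ _ _ _ 1) => // [|x]; last by rewrite ler_norml cos_geN1 cos_le1.
  exact: measurable_cos_dot.
have dN z : dot (vopp k) z = - dot k z.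
  by rewrite /dot -sumrN; apply: eq_bigr => i _; rewrite tnth_mktuple mulNr.
have I1 : intg vol (fun z => V z * cos (A - dot k z)).
  by under [X in intg vol X]eq_fun do rewrite -dN.
have voppE z : vopp z = [tuple -1 * tnth z i + tnth [tuple 0 | _ < d] i | i < d].
  by apply: eq_from_tnth => i; rewrite !tnth_mktuple addr0 mulN1r.
have E : \int[vol]_z (V z * cos (A - dot k z)) = \int[vol]_z (V z * cos (A + dot k z)).
  rewrite (@Rint_transfer _ _ _ _ R vol vol (@vopp R d)).
  - apply: eq_Rintegral => z _; rewrite -V_even; congr (_ * cos (_ + _)).
    by rewrite /dot -sumrN; apply: eq_bigr => i _; rewrite [tnth (vopp z) i]tnth_mktuple mulrN opprK.
  - move=> f mf f0; under [RHS]eq_integral do rewrite voppE.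
    by rewrite ge0_integral_power_affine//; right.
  - exact: intg_meas I1.
have : \int[vol]_z (V z * cos (A - dot k z)) + \int[vol]_z (V z * cos (A + dot k z)) =
    2 * (cos A * fourier V k).
  have iF := intg_fourier iV k.
  rewrite -(RintD I1 (bc A k)) mulrA -(RintZ _ iF).
  by apply: eq_Rintegral => z _; rewrite cosB cosD; ring.
by rewrite -E; lra.
Qed.

(** Waves are periodic, so after unfolding the lattice shift disappears from the phase, and on the
    support of [V] the indicators sum to 1 because [a < L / 2]. *)
Lemma Rint_Vper_wave x m c : B x ->
  \int[mu]_y (Vper L V (vsub x y) * wave L m c y) = fourier V (freq m) * wave L m c x.
Proof.
move=> Bx; have E y : Vper L V (vsub x y) * wave L m c y =
    \sum_n V (reflect_translate L x n y) * wave L m c y by rewrite Vper_reflect mulr_suml.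
under eq_Rintegral do rewrite E.
rewrite (Rint_torus_unfold L iV (measurable_wave L m c) (wave_le1 L m c)) -Rint_phase.
apply: eq_Rintegral => z _; under eq_bigr do rewrite wave_reflect_translate.
rewrite -mulr_suml; case: (leP (vnorm z) a) => za; first by rewrite sum_translate_supp// mul1r.
by rewrite V_supp// mul0r mulr0.
Qed.

(** The eigenfunction identity evaluated at the origin with phase 0. It ties the coefficients on all
    tori to one function on the whole space. *)
Lemma Vhat_fourier m : Vhat L V m = fourier V (freq m).
Proof.
pose x0 : d.-tuple R := [tuple 0 | _ < d].
have Bx0 : B x0 by move=> i; rewrite tnth_mktuple /cell/= lexx.
have kx0 : kdot L m x0 = 0.
  by rewrite /kdot big1// => i _; rewrite tnth_mktuple mulr0.
have Vx0 y : Vper L V y = Vper L V (vsub x0 y).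
  rewrite Vper_sym; congr (Vper L V _); apply: eq_from_tnth => i.
  by rewrite !tnth_mktuple subr0.
have mf : measurable_fun setT (fun x => Vper L V x * cos (kdot L m x)).
  apply: measurable_funM.
    by rewrite (funext Vx0 : Vper L V = _); exact: measurable_Vper_row.
  by have := measurable_wave L m 0; rewrite /wave; under eq_fun do rewrite add0r.
have VE : Vhat L V m = \int[mu]_x (Vper L V x * cos (kdot L m x)).
  exact: (congr1 fine (sintE L mf)).
rewrite VE; under eq_Rintegral do rewrite Vx0.
have := Rint_Vper_wave m 0 Bx0.
rewrite [X in _ = _ * X](_ : _ = 1); last by rewrite /wave kx0 addr0 cos0.
rewrite mulr1 => <-; apply: eq_Rintegral => y _; congr (_ * _).
by rewrite /wave add0r.
Qed.

Lemma Vhat_opp m : Vhat L V [tuple - tnth m i | i < d] = Vhat L V m.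
Proof.
rewrite !Vhat_fourier; apply: eq_Rintegral => x _; congr (_ * _).
rewrite -cosN; congr cos; rewrite /dot -sumrN; apply: eq_bigr => i _.
by rewrite !tnth_mktuple intrN; ring.
Qed.
End PeriodizedKernel.

Section TorusKernel.
Variables (R : realType) (d : nat) (V : d.-tuple R -> R) (L a M : R).
Hypothesis L0 : 0 < L.
Hypothesis aL : a < L / 2.
Local Notation mu := (torus_measure L d).
Local Notation vol := (power_measure (lebR R) d).
Local Notation B := (box (cell L) (n:=d)).
Hypothesis mV : measurable_fun setT V.
Hypothesis iV : intg vol V.
Hypothesis V_even : forall x, V x = V (vopp x).
Hypothesis V_supp : forall x, a < vnorm x -> V x = 0.
Hypothesis M0 : 0 <= M.
Hypothesis V_lb : (\int[vol]_x (\1_[set y | (V y < - M)%R] x : R)%:E = 0)%E.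
Implicit Types (x y z : d.-tuple R) (n : d.-tuple 'I_3) (m : d.-tuple int).

Lemma Rint_torus_unfold_le (G : d.-tuple R -> R) x : intg vol G ->
  (forall z, 0 <= G z) ->
  intg mu (fun y => \sum_n G (reflect_translate L x n y)) /\
  \int[mu]_y (\sum_n G (reflect_translate L x n y)) <= \int[vol]_z G z.
Proof.
move=> iG G0; have h1 y : `|cst 1 y : R| <= 1 by rewrite normr1.
have m1 : measurable_fun setT (cst 1 : d.-tuple R -> R) by exact: measurable_cst.
have iS n : intg mu (fun y => G (reflect_translate L x n y)).
  by have := intg_torus_unfold L iG m1 h1 x n; under eq_fun do rewrite mulr1.
split; first exact: intg_sum.
have := Rint_torus_unfold L iG m1 h1 x.
under eq_Rintegral do under eq_bigr do rewrite mulr1.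
under [in RHS]eq_Rintegral do under eq_bigr do rewrite mulr1.
move=> ->; have E z : \sum_n \1_B (reflect_translate L x n z) * G z =
    (\sum_n (\1_B (translate L n (vsub x z)) : R)) * G z by rewrite mulr_suml.
have s0 z : 0 <= \sum_n (\1_B (translate L n (vsub x z)) : R).
  by apply: sumr_ge0 => n _; rewrite indicE.
have s1 z : \sum_n (\1_B (translate L n (vsub x z)) : R) <= 1 by exact: sum_translate_le1.
under eq_Rintegral do rewrite E.
apply: Rint_le => [||z] //; last by rewrite ler_piMl.
apply: (intgMb (c := 1)) iG => [|z]; last by rewrite ger0_norm.
have mI : measurable_fun setT (\1_B : d.-tuple R -> R).
  by apply: measurable_indic; exact: measurable_box_cell.
apply: measurable_sum => n.
exact: (measurableT_comp mI (measurable_reflect_translate L x n)).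
Qed.

(* [V] is bounded below only almost everywhere; truncating its periodization
   makes the bound hold everywhere without changing any integral. *)
Definition torus_kernel x y : R := Num.max (Vper L V (vsub x y)) (- ((3 ^ d)%:R * M)).

Let E x := [set y | torus_kernel x y = Vper L V (vsub x y)].

Lemma measurable_torus_kernel : measurable_fun setT
  (fun p : d.-tuple R * d.-tuple R => torus_kernel p.1 p.2).
Proof. by apply: measurable_maxr => //; exact: measurable_Vper. Qed.

Lemma measurable_torus_kernel_row x : measurable_fun setT (torus_kernel x).
Proof. exact: (measurableT_comp measurable_torus_kernel (@measurable_pair1 _ _ _ _ x)). Qed.

(** The periodization can fall below [- 3 ^ d * M] only if one of its [3 ^ d] terms is below [- M],
    so the bad set is covered by images of a null set under reflections and translations. *)
Lemma torus_kernelE x : measurable (E x) /\ mu (~` E x) = 0%E.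
Proof.
have mE : measurable (E x).
  pose f y := torus_kernel x y - Vper L V (vsub x y).
  have mf : measurable_fun setT f.
    apply: measurable_funB; first exact: measurable_torus_kernel_row.
    exact: measurable_Vper_row.
  rewrite (_ : E x = f @^-1` [set 0]); first by rewrite -[X in measurable X]setTI; exact: mf.
  apply/seteqP; split => y; rewrite /E /f/=; first by move=> ->; rewrite subrr.
  by move=> /eqP; rewrite subr_eq0 => /eqP.
split => //; pose N := [set y : d.-tuple R | V y < - M].
have mN : measurable N.
  rewrite (_ : N = V @^-1` `]-oo, - M[%classic).
    by rewrite -[X in measurable X]setTI; exact: mV.
  by apply/seteqP; split => y /=; rewrite in_itv.
have N0 z : 0 <= \1_N z :> R by rewrite indicE.
have mIN : measurable_fun setT (\1_N : _ -> R) by exact: measurable_indic.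
have iN : intg vol (\1_N : _ -> R).
  by apply: intg_ge0 => //; rewrite V_lb.
have [iS le0] := Rint_torus_unfold_le x iN N0.
have z0 : \int[vol]_z (\1_N z : R) = 0 by rewrite /Rintegral V_lb.
have le1 y : (\1_(~` E x) y : R) <= \sum_n \1_N (reflect_translate L x n y).
  rewrite indicE; case: (boolP (y \in _)) => [/set_mem nE|_]; last by rewrite sumr_ge0.
  case: (pselect (exists n, N (reflect_translate L x n y))) => [[n Nn]|nN].
    rewrite (bigD1 n)//= [X in _ <= X + _](_ : _ = 1); last by rewrite indicE mem_set.
    by rewrite lerDl sumr_ge0.
  exfalso; apply: nE; rewrite /E/= /torus_kernel max_l//.
  rewrite Vper_reflect; apply: (@le_trans _ _ (\sum_(n : d.-tuple 'I_3) - M)).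
    by rewrite sumr_const card_tuple card_ord mulNrn mulr_natl.
  apply: ler_sum => n _; rewrite leNgt; apply/negP => Vn; apply: nN; by exists n.
have mC : measurable (~` E x) by exact: measurableC.
have iC : intg mu (\1_(~` E x) : _ -> R).
  apply: (@intg_bounded _ _ _ mu _ 1) => [|y]; first exact: measurable_indic.
  by rewrite indicE; case: (_ \in _); rewrite ?normr1 ?normr0.
have : \int[mu]_y (\1_(~` E x) y : R) <= 0.
  by rewrite -z0; apply: le_trans le0; exact: Rint_le.
rewrite -[X in X <= _ -> _]/(fine (\int[mu]_y (\1_(~` E x) y : R)%:E)%E).
rewrite integral_indic// setIT => f0.
have fin : mu (~` E x) \is a fin_num by exact: fin_num_measure.
rewrite -(fineK fin); congr EFin; apply/eqP; rewrite eq_le f0/=.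
by apply: fine_ge0; exact: measure_ge0.
Qed.

Lemma Rint_torus_kernel x (h : d.-tuple R -> R) : measurable_fun setT h ->
  \int[mu]_y (torus_kernel x y * h y) = \int[mu]_y (Vper L V (vsub x y) * h y).
Proof.
move=> mh; have [mE E0] := torus_kernelE x.
apply: (Rint_eq_null mE E0) => [||y ->//]; apply: measurable_funM => //.
  exact: measurable_torus_kernel_row.
exact: measurable_Vper_row.
Qed.

Lemma Rint_torus_kernel_wave x m c : B x ->
  \int[mu]_y (torus_kernel x y * wave L m c y) = Vhat L V m * wave L m c x.
Proof.
move=> Bx; rewrite Rint_torus_kernel; last exact: measurable_wave.
by rewrite (Vhat_fourier (a := a))// (Rint_Vper_wave (a := a)).
Qed.

Lemma pos_excess_sum K (F : d.-tuple 'I_3 -> R) : 0 <= K ->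
  pos_excess ((3 ^ d)%:R * K) (\sum_n F n) <= \sum_n pos_excess K (F n).
Proof.
move=> K0; rewrite /pos_excess ge_max; apply/andP; split; last first.
  by apply: sumr_ge0 => n _; rewrite le_max lexx orbT.
apply: (@le_trans _ _ (\sum_n (`|F n| - K))); last first.
  by apply: ler_sum => n _; rewrite le_max lexx.
rewrite sumrB sumr_const card_tuple card_ord mulr_natl lerB//.
exact: ler_norm_sum.
Qed.

Lemma torus_kernel_norm x y : `|torus_kernel x y| <= `|Vper L V (vsub x y)|.
Proof.
have M3 : 0 <= (3 ^ d)%:R * M by rewrite mulr_ge0.
rewrite /torus_kernel; move: (Vper _ _ _) ((3 ^ d)%:R * M) M3 => v b b0.
have [vb|/ltW vb] := leP v (- b); last by rewrite lexx.
by rewrite normrN ger0_norm// ler0_norm; lra.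
Qed.

Lemma Rint_pos_excess_cvg :
  (fun k : nat => \int[vol]_z pos_excess k%:R (V z)) @ \oo --> (0 : R).
Proof.
have z0 : \int[vol]_z (0 : R) = 0 by rewrite /Rintegral integral0.
rewrite -[X in _ --> X]z0.
have iA : intg vol (fun z => `|V z|) by exact: intg_abs.
have mP (k : nat) : measurable_fun setT (fun z => pos_excess k%:R (V z)).
  apply: measurable_maxr => //; apply: measurable_funB => //.
  exact: measurableT_comp.
have cP z : (fun k : nat => pos_excess k%:R (V z)) @ \oo --> (0 : R).
  apply: cvg_near_cst; exists (Num.bound (`|V z|)) => // k /= kV.
  rewrite /pos_excess max_r// subr_le0; apply/ltW.
  by apply: (lt_le_trans (archi_boundP (normr_ge0 (V z)))); rewrite ler_nat.
have bP (k : nat) z : `|pos_excess k%:R (V z)| <= `|V z|.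
  rewrite ger0_norm; last exact: pos_excess_ge0.
  by rewrite /pos_excess ge_max normr_ge0 andbT gerBl.
by have [_ [_]] := Rint_dct mP cP iA bP.
Qed.

(** Unfolding bounds every row by the same integral of the excess of [V] over the whole space, hence
    the uniformity in [x]. *)
Lemma torus_kernel_tail e : 0 < e -> exists2 K, 0 <= K &
  forall x, (\int[mu]_y (pos_excess K (torus_kernel x y))%:E <= e%:E)%E.
Proof.
move=> e0; have [k ke] : exists k : nat, \int[vol]_z pos_excess k%:R (V z) <= e.
  have /cvgrPdist_lt/(_ _ e0)[N _ /(_ N (leqnn N))] := Rint_pos_excess_cvg.
  rewrite /= sub0r normrN ger0_norm => [/ltW H|]; first by exists N.
  by apply: Rint_ge0 => z; exact: pos_excess_ge0.
have k0 : 0 <= k%:R :> R by [].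
have K0 : 0 <= (3 ^ d)%:R * k%:R :> R by rewrite mulr_ge0.
exists ((3 ^ d)%:R * k%:R) => // x.
pose G z := pos_excess k%:R (V z).
have mG : measurable_fun setT G.
  apply: measurable_maxr => //; apply: measurable_funB => //.
  exact: measurableT_comp.
have iG : intg vol G.
  apply: (intg_le mG _ (intg_abs iV)) => z.
  rewrite ger0_norm; last exact: pos_excess_ge0.
  by rewrite /G /pos_excess ge_max normr_ge0 andbT gerBl.
have [iS leS] := Rint_torus_unfold_le x iG (fun z => pos_excess_ge0 _ _).
apply: (@le_trans _ _ (\int[mu]_y (\sum_n G (reflect_translate L x n y))%:E)%E).
  apply: ge0_le_integral => //.
  - by move=> y _; rewrite lee_fin pos_excess_ge0.
  - apply/measurable_EFinP; apply: measurable_maxr => //; apply: measurable_funB => //.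
    by apply: measurableT_comp => //; exact: measurable_torus_kernel_row.
  - by apply/measurable_EFinP; exact: intg_meas iS.
  - move=> y _; rewrite lee_fin; apply: le_trans (pos_excess_sum _ k0).
    rewrite -Vper_reflect /pos_excess; rewrite ge_max le_max [X in _ && X]le_max lexx orbT andbT lerD2r.
    by rewrite torus_kernel_norm.
rewrite (RintE iS) lee_fin; exact: (le_trans leS ke).
Qed.

Lemma torus_kernel_admissible : admissible_kernel mu torus_kernel ((3 ^ d)%:R * M)
  (Vhat L V [tuple 0 | _ < d]).
Proof.
split.
- exact: measurable_torus_kernel.
- by move=> x y; rewrite /torus_kernel (Vper_sym _ V_even).
- by rewrite mulr_ge0.
- by move=> x y; rewrite /torus_kernel le_max lexx orbT.
- exact: torus_kernel_tail.
exists (~` B); split; first by apply: measurableC; exact: measurable_box_cell.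
  exact: torus_measure_cell.
move=> x /= + Bx; apply.
have w1 z : wave L [tuple 0 | _ < d] 0 z = 1.
  rewrite /wave /kdot big1 ?addr0 ?cos0// => i _.
  by rewrite tnth_mktuple mulr0 mul0r.
rewrite -[RHS]mulr1 -(w1 x) -Rint_torus_kernel_wave//.
by apply: eq_Rintegral => y _; rewrite w1 mulr1.
Qed.

Lemma torus_kernel_coercive (lam : R) : 0 <= lam ->
  (forall m, ~~ zero_freq m -> 0 <= Vhat L V m + lam) ->
  coercive mu torus_kernel lam (`|Vhat L V [tuple 0 | _ < d]| / L ^+ d).
Proof.
move=> lam0 Vlam; apply: (torus_coercive L0 torus_kernel_admissible) => //.
- by move=> m c x; exact: Rint_torus_kernel_wave.
- by move=> m; exact: (@Vhat_opp _ _ _ _ a).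
Qed.
End TorusKernel.

(** * Three-wave perturbation *)

Lemma floor_approx (R : realType) (b h : R) : 0 < h ->
  exists p : int, `|h * p%:~R - b| <= h.
Proof.
move=> h0; exists (Num.floor (b / h)).
have /andP[f1 f2] := floor_itv (b / h).
have bE : b = h * (b / h) by rewrite mulrC divfK// gt_eqF.
rewrite [X in _ - X]bE -mulrBr normrM (gtr0_norm h0) ler_piMr ?(ltW h0)//.
by rewrite intrD in f2; rewrite ler_norml; apply/andP; split; lra.
Qed.

Section LatticeTriangle.
Variables (R : realType) (d : nat) (V : d.-tuple R -> R) (a : R).
Local Notation vol := (power_measure (lebR R) d).
Hypothesis d2 : (2 <= d)%N.
Hypothesis a0 : 0 <= a.
Hypothesis mV : measurable_fun setT V.
Hypothesis iV : intg vol V.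
Hypothesis isoV : isotropic V.
Hypothesis V_supp : forall x, a < vnorm x -> V x = 0.
Implicit Types (k : d.-tuple R) (m : d.-tuple int).

(** All nonzero real frequencies, not those of one lattice: the infimum is independent of [L] and
    lies below the nonzero coefficients of every torus. *)
Definition fourier_values := [set fourier V k | k in [set k | exists l, tnth k l != 0]].

Lemma fourier_ge k : - (\int[vol]_x `|V x|) <= fourier V k.
Proof.
have iA := intg_abs iV; rewrite -(RintN iA); apply: Rint_le.
- exact: intgN.
- exact: intg_fourier.
move=> x; have := cos_geN1 (dot k x); have := cos_le1 (dot k x).
have := ler_norm (V x); have := ler_norm (- V x); rewrite normrN.
by move: (V x) `|V x| (cos _) => v w c *; nra.
Qed.

Lemma fourier_inf_le k : (exists l, tnth k l != 0) -> inf fourier_values <= fourier V k.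
Proof.
move=> k0; apply: ge_inf; last by exists k.
by exists (- (\int[vol]_x `|V x|)) => _ [k' _ <-]; exact: fourier_ge.
Qed.

Definition plane_freq (i j : 'I_d) (p q : int) : d.-tuple int :=
  [tuple if l == i then p else if l == j then q else 0 | l < d].

Lemma fourier_plane_freq (L : R) (i j : 'I_d) (p q : int) (b c : R) : i != j ->
  fourier V (freq L (plane_freq i j p q)) <= fourier V (plane_tuple i j b c) +
    (`|2 * pi / L * p%:~R - b| + `|2 * pi / L * q%:~R - c|) * (a * \int[vol]_x `|V x|).
Proof.
move=> ij; have ji : (j == i) = false by rewrite eq_sym; exact: negbTE.
have := fourier_lipschitz iV V_supp (freq L (plane_freq i j p q)) (plane_tuple i j b c) a0.
rewrite (sum_pair _ ij) big1 ?addr0 => [|l /andP[/negbTE li /negbTE lj]]; last first.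
  by rewrite !tnth_mktuple li lj mulr0 subrr normr0.
rewrite !tnth_mktuple !eqxx ji => /(le_trans (ler_norm _)).
by rewrite lerBlDl.
Qed.

(* An almost minimizing frequency is rotated into an equilateral triangle,
   whose vertices are then rounded to lattice points with vanishing sum. *)
Lemma lattice_triangle (de : R) : 0 < de -> inf fourier_values < 0 ->
  exists L1 : R, forall L, L1 <= L -> 0 < L ->
    exists m1 m2 m3 : d.-tuple int,
      [/\ [/\ ~~ zero_freq m1, ~~ zero_freq m2 & ~~ zero_freq m3],
          (forall l, tnth m1 l + tnth m2 l + tnth m3 l = 0) &
          [/\ fourier V (freq L m1) <= inf fourier_values * (1 - de),
              fourier V (freq L m2) <= inf fourier_values * (1 - de) &
              fourier V (freq L m3) <= inf fourier_values * (1 - de)]].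
Proof.
move=> de0; set v := inf fourier_values => v0.
have d0 : (0 < d)%N by apply: leq_trans d2.
pose i : 'I_d := Ordinal d0; pose j : 'I_d := Ordinal d2.
have ji : j != i by []. have ij : i != j by [].
(* The target [v * (1 - de)] equals [v + 2 * e]: one [e] for near minimality of [k], one for
   rounding. *)
pose e := - v * de / 2.
have e0 : 0 < e by rewrite /e divr_gt0// mulr_gt0// oppr_gt0.
have hi : has_inf fourier_values.
  split; last by exists (- (\int[vol]_x `|V x|)) => _ [k' _ <-]; exact: fourier_ge.
  exists (fourier V [tuple 1 | _ < d]), [tuple 1 | _ < d] => //.
  by exists i; rewrite tnth_mktuple oner_eq0.
have [_ [k k0 <-] kv] := inf_adherent e0 hi; rewrite -/v in kv.
have [t t0 tk] := fourier_axis iV isoV ji k0.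
have [t2 t3] := fourier_triangle iV isoV t ji.
rewrite tk in t2 t3.
pose A := a * \int[vol]_x `|V x|.
have A0 : 0 <= A by rewrite mulr_ge0// Rint_ge0.
pose P := 2 * pi : R; have P0 : 0 < P by rewrite mulr_gt0// pi_gt0.
have tn : 0 < `|t| by rewrite normr_gt0.
(* The lattice spacing [h] must be small against [|t|], so that rounded vertices are nonzero, and
   small against [e / A], so that the Lipschitz error is at most [e]. *)
exists (4 * P / `|t| + 4 * P * A / e + 1) => L LL L0.
pose h := P / L.
have h0 : 0 < h by rewrite divr_gt0.
have ht : 4 * h < `|t|.
  rewrite /h mulrA ltr_pdivrMr// -ltr_pdivrMl// mulrC.
  have : 0 <= 4 * P * A / e by apply: divr_ge0; [apply: mulr_ge0 => //; apply: mulr_ge0 => //|]; exact: ltW.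
  by move: LL; lra.
have hA : 4 * h * A <= e.
  rewrite /h [4 * _]mulrA mulrAC ler_pdivrMr// -ler_pdivrMl// mulrC.
  have : 0 <= 4 * P / `|t| by apply: divr_ge0; [apply: mulr_ge0 => //|]; exact: ltW.
  by move: LL; lra.
have fl (b : R) := floor_approx b h0.
have h2 : h <= 2 * h by rewrite ler_peMl ?(ltW h0)// ler1n.
have h4 : 2 * h <= 4 * h by rewrite ler_wpM2r ?(ltW h0)// ler_nat.
pose s := Num.sqrt 3 / 2 : R.
have [p1 p1h] := fl t.
have [p2 p2h] := fl (- (1 / 2) * t).
have [q2 q2h] := fl (s * t).
have q0h : `|h * (0 : int)%:~R - 0| <= 0 by rewrite mulr0 subr0 normr0.
(* The third vertex is not rounded but forced by the vanishing sum, so it inherits the errors of the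
   other two. *)
have p3h : `|h * (- p1 - p2)%:~R - (- (1 / 2) * t)| <= 2 * h.
  rewrite (_ : _ - _ = - ((h * p1%:~R - t) + (h * p2%:~R - (- (1 / 2) * t)))).
    by rewrite normrN (le_trans (ler_normD _ _))//; rewrite mulr_natl mulr2n lerD.
  by rewrite intrB intrN; field.
have q3h : `|h * (- q2)%:~R - (- s * t)| <= h.
  rewrite (_ : _ - _ = - (h * q2%:~R - s * t)) ?normrN//.
  by rewrite intrN; ring.
have bound p q b c r : `|h * p%:~R - b| + `|h * q%:~R - c| <= 4 * h ->
    fourier V (plane_tuple i j b c) = r -> r < v + e ->
    fourier V (freq L (plane_freq i j p q)) <= v * (1 - de).
  move=> pq <- rv; apply: (le_trans (fourier_plane_freq L p q b c ij)).
  have : (`|h * p%:~R - b| + `|h * q%:~R - c|) * A <= e.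
    by apply: le_trans hA; rewrite ler_wpM2r.
  by rewrite -/P -/h -/A; move: rv; rewrite /e; lra.
have nz p q b : 2 * h < `|b| -> `|h * p%:~R - b| <= 2 * h ->
    ~~ zero_freq (plane_freq i j p q).
  move=> hb pb; apply/negP => /forallP/(_ i); rewrite tnth_mktuple eqxx => /eqP p0.
  by move: pb; rewrite p0 mulr0 sub0r normrN leNgt hb.
have t2n : 2 * h < `|- (1 / 2) * t|.
  have -> : `|- (1 / 2) * t| = `|t| / 2.
    by rewrite normrM normrN (gtr0_norm (divr_gt0 ltr01 (ltr0n R 2))) mul1r mulrC.
  by rewrite ltr_pdivlMr// mulrAC -natrM.
exists (plane_freq i j p1 0), (plane_freq i j p2 q2), (plane_freq i j (- p1 - p2) (- q2)).
split; first split.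
- by apply: (nz p1 0 t); [exact: le_lt_trans h4 ht|exact: le_trans p1h h2].
- exact: (nz p2 q2 _ t2n (le_trans p2h h2)).
- exact: (nz _ _ _ t2n p3h).
- by move=> l; rewrite !tnth_mktuple; case: (l == i); [|case: (l == j)]; ring.
split.
- apply: (bound _ _ t 0 (fourier V k)) => //; apply: le_trans (lerD p1h q0h) _.
  by rewrite addr0 (le_trans h2).
- apply: (bound _ _ (- (1 / 2) * t) (s * t) (fourier V k)) => //.
  by apply: le_trans (lerD p2h q2h) _; rewrite (_ : h + h = 2 * h)//; ring.
- apply: (bound _ _ (- (1 / 2) * t) (- s * t) (fourier V k)) => //.
  apply: le_trans (lerD p3h q3h) _.
  rewrite (_ : 2 * h + h = 3 * h); last by ring.
  by rewrite ler_wpM2r ?(ltW h0)// ler_nat.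
Qed.
End LatticeTriangle.

Lemma measurable_hrel (R : realType) : measurable_fun setT (@hrel R).
Proof.
rewrite (_ : @hrel R = fun u => u * ln u - u + 1).
  apply: measurable_funD => //; apply: measurable_funB => //.
  by apply: measurable_funM => //; exact: measurable_ln.
by apply/funext => u; rewrite /hrel xlnxE.
Qed.

Section WaveProducts.
Variables (R : realType) (L : R).
Hypothesis L0 : 0 < L.
Variable n : nat.
Local Notation mu := (torus_measure L n).
Implicit Types p q r : n.-tuple int.

Lemma wave_mul0 p q x : wave L p 0 x * wave L q 0 x =
  1 / 2 * wave L [tuple tnth p i + tnth q i | i < n] 0 x +
  1 / 2 * wave L [tuple tnth p i - tnth q i | i < n] 0 x.
Proof. by rewrite wave_mul addr0 subr0. Qed.

Lemma Rint_wave0_ge0 p : 0 <= \int[mu]_x wave L p 0 x.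
Proof. by rewrite Rint_wave//; case: ifP => // _; rewrite cos0 mulr1 exprn_ge0// ltW. Qed.

Lemma Rint_wave0_mul_ge0 p q : 0 <= \int[mu]_x (wave L p 0 x * wave L q 0 x).
Proof.
under eq_Rintegral do rewrite wave_mul0.
by rewrite RintD ?RintZ ?addr_ge0 ?mulr_ge0 ?Rint_wave0_ge0//;
  do ?apply: intgZ; exact: intg_wave.
Qed.

Lemma intg_wave_mul3 p q r : intg mu (fun x => wave L p 0 x * wave L q 0 x * wave L r 0 x).
Proof.
apply: (@intg_bounded _ _ _ mu _ 1).
  by apply: measurable_funM; [apply: measurable_funM|]; exact: measurable_wave.
by move=> x; rewrite !normrM mulr_ile1 ?mulr_ile1 ?wave_le1// mulr_ge0.
Qed.

(** Product-to-sum for the first two waves; with all phases zero the discarded difference term has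
    nonnegative integral. Two such steps give the factor 1/4 for a resonant triple. *)
Lemma Rint_wave0_mul3_half p q r :
  1 / 2 * \int[mu]_x (wave L [tuple tnth p i + tnth q i | i < n] 0 x * wave L r 0 x) <=
  \int[mu]_x (wave L p 0 x * wave L q 0 x * wave L r 0 x).
Proof.
have ip k : intg mu (fun x => wave L k 0 x * wave L r 0 x).
  apply: (@intg_bounded _ _ _ mu _ 1); first by apply: measurable_funM; exact: measurable_wave.
  by move=> x; rewrite normrM mulr_ile1// wave_le1.
have E x : wave L p 0 x * wave L q 0 x * wave L r 0 x =
    1 / 2 * (wave L [tuple tnth p i + tnth q i | i < n] 0 x * wave L r 0 x) +
    1 / 2 * (wave L [tuple tnth p i - tnth q i | i < n] 0 x * wave L r 0 x).
  by rewrite wave_mul0; ring.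
under [leRHS]eq_Rintegral do rewrite E.
rewrite RintD; [|exact: intgZ..]; rewrite !RintZ// lerDl.
by rewrite mulr_ge0// Rint_wave0_mul_ge0.
Qed.

Lemma Rint_wave0_mul3_ge0 p q r :
  0 <= \int[mu]_x (wave L p 0 x * wave L q 0 x * wave L r 0 x).
Proof.
by apply: le_trans (Rint_wave0_mul3_half _ _ _); rewrite mulr_ge0// Rint_wave0_mul_ge0.
Qed.

Lemma Rint_wave0_triangle p q r : (forall i, tnth p i + tnth q i + tnth r i = 0) ->
  L ^+ n / 4 <= \int[mu]_x (wave L p 0 x * wave L q 0 x * wave L r 0 x).
Proof.
move=> pqr; apply: le_trans (Rint_wave0_mul3_half _ _ _).
rewrite Rint_wave_mul// ifT; last first.
  by apply/forallP => i; rewrite !tnth_mktuple pqr.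
rewrite addr0 cos0 mulr1.
have Ln : 0 <= L ^+ n by rewrite exprn_ge0// ltW.
have : 0 <= 1 / 2 * (if zero_freq [tuple tnth [tuple tnth p i + tnth q i | i < n] i - tnth r i | i < n]
    then L ^+ n * cos (0 - 0) else 0).
  by rewrite mulr_ge0//; case: ifP => // _; rewrite subr0 cos0 mulr1.
by move: (_ * (if _ then _ else _)) => y y0; lra.
Qed.
End WaveProducts.

(** In units of [ep ^+ 3 * m], the cubic gain is at least 1/4, while the quartic term costs at most
    81/600 and the factor [(1 - ep / 100) ^+ 2] at most 9/100; these add up to 0.225. *)
Lemma perturbation_arith (R : realType) (ep m S T F : R) : 0 < ep -> ep <= 1 / 100 ->
  0 < m -> 0 <= S -> S <= 9 * ep ^+ 2 * m ->
  3 / 2 * ep ^+ 3 * m <= T -> F <= 81 * ep ^+ 4 * m ->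
  S / 2 - T / 6 + F / 6 < (1 - ep / 100) ^+ 2 * S / 2.
Proof.
move=> e0 e1 m0 S0 S1 T1 F1.
have H (A B C D : R) : A <= 9 * C -> 0 <= B -> 0 < C -> D <= 1 / 100 * C ->
    3 / 2 * C <= T -> F <= 81 * D ->
    S / 2 - T / 6 + F / 6 < S / 2 - A / 100 + B / 20000.
  by clear; move=> *; lra.
have C0 : 0 < ep ^+ 3 * m by rewrite mulr_gt0// exprn_gt0.
rewrite (_ : _ * S / 2 = S / 2 - S * ep / 100 + S * ep ^+ 2 / 20000); last by field.
apply: (H _ _ (ep ^+ 3 * m) (ep ^+ 4 * m)) => //.
- by have := ler_wpM2r (ltW e0) S1; rewrite (_ : 9 * ep ^+ 2 * m * ep = 9 * (ep ^+ 3 * m))//; ring.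
- by rewrite mulr_ge0// sqr_ge0.
- by have := ler_wpM2r (ltW C0) e1; rewrite (_ : ep * (ep ^+ 3 * m) = ep ^+ 4 * m)//; ring.
- by rewrite mulrA.
- by rewrite mulrA.
Qed.

Lemma perturbation_gain_arith (R : realType) (lam b S Q : R) : 0 < lam -> 0 <= b ->
  Q <= - (lam * b) * S -> b ^+ 2 * S / 2 <= b / lam * (- Q / 2).
Proof.
move=> l0 b0 QS; have c0 : 0 <= b / lam by rewrite divr_ge0// ltW.
have := ler_wpM2l c0 QS.
rewrite (_ : b / lam * (- (lam * b) * S) = - (b ^+ 2 * S)).
  by move: (b / lam) => c; lra.
by field; rewrite gt_eqF.
Qed.

Section Perturbation.
Variables (R : realType) (L : R).
Hypothesis L0 : 0 < L.
Variable n : nat.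
Local Notation mu := (torus_measure L n).
Local Notation nu := (mu \x mu)%E.
Variables (W : n.-tuple R -> n.-tuple R -> R) (M w0 : R).
Hypothesis kW : admissible_kernel mu W M w0.
Variables (vh : n.-tuple int -> R) (lam : R).
Hypothesis eigen : forall m c x, box (cell L) x ->
  \int[mu]_y (W x y * wave L m c y) = vh m * wave L m c x.
Hypothesis lam_gt0 : 0 < lam.
Variables m1 m2 m3 : n.-tuple int.
Hypotheses (m1_neq0 : ~~ zero_freq m1) (m2_neq0 : ~~ zero_freq m2)
  (m3_neq0 : ~~ zero_freq m3).
Hypothesis m_sum : forall i, tnth m1 i + tnth m2 i + tnth m3 i = 0.
Variable ep : R.
Hypotheses (ep_gt0 : 0 < ep) (ep_le : ep <= 1 / 100).
Let de : R := ep / 100.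
Hypotheses (vh1 : vh m1 <= - lam * (1 - de)) (vh2 : vh m2 <= - lam * (1 - de))
  (vh3 : vh m3 <= - lam * (1 - de)).

Let s : seq (n.-tuple int * R * R) := [:: (m1, 0, ep); (m2, 0, ep); (m3, 0, ep)].
Let u := trig_sum L s.
Let mass_gt0 : 0 < L ^+ n. Proof. exact: exprn_gt0. Qed.

Let uE x : u x = ep * (wave L m1 0 x + wave L m2 0 x + wave L m3 0 x).
Proof. by rewrite /u /trig_sum !big_cons big_nil /=; ring. Qed.

Let u_le x : `|u x| <= 3 * ep.
Proof.
rewrite uE normrM (gtr0_norm ep_gt0) mulrC ler_wpM2r ?(ltW ep_gt0)//.
rewrite (le_trans (ler_normD _ _))// (_ : 3 = 1 + 1 + 1 :> R); last by ring.
by rewrite lerD ?wave_le1// (le_trans (ler_normD _ _))// lerD ?wave_le1.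
Qed.

Let mu_u : measurable_fun setT u. Proof. exact: trig_sum_measurable. Qed.

Let intg_uX k : intg mu (fun x => u x ^+ k).
Proof.
apply: (@intg_bounded _ _ _ mu _ ((3 * ep) ^+ k)); first exact: measurable_funX.
move=> x; rewrite normrX lerXn2r// nnegrE//.
by rewrite mulr_ge0// ltW.
Qed.

Let Rint_u_le k (c : R) : (3 * ep) ^+ k <= c -> \int[mu]_x (u x ^+ k) <= c * L ^+ n.
Proof.
move=> kc; rewrite -(torus_mass L0) -Rint_cst; apply: Rint_le => [||x].
- exact: intg_uX.
- exact: intg_cst.
apply: le_trans kc; apply: (le_trans (ler_norm _)).
by rewrite normrX lerXn2r// nnegrE mulr_ge0// ltW.
Qed.

Let Rint_u : \int[mu]_x u x = 0.
Proof.
rewrite Rint_trig_sum !big_cons big_nil /= !(Rint_wave L0).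
by rewrite (negbTE m1_neq0) (negbTE m2_neq0) (negbTE m3_neq0) !mulr0 !addr0.
Qed.

Let Rint_u3 : 3 / 2 * ep ^+ 3 * L ^+ n <= \int[mu]_x (u x ^+ 3).
Proof.
(* The cube of a sum of three waves has ten monomials. The mixed one, with coefficient 6,
   contributes at least 6/4 of the mass; the nine listed here only need to be nonnegative. *)
pose t : seq (R * (n.-tuple int * n.-tuple int * n.-tuple int)) :=
  [:: (1, (m1, m1, m1)); (1, (m2, m2, m2)); (1, (m3, m3, m3));
      (3, (m1, m1, m2)); (3, (m1, m1, m3)); (3, (m2, m2, m1));
      (3, (m2, m2, m3)); (3, (m3, m3, m1)); (3, (m3, m3, m2))].
pose w3 (q : n.-tuple int * n.-tuple int * n.-tuple int) x :=
  wave L q.1.1 0 x * wave L q.1.2 0 x * wave L q.2 0 x.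
have E x : u x ^+ 3 = ep ^+ 3 * (6 * w3 (m1, m2, m3) x + \sum_(w <- t) w.1 * w3 w.2 x).
  by rewrite uE /t !big_cons big_nil /w3 /=; ring.
have i3 q : intg mu (w3 q) by exact: intg_wave_mul3.
under eq_Rintegral do rewrite E.
have iS : intg mu (fun x => \sum_(w <- t) w.1 * w3 w.2 x).
  by apply: intg_sum => w; apply: intgZ; exact: i3.
rewrite RintZ; last by apply: intgD => //; apply: intgZ; exact: i3.
rewrite RintD//; last by apply: intgZ; exact: i3.
rewrite RintZ; last exact: i3.
rewrite [3 / 2 * _]mulrC -mulrA ler_wpM2l//; first by rewrite exprn_ge0// ltW.
have := Rint_wave0_triangle L0 m_sum.
rewrite -[X in _ <= X -> _]/(\int[mu]_x w3 (m1, m2, m3) x).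
have : 0 <= \int[mu]_x \sum_(w <- t) w.1 * w3 w.2 x.
  rewrite Rint_sum => [|w]; last by apply: intgZ; exact: i3.
  rewrite big_seq; apply: sumr_ge0 => w wt; rewrite RintZ; last exact: i3.
  apply: mulr_ge0; last exact: Rint_wave0_mul3_ge0.
  by move: wt; rewrite !inE => /orP[/eqP->//|]; do ?(move=> /orP[/eqP->//|]); move=> /eqP->.
by move: (\int[mu]_x _) (\int[mu]_x _) => y z y0 z0; lra.
Qed.

(** With zero phases all inner products of waves are nonnegative, so the eigenvalue bound applies
    term by term, even if some of the frequencies coincide up to sign. *)
Let kernel_form_u : kernel_form mu W u <= - (lam * (1 - de)) * \int[mu]_x (u x ^+ 2).
Proof.
rewrite (kernel_form_trig_sum kW eigen) Rint_trig_sum_sqr mulr_sumr.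
rewrite big_seq [leRHS]big_seq; apply: ler_sum => w ws.
rewrite mulr_sumr big_seq [leRHS]big_seq; apply: ler_sum => w' ws'.
have sP v : v \in s -> [/\ v.2 = ep, v.1.2 = 0 & vh v.1.1 <= - lam * (1 - de)].
  by rewrite !inE => /orP[/eqP->//|/orP[/eqP->//|/eqP->//]].
have [-> -> _] := sP w ws; have [-> -> v'] := sP w' ws'.
have := Rint_wave0_mul_ge0 L0 w.1.1 w'.1.1.
move: (\int[mu]_x _) => y y0; rewrite -mulNr in v' *.
have e2 : 0 <= ep * ep * y by rewrite !mulr_ge0// ltW.
have := ler_wpM2r e2 v'; lra.
Qed.

(** One factor [1 - de] pays for the frequencies not being exact minimizers, a second one places the
    threshold strictly below [lam^-1]; the cubic term beats both. *)
Lemma perturbation : exists sigma, finite_energy mu W sigma /\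
  rel_entropy mu sigma < (1 - de) / lam * energy_gain mu W w0 sigma.
Proof.
have mE : fine (mu setT) = L ^+ n := torus_mass L0 n.
pose sigma x := (L ^+ n)^-1 * (1 + u x).
have ep3 : 3 * ep <= 1 / 2 by have := ep_le; lra.
have sE x : fine (mu setT) * sigma x = 1 + u x.
  by rewrite mE /sigma mulrA divff ?mul1r// gt_eqF.
have u1 x : - (1 / 2) <= u x <= 1 / 2.
  by rewrite -ler_norml (le_trans (u_le x)).
have ms : measurable_fun setT sigma.
  by apply: measurable_funM => //; exact: measurable_funD.
have sb x : `|sigma x| <= (L ^+ n)^-1 * 2.
  rewrite /sigma normrM gtr0_norm ?invr_gt0// ler_wpM2l ?invr_ge0 ?(ltW mass_gt0)//.
  by have /andP[a1 a2] := u1 x; rewrite ler_norml; apply/andP; split; lra.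
have iu : intg mu u by have := intg_uX 1; under eq_fun do rewrite expr1.
have i1 : intg mu (fun=> 1 : R) by exact: intg_cst.
have is_ : intg mu sigma by exact: intg_bounded ms sb.
have ds : rdensity mu sigma.
  split => //.
  - move=> x; rewrite /sigma mulr_ge0 ?invr_ge0 ?(ltW mass_gt0)//.
    by have /andP[a1 a2] := u1 x; lra.
  - rewrite /sigma RintZ; last exact: intgD.
    by rewrite RintD// Rint_u Rint_cst mE mul1r addr0 mulVf// gt_eqF.
have hle x : hrel (fine (mu setT) * sigma x) <= u x ^+ 2 / 2 - u x ^+ 3 / 6 + u x ^+ 4 / 6.
  by rewrite sE; apply: hrel_le_quartic; exact: le_trans (u_le x) ep3.
have ip : intg mu (fun x => u x ^+ 2 / 2 - u x ^+ 3 / 6 + u x ^+ 4 / 6).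
  under [X in intg mu X]eq_fun do rewrite ![_ / 2]mulrC ![_ / 6]mulrC.
  by apply: intgD; [apply: intgB|]; apply: intgZ.
have h0 x : 0 <= hrel (fine (mu setT) * sigma x).
  by apply: hrel_ge0; rewrite sE; have /andP[a1 a2] := u1 x; lra.
have ih : intg mu (fun x => hrel (fine (mu setT) * sigma x)).
  apply: (intg_le _ _ ip) => [|x]; last by rewrite ger0_norm.
  apply: measurableT_comp; first exact: measurable_hrel.
  exact: measurable_funM.
have iW : intg nu (fun p => W p.1 p.2 * sigma p.1 * sigma p.2).
  exact: (intg_kernel_schur kW ms sb is_).
exists sigma; split; first by split.
have [_ devE] := kernel_form_deviation kW ds iW.
have -> : energy_gain mu W w0 sigma = - kernel_form mu W u / 2.
  rewrite /energy_gain devE (_ : (fun x => _) = u); first by field.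
  by apply/funext => x; rewrite sE; ring.
have SE := Rint_u_le (k := 2) (lexx _).
have FE := Rint_u_le (k := 4) (lexx _).
have S0 : 0 <= \int[mu]_x (u x ^+ 2) by apply: Rint_ge0 => x; exact: sqr_ge0.
have rle : rel_entropy mu sigma <= \int[mu]_x (u x ^+ 2) / 2 -
    \int[mu]_x (u x ^+ 3) / 6 + \int[mu]_x (u x ^+ 4) / 6.
  apply: le_trans (Rint_le ih ip hle) _.
  under eq_Rintegral do rewrite ![_ / 2]mulrC ![_ / 6]mulrC.
  rewrite RintD; [|by apply: intgB; exact: intgZ|exact: intgZ].
  rewrite RintB; [|exact: intgZ..].
  by rewrite !RintZ// ![_ * \int[mu]_x _]mulrC.
apply: le_lt_trans rle _.
have Rs : \int[mu]_x (u x ^+ 2) <= 9 * ep ^+ 2 * L ^+ n.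
  by apply: (le_trans SE); rewrite exprMn (_ : 3 ^+ 2 = 9 :> R); [exact: lexx|ring].
have Rf : \int[mu]_x (u x ^+ 4) <= 81 * ep ^+ 4 * L ^+ n.
  by apply: (le_trans FE); rewrite exprMn (_ : 3 ^+ 4 = 81 :> R); [exact: lexx|ring].
apply: lt_le_trans (perturbation_arith ep_gt0 ep_le mass_gt0 S0 Rs Rint_u3 Rf) _.
apply: perturbation_gain_arith kernel_form_u => //.
by rewrite /de; have := ep_le; lra.
Qed.
End Perturbation.

(** * The transition on large tori *)

Lemma iint_setT (R : realType) (d : nat) (f : d.-tuple R -> \bar R) :
  measurable_fun setT f -> (forall x, (0 <= f x)%E) ->
  (iint setT f = \int[power_measure (lebR R) d]_x f x)%E.
Proof.
move=> mf f0; have mT : measurable (setT : set R) := measurableT.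
apply: (etrans (@iintE R setT mT d f mf f0)).
apply: (etrans (@ge0_integral_cell_measure R setT mT d f mf f0)).
by rewrite (_ : box setT (n:=d) = setT)//; apply/seteqP; split.
Qed.

Lemma nonzero_freqP d (m : d.-tuple int) : nonzero_freq m <-> ~~ zero_freq m.
Proof.
split => [[i mi]|]; first by apply/negP => /forallP/(_ i); exact/negP.
by rewrite negb_forall => /existsP.
Qed.

(* The properties of [V] in [inV] that do not depend on the torus. *)
Record potential (R : realType) d (V : d.-tuple R -> R) (a M : R) : Prop := Potential {
  potential_meas : measurable_fun setT V;
  potential_intg : intg (power_measure (lebR R) d) V;
  potential_even : forall x, V x = V (vopp x);
  potential_gt0 : 0 < a;
  potential_supp : forall x, a < vnorm x -> V x = 0;
  potential_lb_ge0 : 0 <= M;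
  potential_lb : (\int[power_measure (lebR R) d]_x
    (\1_[set y | (V y < - M)%R] x : R)%:E = 0)%E }.

Lemma inV_potential (R : realType) L d (V : d.-tuple R -> R) : inV L V ->
  exists a M, a < L / 2 /\ potential V a M.
Proof.
case=> mV Voo [M VM] ev [a [/andP[a0 aL] sup]].
have mI b : measurable_fun setT (\1_[set y | V y < b] : d.-tuple R -> R).
  apply: measurable_indic; rewrite (_ : [set y | _] = V @^-1` `]-oo, b[%classic).
    by rewrite -[X in measurable X]setTI; exact: mV.
  by apply/seteqP; split => y /=; rewrite in_itv.
have I0 b y : (0 <= (\1_[set y | V y < b] y : R)%:E)%E by rewrite lee_fin indicE.
exists a, (Num.max M 0); split => //; split => //.
- apply/integrableP; split; first exact/measurable_EFinP.
  rewrite -iint_setT//; apply: measurableT_comp => //; exact/measurable_EFinP.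
- by rewrite le_max lexx orbT.
apply/eqP; rewrite eq_le; apply/andP; split; last by apply: integral_ge0 => y _; exact: I0.
rewrite -VM iint_setT//; last by apply/measurable_EFinP; exact: mI.
apply: ge0_le_integral => //.
- by apply/measurable_EFinP; exact: mI.
- by apply/measurable_EFinP; exact: mI.
move=> y _; rewrite lee_fin !indicE; case: (boolP (y \in [set y | V y < - Num.max M 0])) => // yV.
rewrite [X in _ <= X](_ : _ = 1)//; rewrite mem_set//=.
by move/set_mem: yV => /= /lt_le_trans; apply; rewrite lerN2 le_max lexx.
Qed.

Section TorusTransition.
Variables (R : realType) (d : nat) (V : d.-tuple R -> R) (a M : R).
Local Notation vol := (power_measure (lebR R) d).
Hypothesis d2 : (2 <= d)%N.
Hypothesis isoV : isotropic V.
Hypothesis pV : potential V a M.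

Let mV := potential_meas pV.
Let iV := potential_intg pV.

Lemma Vhat_inf (L : R) : 0 < L -> a < L / 2 -> inVN L V ->
  let v := inf [set Vhat L V m | m in @nonzero_freq d] in
  [/\ v < 0, inf (fourier_values V) <= v &
      forall m, ~~ zero_freq m -> v <= Vhat L V m].
Proof.
move=> L0 aL [m0 [nz0 V0]] v.
have VE m : Vhat L V m = fourier V (freq L m).
  have ev := potential_even pV; have sp := potential_supp pV.
  by apply: (Vhat_fourier (a := a)).
have nzf m : nonzero_freq m -> exists l, tnth (freq L m) l != 0.
  move=> [l ml]; exists l; rewrite tnth_mktuple mulf_neq0 ?intr_eq0//.
  by rewrite gt_eqF// divr_gt0// mulr_gt0// pi_gt0.
have lb m : nonzero_freq m -> inf (fourier_values V) <= Vhat L V m.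
  by move=> /nzf nz; rewrite VE; exact: fourier_inf_le.
have hlb : has_lbound [set Vhat L V m | m in @nonzero_freq d].
  by exists (inf (fourier_values V)) => _ [m nz <-]; exact: lb.
have vle m : nonzero_freq m -> v <= Vhat L V m by move=> nz; apply: ge_inf => //; exists m.
split; first exact: le_lt_trans (vle _ nz0) V0.
  apply: lb_le_inf; first by exists (Vhat L V m0), m0.
  by move=> _ [m nz <-]; exact: lb.
by move=> m nz; apply: vle; exact/nonzero_freqP.
Qed.

Lemma torus_transition : (exists L, 0 < L /\ a < L / 2 /\ inVN L V) ->
  exists L1 : R, forall L, L1 <= L -> 0 < L -> a < L / 2 -> inVN L V ->
  let mu := torus_measure L d in let W := torus_kernel V L M in
  let w0 := Vhat L V [tuple 0 | _ < d] in
  exists th, [/\ 0 < th, th < thetasharp L V,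
    forall rho, finite_energy mu W rho -> th * energy_gain mu W w0 rho <= rel_entropy mu rho &
    exists rho, [/\ finite_energy mu W rho, 0 < rel_entropy mu rho &
      rel_entropy mu rho = th * energy_gain mu W w0 rho]].
Proof.
move=> [L' [L'0 [aL' N']]].
have [v'0 lev' _] := Vhat_inf L'0 aL' N'.
(* A negative coefficient on a single torus already makes the [L]-independent infimum negative. *)
have vneg : inf (fourier_values V) < 0 by exact: le_lt_trans lev' v'0.
pose ep : R := 1 / 100; have ep0 : 0 < ep by rewrite divr_gt0.
have de0 : 0 < ep / 100 by rewrite divr_gt0.
have de1 : ep / 100 < 1 by rewrite /ep; lra.
have a0 := ltW (potential_gt0 pV).
have [L1 L1P] := lattice_triangle d2 a0 iV isoV (potential_supp pV) de0 vneg.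
exists L1 => L LL L0 aL NL mu W w0.
have [m1 [m2 [m3 [[n1 n2 n3] ms [f1 f2 f3]]]]] := L1P L LL L0.
have [v0 lev vle] := Vhat_inf L0 aL NL.
set v := inf [set Vhat L V m | m in @nonzero_freq d] in v0 lev vle.
have thsE : thetasharp L V = (- v)^-1 by rewrite /thetasharp ltr0_norm.
pose lam := - v; have lam0 : 0 < lam by rewrite oppr_gt0.
have ev := potential_even pV; have sp := potential_supp pV.
have M0 := potential_lb_ge0 pV; have Vlb := potential_lb pV.
have adm := torus_kernel_admissible L0 aL mV iV ev sp M0 Vlb.
have eig m c x : box (cell L) x ->
    \int[mu]_y (W x y * wave L m c y) = Vhat L V m * wave L m c x.
  exact: (Rint_torus_kernel_wave L0 aL mV iV ev sp Vlb).
have co : coercive mu W lam (`|w0| / L ^+ d).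
  apply: (torus_kernel_coercive L0 aL mV iV ev sp M0 Vlb (ltW lam0)) => m /vle.
  by rewrite subr_ge0.
(* The infimum over real frequencies is below the lattice minimum [- lam], so closeness to the
   former implies the bound in terms of the latter. *)
have Vm m : fourier V (freq L m) <= inf (fourier_values V) * (1 - ep / 100) ->
    Vhat L V m <= - lam * (1 - ep / 100).
  rewrite (Vhat_fourier (a := a))// => fm; apply: le_trans fm _.
  by rewrite /lam opprK ler_wpM2r// subr_ge0 ltW.
have [sigma [fs sgain]] := perturbation L0 adm eig lam0 n1 n2 n3 ms ep0 (lexx _)
  (Vm _ f1) (Vm _ f2) (Vm _ f3).
have mass0 : 0 < fine (mu setT) by rewrite torus_mass// exprn_gt0.
have th1E : (1 - ep / 100) / lam * lam < 1 by rewrite divfK ?gt_eqF// ltrBlDr ltrDl.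
have th10 : 0 <= (1 - ep / 100) / lam by rewrite divr_ge0 ?(ltW lam0)// subr_ge0 ltW.
have C0 : 0 <= `|w0| / L ^+ d by rewrite divr_ge0// exprn_ge0// ltW.
have [th [th0 thlt thle thex]] :=
  discontinuous_transition mass0 adm co C0 lam0 th10 th1E fs sgain.
exists th; split => //; apply: lt_trans thlt _; rewrite thsE -/lam.
by rewrite -[ltRHS]mul1r ltr_pM2r ?invr_gt0// ltrBlDr ltrDl.
Qed.
End TorusTransition.

(** * The free energy *)

(** The negative part is dominated by [g], so the integral can only diverge upwards. This gives the
    dichotomies for entropy and energy. *)
Lemma intg_or_pinfty d (T : measurableType d) (R : realType)
    (mu : {measure set T -> \bar R}) (f g : T -> R) :
  measurable_fun setT f -> intg mu g -> (forall x, 0 <= g x) -> (forall x, - g x <= f x) ->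
  intg mu f \/ (\int[mu]_x (f x)%:E = +oo)%E.
Proof.
move=> mf ig g0 gf; have mEf : measurable_fun setT (EFin \o f) by exact/measurable_EFinP.
have nfin : (\int[mu]_x (EFin \o f)^\- x \is a fin_num)%E.
  rewrite ge0_fin_numE; last by apply: integral_ge0 => x _; exact: funeneg_ge0.
  apply: (@le_lt_trans _ _ (\int[mu]_x (g x)%:E)%E); last by rewrite RintE// ltry.
  apply: ge0_le_integral => //.
  - exact: measurable_funeneg.
  - exact: measurable_int ig.
  move=> x _; rewrite funenegE /= -EFin_max lee_fin ge_max g0 andbT.
  by rewrite lerNl.
have E := integralE mu setT (EFin \o f).
case: (boolP ((\int[mu]_x (EFin \o f)^\+ x)%E \is a fin_num)) => pfin.
  left; apply: intg_fin_num => //.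
  by rewrite [X in X \is a fin_num]E fin_numB pfin.
right; rewrite [LHS]E; move: pfin; rewrite ge0_fin_numE; last first.
  by apply: integral_ge0 => x _; exact: funepos_ge0.
by rewrite ltey negbK => /eqP->; rewrite addye// eqe_oppLR; move/fin_numPlt: nfin => /andP[_]; rewrite lt_neqAle => /andP[].
Qed.

Section Functionals.
Variables (R : realType) (d : nat) (V : d.-tuple R -> R) (a M L : R).
Hypothesis L0 : 0 < L.
Hypothesis aL : a < L / 2.
Hypothesis pV : potential V a M.
Local Notation mu := (torus_measure L d).
Local Notation nu := (mu \x mu)%E.
Local Notation W := (torus_kernel V L M).
Local Notation w0 := (Vhat L V [tuple 0 | _ < d]).
Implicit Types rho : d.-tuple R -> R.

Let mV := potential_meas pV.
Let iV := potential_intg pV.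
Let V_even := potential_even pV.
Let V_supp := potential_supp pV.
Let M0 := potential_lb_ge0 pV.
Let V_lb := potential_lb pV.

Let mass_gt0 : 0 < L ^+ d. Proof. exact: exprn_gt0. Qed.
Let massE : fine (mu setT) = L ^+ d := torus_mass L0 d.
Let adm := torus_kernel_admissible L0 aL mV iV V_even V_supp M0 V_lb.

Lemma iint_cellE (f : d.-tuple R -> \bar R) : measurable_fun setT f ->
  (forall x, (0 <= f x)%E) -> (iint (cell L) f = \int[mu]_x f x)%E.
Proof. exact: (@iintE R (cell L) (measurable_cell L) d). Qed.

Lemma density_rdensity rho : density L rho <-> rdensity mu rho.
Proof.
have E : measurable_fun setT rho -> (forall x, 0 <= rho x) ->
    (iint (cell L) (fun x => (rho x)%:E) = \int[mu]_x (rho x)%:E)%E.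
  by move=> mr r0; apply: iint_cellE => //; exact/measurable_EFinP.
split=> [[mr r0]|[mr r0 ir r1]]; last by split => //; rewrite E// RintE// r1.
rewrite E// => r1; split => //; last by rewrite /Rintegral r1.
by apply: intg_ge0 => //; rewrite r1 ltry.
Qed.

(** The periodized and the truncated kernel agree, for every [x], off a null set of [y]; hence the
    inner integrals coincide for every [x]. *)
Lemma iint_pair_ae (F G : d.-tuple R * d.-tuple R -> R) (E : d.-tuple R -> set (d.-tuple R)) :
  measurable_fun setT F -> measurable_fun setT G ->
  (forall x, measurable (E x) /\ mu (~` E x) = 0%E) ->
  (forall x y, E x y -> F (x, y) = G (x, y)) ->
  (iint (cell L) (fun x => iint (cell L) (fun y => ppart (F (x, y)))) =
   \int[nu]_p (Num.max (G p) 0)%:E)%E.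
Proof.
move=> mF mG mE FG.
have m0 (H : d.-tuple R * d.-tuple R -> R) : measurable_fun setT H ->
    measurable_fun setT (fun p => (Num.max (H p) 0)%:E).
  by move=> mH; apply/measurable_EFinP; exact: measurable_maxr.
have p0 (r : R) : (0 <= (Num.max r 0)%:E)%E by rewrite lee_fin le_max lexx orbT.
have m1 (H : d.-tuple R * d.-tuple R -> R) x : measurable_fun setT H ->
    measurable_fun setT (fun y => (Num.max (H (x, y)) 0)%:E).
  by move=> mH; exact: measurableT_comp (m0 _ mH) (@measurable_pair1 _ _ _ _ x).
have inner x : (iint (cell L) (fun y => ppart (F (x, y))) =
    \int[mu]_y (Num.max (G (x, y)) 0)%:E)%E.
  rewrite iint_cellE; [|exact: (m1 F x mF)|by move=> y; exact: p0].
  apply: ge0_ae_eq_integral => //; [exact: (m1 F x mF)|exact: (m1 G x mG)|by move=> y _; exact: p0|].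
  have [mEx E0] := mE x; exists (~` E x); split => //; first exact: measurableC.
  by move=> y /= + Exy; apply => _; rewrite /ppart FG.
rewrite (_ : (fun x => _) = (fun x => \int[mu]_y (Num.max (G (x, y)) 0)%:E)%E); last first.
  by apply/funext => x; exact: inner.
have mF1 : measurable_fun setT (fun x => \int[mu]_y (Num.max (G (x, y)) 0)%:E)%E.
  by apply: (@measurable_fun_fubini_tonelli_F _ _ _ _ _ mu
    (fun p => (Num.max (G p) 0)%:E)) => //; exact: m0.
rewrite iint_cellE//; last by move=> x; apply: integral_ge0 => y _; exact: p0.
by rewrite (@fubini_tonelli1 _ _ _ _ _ mu mu (fun p => (Num.max (G p) 0)%:E) (m0 _ mG) (fun p => p0 _)).
Qed.

Lemma energyE rho : measurable_fun setT rho ->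
  energy L V rho = (\int[nu]_p (W p.1 p.2 * rho p.1 * rho p.2)%:E)%E.
Proof.
move=> mr.
pose F p := Vper L V (vsub p.1 p.2) * rho p.1 * rho p.2.
pose G p := W p.1 p.2 * rho p.1 * rho p.2.
have mr1 : measurable_fun setT (fun p : d.-tuple R * d.-tuple R => rho p.1).
  exact: measurableT_comp.
have mr2 : measurable_fun setT (fun p : d.-tuple R * d.-tuple R => rho p.2).
  exact: measurableT_comp.
have mF : measurable_fun setT F.
  by do 2?apply: measurable_funM => //; exact: measurable_Vper.
have mG : measurable_fun setT G.
  by do 2?apply: measurable_funM => //; exact: measurable_torus_kernel.
pose E x := [set y | W x y = Vper L V (vsub x y)].
have mE x : measurable (E x) /\ mu (~` E x) = 0%E by exact: torus_kernelE.
have EF x y : E x y -> F (x, y) = G (x, y) by rewrite /E/= /F /G /= => ->.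
rewrite /energy [RHS]integralE.
have e1 := iint_pair_ae mF mG mE EF.
have mFN : measurable_fun setT (fun p => - F p) by exact: measurableT_comp.
have mGN : measurable_fun setT (fun p => - G p) by exact: measurableT_comp.
have EFN x y : E x y -> - F (x, y) = - G (x, y) by move=> /EF->.
have e2 := iint_pair_ae mFN mGN mE EFN.
apply: (etrans (congr2 (fun u v => (u - v)%E) e1 e2)).
by congr (_ - _)%E; apply: eq_integral => p _; rewrite ?funeposE ?funenegE EFin_max// EFinN.
Qed.

Lemma energy_finite rho : measurable_fun setT rho ->
  intg nu (fun p => W p.1 p.2 * rho p.1 * rho p.2) ->
  energy L V rho = (kernel_form mu W rho)%:E.
Proof. by move=> mr iW; rewrite energyE// (RintE iW). Qed.

Lemma energy_cases rho : rdensity mu rho ->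
  intg nu (fun p => W p.1 p.2 * rho p.1 * rho p.2) \/ energy L V rho = +oo%E.
Proof.
move=> dr; have mr := rdensity_measurable dr; rewrite energyE//.
have [i2 _] := Rint_tensor (rdensity_intg dr) (rdensity_intg dr).
have r2 (p : d.-tuple R * d.-tuple R) : 0 <= rho p.1 * rho p.2.
  by rewrite mulr_ge0// (rdensity_ge0 dr).
have M3 := kernel_lb_ge0 adm.
have [|||iW|->] := @intg_or_pinfty _ _ _ nu
  (fun p => W p.1 p.2 * rho p.1 * rho p.2)
  (fun p => (3 ^ d)%:R * M * (rho p.1 * rho p.2)) _ (intgZ _ i2).
- exact: (measurable_kernel2 adm mr mr).
- by move=> p; rewrite mulr_ge0.
- by move=> p; rewrite -mulNr -mulrA ler_wpM2r// (kernel_lb adm).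
- by left.
- by right.
Qed.

Lemma hrel_mass rho x : 0 <= rho x ->
  hrel (L ^+ d * rho x) = L ^+ d * (xlnx (rho x) + (ln (L ^+ d) - 1) * rho x) + 1.
Proof.
move=> r0; rewrite /hrel !xlnxE; have [->|rn] := eqVneq (rho x) 0.
  by rewrite !(mulr0, mul0r); ring.
by rewrite lnM ?posrE// ?lt_neqAle ?r0 1?eq_sym ?rn//; ring.
Qed.

Lemma xlnx_mass rho x : 0 <= rho x ->
  xlnx (rho x) = (L ^+ d)^-1 * (hrel (L ^+ d * rho x) - 1) + (1 - ln (L ^+ d)) * rho x.
Proof. by move=> r0; rewrite hrel_mass// addrK mulKf ?gt_eqF//; ring. Qed.

Lemma measurable_xlnx : measurable_fun setT (@xlnx R).
Proof.
rewrite (_ : @xlnx R = fun u => u * ln u); last by apply/funext => u; rewrite xlnxE.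
by apply: measurable_funM => //; exact: measurable_ln.
Qed.

Lemma measurable_xlnx_comp rho : measurable_fun setT rho ->
  measurable_fun setT (fun x => xlnx (rho x)).
Proof. exact: measurableT_comp measurable_xlnx. Qed.

Lemma entropy_cases rho : rdensity mu rho ->
  intg mu (fun x => hrel (L ^+ d * rho x)) \/ entropy L rho = +oo%E.
Proof.
move=> dr; have mr := rdensity_measurable dr; have r0 := rdensity_ge0 dr.
have mx := measurable_xlnx_comp mr.
rewrite /entropy sintE//.
have [||ix|->] := @intg_or_pinfty _ _ _ mu (fun x => xlnx (rho x)) (fun=> 1) mx (intg_cst _ 1).
- by [].
- move=> x; have := hrel_ge0 (r0 x); rewrite /hrel; have := r0 x; lra.
- left; have E x : hrel (L ^+ d * rho x) =
      L ^+ d * (xlnx (rho x) + (ln (L ^+ d) - 1) * rho x) + 1 by rewrite hrel_mass.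
  under [X in intg mu X]eq_fun do rewrite E.
  apply: intgD; last exact: intg_cst.
  by apply/intgZ/intgD => //; apply: intgZ; exact: rdensity_intg.
- by right.
Qed.

Lemma entropy_finite rho : rdensity mu rho ->
  intg mu (fun x => hrel (L ^+ d * rho x)) ->
  entropy L rho = (rel_entropy mu rho / L ^+ d - ln (L ^+ d))%:E.
Proof.
move=> dr ih; have r0 := rdensity_ge0 dr; have ir := rdensity_intg dr.
have E x : xlnx (rho x) = (L ^+ d)^-1 * (hrel (L ^+ d * rho x) - 1) +
   (1 - ln (L ^+ d)) * rho x by rewrite xlnx_mass.
have ih1 : intg mu (fun x => hrel (L ^+ d * rho x) - 1) by apply: intgB => //; exact: intg_cst.
have ix : intg mu (fun x => xlnx (rho x)).
  by under [X in intg mu X]eq_fun do rewrite E; apply: intgD; exact: intgZ.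
rewrite /entropy (sintE L (measurable_xlnx_comp (rdensity_measurable dr))) (RintE ix).
congr EFin; under eq_Rintegral do rewrite E.
rewrite RintD; [|exact: intgZ..].
rewrite RintZ// RintZ// RintB//; last exact: intg_cst.
rewrite (rdensity_int dr) Rint_cst massE /rel_entropy massE.
by field; rewrite gt_eqF.
Qed.

Let rdensity_rho0 : rdensity mu (rho0 L d).
Proof.
apply/density_rdensity; split; first exact: measurable_cst.
  by move=> x; rewrite /rho0 /= invr_ge0 ltW.
rewrite iint_cellE; [|exact: (@measurable_cst _ _ _ _ _ ((L ^+ d)^-1)%:E)|by move=> x; rewrite lee_fin /rho0 /= invr_ge0 ltW].
rewrite -[LHS]/(\int[mu]_x ((L ^+ d)^-1)%:E)%E RintE; last exact: intg_cst.
by rewrite Rint_cst massE mulVf// gt_eqF.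
Qed.

Lemma rel_entropy_rho0 : rel_entropy mu (rho0 L d) = 0.
Proof.
rewrite /rel_entropy massE; under eq_Rintegral do rewrite /rho0 mulfV ?gt_eqF// hrel1.
by rewrite /Rintegral integral0.
Qed.

Lemma kernel_form_rho0 : intg nu (fun p => W p.1 p.2 * rho0 L d p.1 * rho0 L d p.2) /\
  kernel_form mu W (rho0 L d) = w0 / L ^+ d.
Proof.
have i1 := intg_cst mu (1 : R).
have iW : intg nu (fun p => W p.1 p.2 * 1 * 1).
  by apply: (intg_kernel_schur adm (c := 1) (u := fun=> 1) (v := fun=> 1)) => // y; rewrite normr1.
have E p : W p.1 p.2 * rho0 L d p.1 * rho0 L d p.2 =
    (L ^+ d)^-1 ^+ 2 * (W p.1 p.2 * 1 * 1) by rewrite /rho0; ring.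
rewrite /kernel_form; under [X in intg nu X]eq_fun do rewrite E.
under eq_Rintegral do rewrite E.
split; first exact: intgZ.
rewrite RintZ// (kernel_cst_row adm i1) Rint_cst massE.
by field; rewrite gt_eqF.
Qed.

Lemma finite_energy_rho0 : finite_energy mu W (rho0 L d).
Proof.
split; [exact: rdensity_rho0|exact: kernel_form_rho0.1|].
rewrite massE /rho0; under [X in intg mu X]eq_fun do rewrite mulfV ?gt_eqF// hrel1.
exact: intg_cst.
Qed.

Lemma energy_gain_rho0 : energy_gain mu W w0 (rho0 L d) = 0.
Proof.
rewrite /energy_gain massE kernel_form_rho0.2.
by field; rewrite gt_eqF.
Qed.

Local Notation excess th rho := (rel_entropy mu rho - th * energy_gain mu W w0 rho).

Lemma Ftheta_finite th rho : finite_energy mu W rho ->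
  Ftheta L V th rho = (excess th rho / L ^+ d + (th * w0 / 2 - ln (L ^+ d)))%:E.
Proof.
move=> [dr iW]; rewrite massE => ih.
rewrite /Ftheta entropy_finite// (energy_finite (rdensity_measurable dr) iW).
rewrite -EFinM -EFinD; congr EFin; rewrite /energy_gain massE.
by field; rewrite gt_eqF.
Qed.

Lemma Ftheta_rho0 th : Ftheta L V th (rho0 L d) = (th * w0 / 2 - ln (L ^+ d))%:E.
Proof.
rewrite Ftheta_finite; last exact: finite_energy_rho0.
by rewrite rel_entropy_rho0 energy_gain_rho0 mulr0 subrr mul0r add0r.
Qed.

(** The third case is an artifact of [theta = 0]: there [0 * +oo] is 0, so a density of infinite
    energy still has finite free energy, equal to its entropy. *)
Lemma Ftheta_cases th rho : 0 <= th -> rdensity mu rho ->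
  [\/ finite_energy mu W rho, Ftheta L V th rho = +oo%E |
    [/\ th = 0, intg mu (fun x => hrel (L ^+ d * rho x)) &
      Ftheta L V th rho = entropy L rho]].
Proof.
move=> th0 dr; have c0 : 0 <= th * L ^+ d / 2 by rewrite divr_ge0// mulr_ge0// ltW.
case: (entropy_cases dr) => [ih|Soo].
  case: (energy_cases dr) => [iW|Eoo].
    by constructor 1; split => //; rewrite massE.
  move: th0; rewrite le_eqVlt => /orP[/eqP th0|th0].
    constructor 3; split => //.
    by rewrite /Ftheta -th0 !mul0r mul0e adde0.
  constructor 2; rewrite /Ftheta entropy_finite// Eoo gt0_muley//.
  by rewrite lte_fin divr_gt0// mulr_gt0.
constructor 2; rewrite /Ftheta Soo addye// gt_eqF//.
case: (energy_cases dr) => [iW|->].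
  by rewrite (energy_finite (rdensity_measurable dr) iW) -EFinM ltNye.
move: c0; rewrite le_eqVlt => /orP[/eqP<-|c0]; first by rewrite mul0e.
by rewrite gt0_muley.
Qed.

Lemma same_densityP rho : rdensity mu rho ->
  same_density L rho (rho0 L d) <-> ae_eq mu setT rho (cst (L ^+ d)^-1).
Proof.
move=> dr; have mr := rdensity_measurable dr.
have mf : measurable_fun setT (fun x => rho x - (L ^+ d)^-1) by exact: measurable_funB.
have E : L1dist L rho (rho0 L d) = (\int[mu]_x `|(rho x - (L ^+ d)^-1)%:E|)%E.
  rewrite /L1dist iint_cellE//; apply/measurable_EFinP; exact: measurableT_comp.
have H := ae_eq_integral_abs mu measurableT ((measurable_EFinP _ _).2 mf).
rewrite /same_density E; split => [/H.1|ae].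
  by apply: filterS => x K _; have := K Logic.I => -[] /eqP; rewrite subr_eq0 => /eqP.
by apply/H; apply: filterS ae => x K _; have /= -> := K Logic.I; rewrite subrr.
Qed.

Lemma same_density_rel_entropy rho : rdensity mu rho ->
  same_density L rho (rho0 L d) -> rel_entropy mu rho = 0.
Proof.
move=> dr /(same_densityP dr) ae; rewrite /rel_entropy /Rintegral massE.
rewrite (@ae_eq_integral _ _ _ mu setT (cst 0%E))//; first by rewrite integral0.
- apply/measurable_EFinP; apply: measurableT_comp; first exact: measurable_hrel.
  by apply: measurable_funM => //; exact: (rdensity_measurable dr).
- apply: filterS ae => x K _; have /= -> := K Logic.I.
  by rewrite mulfV ?gt_eqF// hrel1.
Qed.

Lemma rel_entropy_le0_same rho : rdensity mu rho ->
  intg mu (fun x => hrel (L ^+ d * rho x)) -> rel_entropy mu rho <= 0 ->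
  same_density L rho (rho0 L d).
Proof.
move=> dr ih le0; apply/(same_densityP dr); rewrite -massE.
by apply: rel_entropy_eq0; rewrite ?massE.
Qed.

Section Below.
Variable th : R.
Hypothesis th_gt0 : 0 < th.
Hypothesis th_min : forall rho, finite_energy mu W rho ->
  th * energy_gain mu W w0 rho <= rel_entropy mu rho.

Let rel_ge0 rho : rdensity mu rho -> 0 <= rel_entropy mu rho.
Proof. by apply: rel_entropy_ge0; rewrite massE. Qed.

Lemma excess_ge0 th' rho : 0 <= th' <= th -> finite_energy mu W rho -> 0 <= excess th' rho.
Proof.
move=> /andP[t0 tt] fr; have := th_min fr; have [dr _ _] := fr; have := rel_ge0 dr.
move: (rel_entropy _ _) (energy_gain _ _ _ _) => r g r0 gr.
case: (leP g 0) => g0; first by have := mulr_ge0_le0 t0 g0; lra.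
by have := ler_wpM2r (ltW g0) tt; lra.
Qed.

(** A positive gain would give [th * g <= r <= th' * g], against [th' < th]; so the gain is
    nonpositive and the entropy cannot be positive. *)
Lemma excess_le0 th' rho : 0 <= th' < th -> finite_energy mu W rho ->
  excess th' rho <= 0 -> rel_entropy mu rho <= 0.
Proof.
move=> /andP[t0 tt] fr; have := th_min fr.
move: (rel_entropy _ _) (energy_gain _ _ _ _) => r g gr.
case: (leP g 0) => g0; first by have := mulr_ge0_le0 t0 g0; lra.
by move: tt; rewrite -(ltr_pM2r g0); lra.
Qed.

Lemma rho0_minimizer th' : 0 <= th' <= th -> minimizer L V th' (rho0 L d).
Proof.
move=> tI; have /andP[t0 _] := tI.
split; first exact/density_rdensity/rdensity_rho0.
move=> sigma /density_rdensity ds; rewrite Ftheta_rho0.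
case: (Ftheta_cases t0 ds) => [fs|->|[-> ih ->]]; last first.
- rewrite entropy_finite// lee_fin !mul0r sub0r lerBrDl subrr.
  by rewrite divr_ge0 ?rel_ge0// ltW.
- by rewrite leey.
by rewrite Ftheta_finite// lee_fin lerDr divr_ge0 ?(excess_ge0 tI fs)// ltW.
Qed.

Lemma rho0_unique_minimizer th' : 0 <= th' < th -> unique_minimizer_rho0 L V th'.
Proof.
move=> tI; have /andP[t0 tt] := tI.
have min0 : minimizer L V th' (rho0 L d) by apply: rho0_minimizer; rewrite t0 ltW.
split => // rho [/density_rdensity dr rmin].
have [d0 _] := min0; have := rmin _ d0; rewrite Ftheta_rho0.
case: (Ftheta_cases t0 dr) => [fr|->//|[-> ih ->]].
  rewrite Ftheta_finite// lee_fin gerDr pmulr_lle0 ?invr_gt0// => ex.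
  apply: rel_entropy_le0_same => //; last exact: excess_le0 ex.
  by have [_ _] := fr; rewrite massE.
rewrite entropy_finite// lee_fin !mul0r sub0r gerDr pmulr_lle0 ?invr_gt0// => ex.
exact: rel_entropy_le0_same.
Qed.

Variable rho : d.-tuple R -> R.
Hypothesis fr : finite_energy mu W rho.
Hypothesis rel_gt0 : 0 < rel_entropy mu rho.
Hypothesis rel_gain : rel_entropy mu rho = th * energy_gain mu W w0 rho.

Lemma nontrivial_minimizer :
  [/\ density L rho, ~ same_density L rho (rho0 L d),
      Ftheta L V th rho = Ftheta L V th (rho0 L d),
      (energy L V rho < energy L V (rho0 L d))%E &
      (entropy L (rho0 L d) < entropy L rho)%E].
Proof.
have [dr iW] := fr; rewrite massE => ih.
have [d0 iW0] := finite_energy_rho0; rewrite massE => ih0.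
split.
- exact/density_rdensity.
- by move=> /(same_density_rel_entropy dr) r0; move: rel_gt0; rewrite r0 ltxx.
- by rewrite Ftheta_rho0 Ftheta_finite// rel_gain subrr mul0r add0r.
- have mr := rdensity_measurable dr; have mr0 := rdensity_measurable d0.
  rewrite !energy_finite//.
  rewrite kernel_form_rho0.2 lte_fin.
  have : 0 < energy_gain mu W w0 rho by rewrite -(pmulr_rgt0 _ th_gt0) -rel_gain.
  rewrite /energy_gain massE pmulr_lgt0 ?invr_gt0// subr_gt0 expr2 -mulrA ltr_pM2l//.
  by rewrite ltr_pdivlMr// mulrC.
- rewrite !entropy_finite// lte_fin rel_entropy_rho0 mul0r ltrD2r.
  by rewrite divr_gt0.
Qed.

(** Below [th] the uniform density is the unique minimizer; at [th] it shares the minimum with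
    [rho], so no larger parameter belongs to the set. *)
Lemma thetaTE : thetaT L V = th%:E.
Proof.
have [dr ns FE _ _] := nontrivial_minimizer.
apply/eqP; rewrite eq_le; apply/andP; split.
  apply: ge_ereal_sup => _ [t [t0 tP] <-]; rewrite lee_fin leNgt; apply/negP => tt.
  have [_ uniq] := tP th (introT andP (conj (ltW th_gt0) (ltW tt))).
  apply: ns; apply: uniq; split => // s ds; rewrite FE.
  have [_ H] : minimizer L V th (rho0 L d) by apply: rho0_minimizer; rewrite lexx ltW.
  exact: H.
apply/lee_addgt0Pr => e e0.
have mI : 0 <= Num.max 0 (th - e) < th.
  by rewrite le_max lexx gt_max th_gt0/= ltrBlDr ltrDl.
apply: (@le_trans _ _ ((Num.max 0 (th - e))%:E + e%:E)%E).
  by rewrite -EFinD lee_fin -lerBlDr le_max lexx orbT.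
rewrite leeD2r//; apply: ereal_sup_ubound; exists (Num.max 0 (th - e)) => //.
have /andP[m0 mt] := mI; split => // t /andP[t0 tm].
by apply: rho0_unique_minimizer; rewrite t0 (le_lt_trans tm).
Qed.

(** A critical point at or above [th] contradicts the second minimizer at [th]; one below demands a
    nonuniform minimizer at a parameter between it and [th]. A negative candidate is tested at 0,
    any other at the midpoint. *)
Lemma no_lower_critical_point : ~ exists thc, lower_critical_point L V thc.
Proof.
have [dr ns FE _ _] := nontrivial_minimizer.
move=> [thc [below above _]].
have nab t : 0 <= t < th -> thc < t -> False.
  move=> tI /above[r [rm nr]]; apply: nr.
  by have [_ uniq] := rho0_unique_minimizer tI; exact: uniq.
case: (leP th thc) => [tthc|thcth].
  have [|_ uniq] := below th; first by rewrite ltW.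
  apply: ns; apply: uniq; split => // s ds; rewrite FE.
  have [_ H] : minimizer L V th (rho0 L d) by apply: rho0_minimizer; rewrite lexx ltW.
  exact: H.
case: (ltP thc 0) => [thc0|thc0]; first by apply: (nab 0) => //; rewrite lexx.
by apply: (nab ((thc + th) / 2)); [apply/andP; split|]; lra.
Qed.
End Below.
End Functionals.

Theorem theorem2p10 (R : realType) (d : nat) (V : d.-tuple R -> R) :
  (2 <= d)%N ->
  isotropic V ->
  (exists L0 : R, forall L : R, L0 <= L -> inV L V /\ inVN L V) ->
  exists L1 : R, forall L : R, L1 <= L ->
    (~ exists thc : R, lower_critical_point L V thc) /\
    exists thT : R,
      [/\ thetaT L V = thT%:E,
          thT < thetasharp L V &
          exists rho : d.-tuple R -> R,
            density L rho /\
            ~ same_density L rho (rho0 L d) /\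
            Ftheta L V thT rho = Ftheta L V thT (rho0 L d) /\
            Ftheta L V thT (rho0 L d) =
              ereal_inf [set Ftheta L V thT sigma | sigma in @density R L d] /\
            (energy L V rho < energy L V (rho0 L d))%E /\
            (entropy L (rho0 L d) < entropy L rho)%E].
Proof.
move=> d2 isoV [L0 HL]; pose L' := Num.max L0 1.
have L0L' : L0 <= L' by rewrite le_max lexx.
have L'1 : 1 <= L' by rewrite le_max lexx orbT.
have [inV' inVN'] := HL L' L0L'.
(* The range [a] and the bound [M] found on the reference torus [L'] serve all larger tori, so one
   threshold can be fixed before [L] is given. *)
have [a [M [aL' pV]]] := inV_potential inV'.
have L'0 : 0 < L' by rewrite (lt_le_trans _ L'1).
have [|L1 L1P] := torus_transition d2 isoV pV; first by exists L'.
exists (Num.max L1 L') => L; rewrite ge_max => /andP[L1L L'L].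
have LL0 : 0 < L by rewrite (lt_le_trans L'0).
have aL : a < L / 2 by rewrite (lt_le_trans aL')// ler_pM2r.
have [_ inVNL] := HL L (le_trans L0L' L'L).
have [th [th0 thsharp thmin [rho [fr rpos rE]]]] := L1P L L1L LL0 aL inVNL.
split; first exact: (no_lower_critical_point LL0 aL pV th0 thmin fr rpos rE).
exists th; split => //; first exact: (thetaTE LL0 aL pV th0 thmin fr rpos rE).
have [dr ns FE En Sn] := nontrivial_minimizer LL0 aL pV th0 fr rpos rE.
exists rho; do 4!split => //.
have [d0 min0] : minimizer L V th (rho0 L d).
  by apply: (rho0_minimizer LL0 aL pV thmin); rewrite lexx ltW.
apply/eqP; rewrite eq_le; apply/andP; split.
  by apply: le_ereal_inf_tmp => _ [s ds <-]; exact: min0.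
by apply: ereal_inf_lbound; exists (rho0 L d).
Qed.
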